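(* Fix a real number $q>2$ and $\lambda\in(\lambda_s,\lambda_S)$, and let $p=\lambda/n$. Consider the (discrete-time, heat-bath) Glauber dynamics for the mean-field FK model $\pi_{n,\lambda,q}$ on $n$ vertices. There exists $c=c(\lambda,q)>0$ such that for all sufficiently large $n$, its mixing time satisfies $t_{\textsc{mix}}\geq \exp(cn)$. The same lower bound (with possibly different $c>0$) holds for the Chayes--Machta dynamics for $\pi_{n,\lambda,q}$.
   Context: The mean-field FK (random cluster) model on $n$ vertices with parameters $(p,q)$, $p=\lambda/n$, $q>0$, is the probability measure $\pi_{n,\lambda,q}$ on $\omega\in\{0,1\}^{\binom{n}{2}}$ (subgraphs of the complete graph $K_n$) given by $\pi_{n,\lambda,q}(\omega)\propto p^{|E(\omega)|}(1-p)^{\binom n2-|E(\omega)|}q^{k(\omega)}$, where $E(\omega)$ is the set of open edges and $k(\omega)$ the number of connected components (clusters, counting isolated vertices). For $q>2$ define $\lambda_s=\min_{z\geq 0}\{z+\frac{qz}{e^z-1}\}$ and $\lambda_S=q$. Glauber dynamics: at each step pick a uniformly random edge $e$ of $K_n$ and resample $\omega(e)$ from $\pi_{n,\lambda,q}$ conditioned on $\omega$ off $e$. Chayes--Machta dynamics: from $\omega$, assign each cluster $C$ of $\omega$ an independent Bernoulli$(1/q)$ variable $X_C$; call a vertex active if its cluster has $X_C=1$; then resample every edge $xy$ with both $x,y$ active independently as open with probability $\lambda/n$ (all other edges unchanged), giving $\omega'$. Mixing time: $t_{\textsc{mix}}=\inf\{t:\max_{X_0}\|P^t(X_0,\cdot)-\pi\|_{\mathrm{TV}}<1/(2e)\}$.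 *)

(* Defs.v *)
From Stdlib Require Import Reals.
From mathcomp Require Import all_boot.
Set Implicit Arguments. Unset Strict Implicit. Unset Printing Implicit Defensive.

Local Open Scope R_scope.

Notation "\sumR_ ( i : T ) F" := (\big[Rplus/R0]_(i : T) F)
  (at level 41, F at level 41, i, T at level 50) : R_scope.

Notation edge n := {e : 'I_n * 'I_n | (e.1 < e.2)%N}.

Notation config n := {ffun edge n -> bool}.

Definition adj n (w : config n) : rel 'I_n :=
  fun x y => [exists e : edge n, w e &&
                 ((val e == (x, y)) || (val e == (y, x)))].

Definition n_open n (w : config n) : nat := #|[pred e : edge n | w e]|.

Definition n_clusters n (w : config n) : nat := n_comp (adj w) 'I_n.

Definition fk_weight n (lam q : R) (w : config n) : R :=
  let p := lam / INR n in
  p ^ n_open w * (1 - p) ^ (#|{: edge n}| - n_open w) * q ^ n_clusters w.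

Definition fk_pi n (lam q : R) (w : config n) : R :=
  fk_weight lam q w / (\sumR_(v : config n) fk_weight lam q v).

Definition upd n (w : config n) (e : edge n) (b : bool) : config n :=
  [ffun f => if f == e then b else w f].

(** Heat-bath Glauber dynamics: uniform edge e, resample omega(e) from pi
    conditioned on omega off e. *)
Definition glauber n (lam q : R) (w w' : config n) : R :=
  / INR #|{: edge n}| *
  \sumR_(e : edge n)
     (if w' == upd w e (w' e) then
        fk_pi lam q w' /
        (fk_pi lam q (upd w e false) + fk_pi lam q (upd w e true))
      else 0).

(** Chayes--Machta dynamics.  The active set A is a union of clusters of
    omega; each of the n_comp (adj w) A clusters in A is active w.p. 1/q and
    each of the remaining clusters inactive w.p. 1 - 1/q (independently).
    Edges with both ends active are resampled as independent Bernoulli(p);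
    all other edges are unchanged. *)
Definition cluster_union n (w : config n) (A : {set 'I_n}) : bool :=
  [forall x, forall y, connect (adj w) x y ==> ((x \in A) == (y \in A))].

Definition inside n (A : {set 'I_n}) (e : edge n) : bool :=
  ((val e).1 \in A) && ((val e).2 \in A).

Definition chayes_machta n (lam q : R) (w w' : config n) : R :=
  let p := lam / INR n in
  \sumR_(A : {set 'I_n})
    (if cluster_union w A then
       (/ q) ^ n_comp (adj w) (mem A) *
       (1 - / q) ^ (n_clusters w - n_comp (adj w) (mem A)) *
       (if [forall e, ~~ inside A e ==> (w' e == w e)] then
          \big[Rmult/R1]_(e : edge n | inside A e) (if w' e then p else 1 - p)
        else 0)
     else 0).

Fixpoint kpow (T : finType) (P : T -> T -> R) (t : nat) (x y : T) : R :=
  match t with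
  | O => if x == y then 1 else 0
  | S t' => \big[Rplus/R0]_(z : T) (kpow P t' x z * P z y)
  end.

Definition tv (T : finType) (mu nu : T -> R) : R :=
  / 2 * \big[Rplus/R0]_(y : T) Rabs (mu y - nu y).

Definition mixed_at (T : finType) (P : T -> T -> R) (pi : T -> R) (t : nat) : Prop :=
  forall x0 : T, tv (kpow P t x0) pi < / (2 * exp 1).

(** t_mix >= b, i.e. inf {t | mixed_at t} >= b (with inf of empty set = +oo). *)
Definition tmix_ge (T : finType) (P : T -> T -> R) (pi : T -> R) (b : R) : Prop :=
  forall t : nat, mixed_at P pi t -> b <= INR t.

(** z + q z / (e^z - 1), extended continuously by q at z = 0. *)
Definition lam_s_fun (q z : R) : R :=
  if Req_EM_T z 0 then q else z + q * z / (exp z - 1).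

Definition is_lambda_s (q ls : R) : Prop :=
  (exists z, 0 <= z /\ lam_s_fun q z = ls) /\
  (forall z, 0 <= z -> ls <= lam_s_fun q z).

(* Main.v *)
Require Import Defs.
From Stdlib Require Import Reals.
From mathcomp Require Import all_boot all_order all_algebra.
From mathcomp Require Import Rstruct.
From mathcomp Require Import ring lra.
Set Implicit Arguments. Unset Strict Implicit. Unset Printing Implicit Defensive.
Import Order.TTheory GRing.Theory Num.Theory.

(** Let N_K be the number of vertices in clusters of size larger than K, and
    p = lam / n. Both chains are trapped for a time exp (c n) in each of two
    disjoint sets, {N_K <= d1 n} and {N_K >= th n}; a chain trapped in two
    disjoint sets has not mixed.

    Choose an active set A as in a Chayes--Machta step: conditionally on A and
    on the edges outside A, the graph on A is Erdos--Renyi with parameter p.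
    Exploring clusters vertex by vertex shows that, outside an event of
    probability exp (- c n), every union of few clusters of this random graph
    has a size k with |A| (1 - (1 - p)^k) close to k (the graph is "typical").
    By concavity in k, if |A| p < 1 only little mass lies in large clusters, and
    if |A| p > 1 there is exactly one giant.

    Let S be one of the two sets. Activating all the clusters larger than K has
    probability at least q^(- n / K), where K is chosen after the rate c above.
    Then |A| is about n / q in the low phase, which is subcritical as lam < q,
    and at least (th + (1 - th) / q) n in the high phase, for which
    lam > lambda_s guarantees a giant larger than th n. Hence resampling A leads
    back to S, whereas a configuration of S outside a core G of "good"
    configurations would have to be atypical on A. Reversibility of the
    resampling then gives pi (S \ G) <= exp (- c n) pi (S). Finally no single
    flip leads from G out of S, and a Chayes--Machta step does so with
    exponentially small probability only. *)

Local Open Scope ring_scope.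
Local Notation R := Rdefinitions.R.
Bind Scope ring_scope with Rdefinitions.R.
#[local] Arguments exp x%_ring_scope.

(** * Exponential bounds and bottlenecks *)

(** Every estimate is relative to the mass of the trap itself, never to the partition function: it
    does not matter which phase dominates, nor that one of the two sets may have exponentially small
    mass.

    A second threshold [K0 <= K] breaks a circularity. A seed reveals clusters larger than [K0] only
    if the clusters of size at most [K0] that it meets are negligible, so it has at most of order
    [n / K0] vertices, and its exploration must be controlled on that scale. Hence the tolerances,
    and with them the rate [c1], depend on [K0]. Activating all the clusters larger than [K] costs a
    factor [exp (q n / K)], for which [c1] can pay only if [K] is large compared with [1 / c1].
    Clusters of intermediate size are therefore not forced to be active. Instead their active share
    is kept near [1 / q]: if a typical graph on the active set has few vertices in them, then few
    exist at all. *)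

Lemma exp_ge1Dx (x : R) : 1 + x <= exp x.
Proof. exact/RleP/exp_ineq1_le. Qed.

Lemma exp_ge0 (x : R) : 0 <= exp x.
Proof. exact/RleP/Rlt_le/exp_pos. Qed.

Lemma exp_gt0 (x : R) : 0 < exp x.
Proof. exact/RltP/exp_pos. Qed.

Lemma ler_exp (x y : R) : x <= y -> exp x <= exp y.
Proof.
rewrite le_eqVlt => /orP[/eqP -> //|/RltP xy].
exact/RleP/Rlt_le/exp_increasing.
Qed.

Lemma expD (x y : R) : exp (x + y) = exp x * exp y.
Proof. exact: exp_plus. Qed.

Lemma exp0 : exp 0 = 1 :> R.
Proof. exact: exp_0. Qed.

Lemma expN (x : R) : exp (- x) = (exp x)^-1.
Proof.
by apply: (mulfI (lt0r_neq0 (exp_gt0 x))); rewrite -expD addrN exp0 divff //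
  lt0r_neq0 // exp_gt0.
Qed.

Lemma expM_nat (x : R) (k : nat) : exp (x * k%:R) = exp x ^+ k.
Proof.
elim: k => [|k IH]; first by rewrite mulr0 exp0 expr0.
by rewrite -addn1 natrD mulrDr mulr1 expD IH addn1 exprSr.
Qed.

(** From [1 - t <= exp (- t)] follows [(1 - t) exp t <= 1], while [(1 - t) (1 + t + 2 t^2) = 1 + t^2
    (1 - 2 t)] is at least 1. Negative [t] is allowed, so the bound serves both tails of the
    Chernoff estimates. *)
Lemma exp_le_quad (t : R) : t <= 1 / 2 -> exp t <= 1 + t + 2 * t ^+ 2.
Proof.
move=> t2.
have h := exp_ge1Dx (- t); rewrite expN in h.
have e0 := exp_gt0 t.
have h1 : (1 - t) * exp t <= 1.
  by rewrite -[leRHS](mulVf (lt0r_neq0 e0)) ler_wpM2r // exp_ge0.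
have h2 : 1 <= (1 - t) * (1 + t + 2 * t ^+ 2).
  have -> : (1 - t) * (1 + t + 2 * t ^+ 2) = 1 + t ^+ 2 * (1 - 2 * t) by ring.
  have : 0 <= t ^+ 2 * (1 - 2 * t) by apply: mulr_ge0; [exact: sqr_ge0 | lra].
  lra.
have t1 : 0 < 1 - t by lra.
by rewrite -(ler_pM2l t1) (le_trans h1).
Qed.

(** With [12 / 5] the mixing errors [1 / e] of two traps add up to at most [5 / 6], and the
    remaining [1 / 6] must come from the flow. *)
Lemma exp1_gt : 12 / 5 < exp 1 :> R.
Proof.
have -> : 1 = 1 / 4 * 4%:R :> R by lra.
rewrite expM_nat; apply: (@lt_le_trans _ _ ((5 / 4) ^+ 4)); first by lra.
apply: lerXn2r; rewrite ?nnegrE ?exp_ge0 //; first by lra.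
by apply: le_trans (exp_ge1Dx _); lra.
Qed.

Section Bottleneck.

Variables (T : finType) (P : T -> T -> R) (mu : T -> R).
Hypothesis P_ge0 : forall x y, 0 <= P x y.
Hypothesis P_row : forall x, \sum_y P x y = 1.
Hypothesis mu_gt0 : forall x, 0 < mu x.
Hypothesis mu_sum : \sum_x mu x = 1.
Hypothesis mu_rev : forall x y, mu x * P x y = mu y * P y x.

Let kpowS t x y : kpow P t.+1 x y = \sum_z kpow P t x z * P z y.
Proof. by []. Qed.

Let kpow0 x y : kpow P 0 x y = (x == y)%:R.
Proof. by rewrite /=; case: eqP. Qed.

Let kpow_ge0 t x y : 0 <= kpow P t x y.
Proof.
elim: t y => [|t IH] y; first by rewrite kpow0 ler0n.
by rewrite kpowS; apply: sumr_ge0 => z _; apply: mulr_ge0.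
Qed.

Let stationary y : \sum_x mu x * P x y = mu y.
Proof.
under eq_bigr do rewrite mu_rev.
by rewrite -mulr_sumr P_row mulr1.
Qed.

(** By stationarity, the chain started from [mu] restricted to [S] stays below [mu] at all times. *)
Let kpow_restr_le (S : {set T}) t z : \sum_(x in S) mu x * kpow P t x z <= mu z.
Proof.
elim: t z => [|t IH] z.
  under eq_bigr do rewrite kpow0.
  rewrite (big_mkcond (fun x => x \in S)) (bigD1 z) //= eqxx mulr1 big1 ?addr0; last first.
    by move=> x /negbTE ->; rewrite mulr0 if_same.
  by case: ifP => // _; apply: ltW.
under eq_bigr do rewrite kpowS mulr_sumr.
rewrite exchange_big /= -[leRHS]stationary.
apply: ler_sum => u _; under eq_bigr do rewrite mulrA.
by rewrite -mulr_suml; apply: ler_wpM2r.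
Qed.

(** In one more step the mass outside grows by at most what crosses from [S], and [kpow_restr_le]
    bounds this by the stationary flow. *)
Lemma kpow_escape (S : {set T}) t :
  \sum_(x in S) mu x * \sum_(y in ~: S) kpow P t x y <=
  t%:R * \sum_(x in S) mu x * \sum_(y in ~: S) P x y.
Proof.
set Q := \sum_(x in S) mu x * \sum_(y in ~: S) P x y.
elim: t => [|t IH].
  rewrite mul0r big1 // => x xS; rewrite big1 ?mulr0 // => y.
  rewrite inE kpow0; case: eqP => // <-; by rewrite xS.
have step x : \sum_(y in ~: S) kpow P t.+1 x y <=
    \sum_(z in S) kpow P t x z * (\sum_(y in ~: S) P z y) +
    \sum_(z in ~: S) kpow P t x z.
  under eq_bigr do rewrite kpowS.
  rewrite exchange_big /= (bigID (mem S)) /=.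
  apply: lerD.
    by apply: ler_sum => z _; rewrite mulr_sumr lexx.
  rewrite (eq_bigl (fun z => z \in ~: S)) => [|z]; last by rewrite in_setC.
  apply: ler_sum => z _; rewrite -mulr_sumr ler_piMr //.
  rewrite -(P_row z) [leRHS](bigID (mem (~: S))) /= lerDl.
  by apply: sumr_ge0.
apply: (@le_trans _ _ (\sum_(x in S) mu x * (\sum_(z in S) kpow P t x z *
    (\sum_(y in ~: S) P z y)) + \sum_(x in S) mu x * \sum_(z in ~: S) kpow P t x z)).
  rewrite -big_split /=; apply: ler_sum => x _; rewrite -mulrDr.
  by apply: ler_wpM2l (step x); exact: ltW.
rewrite -natr1 mulrDl mul1r addrC; apply: lerD => //.
under eq_bigr do rewrite mulr_sumr.
rewrite exchange_big /=; apply: ler_sum => z _.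
under eq_bigr do rewrite mulrA.
rewrite -mulr_suml; apply: ler_wpM2r => //.
exact: sumr_ge0.
Qed.

Let mixed_complement (S : {set T}) t eps : S != set0 ->
  \sum_(x in S) mu x * \sum_(y in ~: S) P x y <= eps * \sum_(x in S) mu x ->
  mixed_at P mu t -> \sum_(y in ~: S) mu y <= t%:R * eps + (exp 1)^-1.
Proof.
move=> /set0Pn[x0 x0S] flow mix.
(* By averaging over [S], some starting point escapes with probability at most [t eps]; the mixing
   condition, uniform in the start, is applied there. *)
case: (boolP [exists x in S, \sum_(y in ~: S) kpow P t x y <= t%:R * eps]); last first.
  rewrite negb_exists_in => /forall_inP far.
  have : \sum_(x in S) mu x * (t%:R * eps) < \sum_(x in S) mu x * \sum_(y in ~: S) kpow P t x y.
    apply: ltr_sum => [|x xS]; first by apply/hasP; exists x0; rewrite ?mem_index_enum.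
    by rewrite ltr_pM2l // ltNge far.
  have := kpow_escape S t; rewrite -mulr_suml => e1 e2.
  have := lt_le_trans e2 e1; rewrite ltNge mulrCA ler_wpM2l ?ler0n //.
  by rewrite mulrC.
case/exists_inP => x _ near.
have /RltP := mix x; rewrite /tv => lt_tv.
have {}lt_tv : \sum_y `|kpow P t x y - mu y| < (exp 1)^-1.
  suff: 2^-1 * \sum_y `|kpow P t x y - mu y| < 2^-1 * (exp 1)^-1 by rewrite ltr_pM2l // invr_gt0.
  rewrite -invfM; move: lt_tv; rewrite !RinvE.
  by under eq_bigr do rewrite RabsE.
apply: le_trans (lerD near (ltW lt_tv)).
rewrite [X in _ <= _ + X](bigID (mem (~: S))) /= addrA.
apply: le_trans (_ : _ <= \sum_(y in ~: S) kpow P t x y + \sum_(y in ~: S) `|kpow P t x y - mu y|) _.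
  rewrite -big_split /=; apply: ler_sum => y _.
  rewrite -lerBlDl -[leRHS]normrN opprB.
  exact: ler_norm.
by rewrite lerDl; apply: sumr_ge0.
Qed.

Lemma two_traps (S S' : {set T}) t eps : S != set0 -> S' != set0 -> [disjoint S & S'] ->
  \sum_(x in S) mu x * \sum_(y in ~: S) P x y <= eps * \sum_(x in S) mu x ->
  \sum_(x in S') mu x * \sum_(y in ~: S') P x y <= eps * \sum_(x in S') mu x ->
  mixed_at P mu t -> 1 <= 12 * eps * t%:R.
Proof.
move=> S0 S'0 dis fS fS' mix.
have h1 := mixed_complement S0 fS mix; have h2 := mixed_complement S'0 fS' mix.
have : 1 <= \sum_(y in ~: S) mu y + \sum_(y in ~: S') mu y.
  rewrite -mu_sum (bigID (mem (~: S))) /= lerD2l.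
  rewrite [leRHS](bigID (mem S)) /= -[leLHS]addr0; apply: lerD; last first.
    by apply: sumr_ge0 => i _; exact: ltW.
  rewrite le_eqVlt; apply/orP; left; apply/eqP/eq_bigl => y; rewrite !inE negbK.
  by case yS: (y \in S); rewrite ?andbF // andbT (disjointFr dis).
have : (exp 1)^-1 <= 5 / 12 :> R.
  rewrite -[leRHS]invrK lef_pV2 ?posrE ?exp_gt0 //; last by lra.
  by have := exp1_gt; lra.
nra.
Qed.

End Bottleneck.

(** * Clusters *)

Lemma connect_ind_pred (T : finType) (e : rel T) (X : pred T) x y :
  X x -> (forall u v, X u -> e u v -> X v) -> connect e x y -> X y.
Proof.
move=> Xx step /connectP[s + ->]; elim: s x Xx => //= u s IH x Xx /andP[exu pth].
by apply: IH pth; exact: step exu.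
Qed.

Section Graphs.

Variable n : nat.
Implicit Types (w : config n) (A B : {set 'I_n}) (x y z : 'I_n) (e : edge n).

Lemma adj_sym w : symmetric (adj w).
Proof. by move=> x y; apply: eq_existsb => e; rewrite orbC. Qed.

Lemma adjP w x y :
  reflect (exists2 e : edge n, w e & val e = (x, y) \/ val e = (y, x)) (adj w x y).
Proof.
apply: (iffP existsP) => [[e /andP[we /orP[] /eqP h]]|[e we h]].
- by exists e => //; left.
- by exists e => //; right.
- by exists e; rewrite we; case: h => ->; rewrite eqxx ?orbT.
Qed.

Lemma adj_connect_sym w : connect_sym (adj w).
Proof. exact/sym_connect_sym/adj_sym. Qed.

Definition cl w x : {set 'I_n} := [set y | connect (adj w) x y].

Definition big (K : nat) w : {set 'I_n} := [set x | K < #|cl w x|]%N.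

Lemma mem_cl w x : x \in cl w x.
Proof. by rewrite inE connect0. Qed.

Lemma cl_eq w x y : y \in cl w x -> cl w y = cl w x.
Proof.
rewrite inE => xy; apply/setP => z; rewrite !inE.
by rewrite (same_connect (adj_connect_sym w) xy).
Qed.

Lemma cl_sym w x y : (y \in cl w x) = (x \in cl w y).
Proof. by rewrite !inE adj_connect_sym. Qed.

Lemma cluster_unionP w A :
  reflect (forall x y, adj w x y -> (x \in A) = (y \in A)) (cluster_union w A).
Proof.
apply: (iffP forallP) => [h x y axy|h x].
  by have /forallP/(_ y)/implyP/(_ (connect1 axy))/eqP := h x.
apply/forallP => y; apply/implyP => xy.
apply: (@connect_ind_pred _ (adj w) (fun z => (x \in A) == (z \in A)) x) xy => //.
by move=> u v /eqP -> /h ->.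
Qed.

Lemma cluster_union_cl w A x : cluster_union w A -> x \in A -> cl w x \subset A.
Proof.
move=> /forallP h xA; apply/subsetP => y; rewrite inE => xy.
by have /forallP/(_ y)/implyP/(_ xy)/eqP <- := h x.
Qed.

Lemma cluster_union_compl w A : cluster_union w (~: A) = cluster_union w A.
Proof.
apply/idP/idP => /cluster_unionP h; apply/cluster_unionP => x y /h; rewrite !inE.
  exact: negb_inj.
by move=> ->.
Qed.

Definition agree A w w' := [forall e, ~~ inside A e ==> (w' e == w e)].

Lemma agreeP A w w' :
  reflect (forall e, ~~ inside A e -> w' e = w e) (agree A w w').
Proof.
apply: (iffP forallP) => h e; first by move=> ne; have /implyP/(_ ne)/eqP := h e.
by apply/implyP => ne; rewrite h.
Qed.

Lemma agree_sym A w w' : agree A w w' = agree A w' w.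
Proof. by apply: eq_forallb => e; rewrite eq_sym. Qed.

Lemma agree_adj A w w' x y : agree A w w' -> ~~ ((x \in A) && (y \in A)) ->
  adj w' x y = adj w x y.
Proof.
move=> /agreeP ag nA; apply/adjP/adjP => -[e we ve]; exists e => //.
  by rewrite -ag //; case: ve => ve; rewrite /inside ve //= andbC.
by rewrite ag //; case: ve => ve; rewrite /inside ve //= andbC.
Qed.

Lemma agree_union A w w' : agree A w w' -> cluster_union w A -> cluster_union w' A.
Proof.
move=> ag /cluster_unionP cu; apply/cluster_unionP => x y.
case: (boolP ((x \in A) && (y \in A))) => [/andP[-> ->] //|nA].
by rewrite (agree_adj ag nA) => /cu.
Qed.

Lemma agree_connect A w w' x y : agree A w w' -> cluster_union w A ->
  x \notin A -> connect (adj w') x y = connect (adj w) x y.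
Proof.
have half v v' : agree A v v' -> cluster_union v A -> x \notin A ->
    connect (adj v) x y -> connect (adj v') x y.
  move=> ag cu xA xy.
  suff: (y \notin A) && connect (adj v') x y by case/andP.
  apply: (@connect_ind_pred _ (adj v) (fun z => (z \notin A) && connect (adj v') x z)) xy.
    by rewrite xA connect0.
  move=> u z /andP[uA xu] uz; move/cluster_unionP: (cu) => /(_ _ _ uz) => <-.
  rewrite uA (connect_trans xu) // connect1 //.
  by rewrite (agree_adj ag) // negb_and uA.
move=> ag cu xA; apply/idP/idP; last exact: half.
apply: half xA; [by rewrite agree_sym | exact: agree_union cu].
Qed.

Lemma agree_cl A w w' x : agree A w w' -> cluster_union w A ->
  x \notin A -> cl w' x = cl w x.
Proof. by move=> ag cu xA; apply/setP => y; rewrite !inE (agree_connect _ ag). Qed.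

Lemma n_comp_le w A : (n_comp (adj w) (mem A) <= n_clusters w)%N.
Proof.
by apply: subset_leq_card; apply/subsetP => x; rewrite !inE => /andP[-> _].
Qed.

Lemma n_comp_diff w A : (n_clusters w - n_comp (adj w) (mem A))%N =
  #|[set x | roots (adj w) x & x \notin A]|.
Proof.
have -> : n_clusters w = #|[set x | roots (adj w) x]|.
  by apply: eq_card => x; rewrite !inE andbT.
rewrite -(cardsID A [set x | roots (adj w) x]).
have -> : n_comp (adj w) (mem A) = #|[set x | roots (adj w) x] :&: A|.
  by apply: eq_card => x; rewrite !inE.
by rewrite addKn; apply: eq_card => x; rewrite !inE andbC.
Qed.

(** A vertex outside a union of clusters keeps its cluster and hence its root. This invariance of
    the number of inactive clusters makes the Chayes--Machta step reversible. *)
Lemma agree_n_comp A w w' : agree A w w' -> cluster_union w A ->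
  (n_clusters w' - n_comp (adj w') (mem A))%N = (n_clusters w - n_comp (adj w) (mem A))%N.
Proof.
move=> ag cu; apply: etrans (n_comp_diff w' A) (etrans _ (esym (n_comp_diff w A))).
congr (#|pred_of_set _|); apply/eq_finset => x.
have [xA|xA] := boolP (x \in A); first by rewrite !andbF.
rewrite !andbT; suff e : fingraph.root (adj w') x = fingraph.root (adj w) x by rewrite /roots e.
congr odflt; apply: eq_pick => y; exact: agree_connect ag cu xA.
Qed.

End Graphs.

(** * The kernels *)

(** An active cluster contributes [q q^-1 = 1], an inactive one [q (1 - q^-1) = q - 1]. *)
Lemma expr_split_inv (x : R) (k m : nat) : x != 0 -> (m <= k)%N ->
  x ^+ k * (x^-1 ^+ m * (1 - x^-1) ^+ (k - m)) = (x - 1) ^+ (k - m).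
Proof.
move=> x0 mk; rewrite -{1}(subnKC mk) exprD mulrACA -!exprMn.
by rewrite divff // expr1n mul1r mulrBr mulr1 divff.
Qed.

Lemma mulr_null_r (a b c d : R) : a * (b * 0) = c * (d * 0).
Proof. by rewrite !mulr0. Qed.

Lemma mulr_null_l (a b c d : R) : a * (0 * b) = c * (0 * d).
Proof. by rewrite !mul0r !mulr0. Qed.

(** Detailed balance in the abstract: [o] stands for the edge weights outside the active set, [i]
    and [i'] for those inside, [k] and [k'] for the cluster weights, [a] and [a'] for the activation
    probabilities, [z] for the partition function. *)
Lemma swap_factors (o i i' k k' a a' d z : R) : k * a = d -> k' * a' = d ->
  o * i * k / z * (a * i') = o * i' * k' / z * (a' * i).
Proof.
move=> h h'; transitivity (o * i * i' * (k * a) / z); first by ring.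
by rewrite h -h'; ring.
Qed.

Section Kernels.

Variables (n : nat) (p q : R).
Implicit Types (w : config n) (A B : {set 'I_n}) (e : edge n).

Definition bern (b : bool) : R := if b then p else 1 - p.

(* The two stages of a Chayes--Machta step: [act w A] is the probability that
   [A] is the active set, [res A w] the law of the configuration resampled in [A].
   Both are locked because unification otherwise unfolds the real arithmetic. *)
Definition act w A : R :=
  locked (if cluster_union w A then
    (q^-1) ^+ n_comp (adj w) (mem A) *
    (1 - q^-1) ^+ (n_clusters w - n_comp (adj w) (mem A))
  else 0).

Definition res A w w' : R :=
  locked (\prod_e (if inside A e then bern (w' e) else (w' e == w e)%:R)).

Lemma res_agree A w w' : res A w w' != 0 -> agree A w w'.
Proof.
apply: contraR => /forallPn[e]; rewrite negb_imply => /andP[ne we].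
by rewrite /res -lock (bigD1 e) //= (negbTE ne) (negbTE we) mul0r.
Qed.

Lemma resE A w w' : agree A w w' -> res A w w' = \prod_(e | inside A e) bern (w' e).
Proof.
move=> /agreeP ag; rewrite /res -lock (bigID (inside A)) /=.
rewrite [X in _ * X]big1 ?mulr1; last by move=> e ne; rewrite (negbTE ne) ag ?eqxx.
by apply: eq_bigr => e ->.
Qed.

Lemma res_row A w : \sum_w' res A w w' = 1.
Proof.
rewrite /res; under eq_bigr do rewrite -lock.
rewrite -(bigA_distr_bigA (fun e b => if inside A e then bern b else (b == w e)%:R)) /=.
apply: big1 => e _; rewrite big_bool /=.
by case: ifP => _; [rewrite /bern; ring | case: (w e); rewrite /= ?addr0 ?add0r].
Qed.

Lemma res_ge0 A w w' : 0 <= p <= 1 -> 0 <= res A w w'.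
Proof.
move=> /andP[p0 p1]; rewrite /res -lock; apply: prodr_ge0 => e _; case: ifP => _; last exact: ler0n.
by rewrite /bern; case: (w' e); rewrite ?subr_ge0.
Qed.

Lemma actE w A : cluster_union w A ->
  act w A = \prod_(x | roots (adj w) x) (if x \in A then q^-1 else 1 - q^-1).
Proof.
move=> cu; rewrite /act -lock cu n_comp_diff (bigID (mem A)) /=; congr (_ * _).
  rewrite (eq_bigr (fun=> q^-1)); last by move=> x /andP[_ ->].
  by rewrite prodr_const; congr (_ ^+ _).
rewrite (eq_bigr (fun=> 1 - q^-1)); last by move=> x /andP[_ /negbTE ->].
rewrite prodr_const; congr (_ ^+ _); apply: eq_card => x.
by rewrite in_set.
Qed.

Lemma act_ge0 w A : 1 < q -> 0 <= act w A.
Proof.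
move=> q1; rewrite /act -lock; case: ifP => // _.
have q0 : 0 < q by lra.
by apply: mulr_ge0; apply: exprn_ge0; rewrite ?subr_ge0 ?invf_le1 ?invr_ge0 // ltW.
Qed.

(** Cluster unions correspond to sets of roots, and the roots are marked independently, so the mean
    of a product over the roots factorises. *)
Lemma act_sum w (g h : 'I_n -> R) :
  \sum_A act w A * \prod_(x | roots (adj w) x) (if x \in A then g x else h x) =
  \prod_(x | roots (adj w) x) (q^-1 * g x + (1 - q^-1) * h x).
Proof.
(* Off the roots [F] is 0 and [G] is 1: in the expansion over all vertex sets only the sets of roots
   survive. *)
pose F x := if roots (adj w) x then q^-1 * g x else 0.
pose G x := if roots (adj w) x then (1 - q^-1) * h x else 1.
have -> : \prod_(x | roots (adj w) x) (q^-1 * g x + (1 - q^-1) * h x) = \prod_x (F x + G x).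
  rewrite big_mkcond /=; apply: eq_bigr => x _; rewrite /F /G.
  by case: ifP; rewrite ?add0r.
rewrite bigA_distr /=.
pose rt := fingraph.root (adj w).
have rt_roots x : roots (adj w) (rt x) by apply: (roots_root (adj_connect_sym w)).
have cl_rt x : connect (adj w) x (rt x) by apply: connect_root.
pose hull (J : {set 'I_n}) := [set x | rt x \in J].
rewrite (bigID (fun A => cluster_union w A)) /= [X in _ + X]big1 ?addr0; last first.
  by move=> A /negbTE cu; rewrite /act -lock cu mul0r.
rewrite (reindex_onto hull (fun A => [set x in A | roots (adj w) x])); last first.
  move=> A /forallP cu; apply/setP => x; rewrite !inE rt_roots andbT.
  by have /forallP/(_ (rt x))/implyP/(_ (cl_rt x))/eqP -> := cu x.
rewrite [RHS](bigID (fun J : {set 'I_n} => J \subset [set x | roots (adj w) x])) /=.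
rewrite [X in _ = _ + X]big1 ?addr0; last first.
  move=> J /subsetPn[x xJ]; rewrite inE => nr.
  by rewrite (bigD1 x) //= xJ /F (negbTE nr) mul0r.
have hullU J : cluster_union w (hull J).
  apply/cluster_unionP => x y xy; rewrite !inE.
  by have -> : rt x = rt y by apply/eqP; rewrite (root_connect (adj_connect_sym w)) connect1.
have mem_hull J x : roots (adj w) x -> (x \in hull J) = (x \in J).
  by move=> /eqP rx; rewrite inE /rt rx.
apply: eq_big => [J|J].
  rewrite hullU /=; apply/eqP/subsetP => [<- x|sub]; first by rewrite !inE => /andP[].
  apply/setP => x; rewrite !inE; case: (boolP (roots (adj w) x)) => [/eqP rx|nr].
    by rewrite andbT /rt rx.
  by rewrite andbF; apply/esym/negP => /sub; rewrite inE (negbTE nr).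
move=> /andP[_ /eqP hJ]; rewrite actE // -big_split /= big_mkcond /=.
apply: eq_bigr => x _; rewrite /F /G; case: ifP => [rx|nr]; first by rewrite mem_hull //; case: ifP.
by rewrite -hJ inE nr andbF.
Qed.

Lemma act_row w : \sum_A act w A = 1.
Proof.
have := act_sum w (fun=> 1) (fun=> 1); rewrite (eq_bigr (act w)) => [->|A _].
  by apply: big1 => x _; ring.
by rewrite big1 ?mulr1 // => x _; rewrite if_same.
Qed.

End Kernels.

(** * Stationarity and reversibility of the two chains *)

Section Reversible.

Variables (n : nat) (lam q : R).
Hypotheses (n0 : (0 < n)%N) (lam0 : 0 < lam) (lamn : lam < n%:R) (q1 : 1 < q).
Let p := lam / n%:R.
Implicit Types (w : config n) (A B : {set 'I_n}) (e : edge n).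

Lemma p_bounds : 0 < p < 1.
Proof.
have n0' : 0 < n%:R :> R by rewrite ltr0n.
by rewrite /p divr_gt0 //= ltr_pdivrMr // mul1r.
Qed.

Lemma fk_weightE w :
  fk_weight lam q w = (\prod_e bern p (w e)) * q ^+ n_clusters w.
Proof.
rewrite /fk_weight INRE !RpowE RdivE RminusE; congr (_ * _).
rewrite [RHS](bigID (fun e => w e)) /=; congr (_ * _).
  rewrite (eq_bigr (fun=> p)); last by move=> e ->.
  by rewrite prodr_const.
rewrite (eq_bigr (fun=> 1 - p)); last by move=> e /negbTE ->.
rewrite prodr_const; congr (_ ^+ _); rewrite /n_open -(cardC [pred e | w e]) addKn.
exact: eq_card.
Qed.

Lemma fk_weight_gt0 w : 0 < fk_weight lam q w.
Proof.
rewrite fk_weightE; have /andP[p0 p1] := p_bounds.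
apply: mulr_gt0; last by apply/exprn_gt0/(lt_trans _ q1).
by apply: prodr_gt0 => e _; rewrite /bern; case: (w e); rewrite ?subr_gt0.
Qed.

Let Z := \sum_(v : config n) fk_weight lam q v.

Let Z_gt0 : 0 < Z.
Proof.
rewrite /Z (bigD1 [ffun=> false]) //=; apply: ltr_wpDr; last exact: fk_weight_gt0.
by apply: sumr_ge0 => w _; exact/ltW/fk_weight_gt0.
Qed.

Let fk_piE w : fk_pi lam q w = fk_weight lam q w / Z.
Proof. by rewrite /fk_pi RdivE. Qed.

Lemma fk_pi_gt0 w : 0 < fk_pi lam q w.
Proof. by rewrite fk_piE divr_gt0 ?fk_weight_gt0. Qed.

Lemma fk_pi_sum : \sum_(w : config n) fk_pi lam q w = 1.
Proof.
under eq_bigr do rewrite fk_piE.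
by rewrite -mulr_suml divff // lt0r_neq0.
Qed.

Lemma chayes_machtaE w w' :
  chayes_machta lam q w w' = \sum_A act q w A * res p A w w'.
Proof.
apply: eq_bigr => A _; rewrite /act -lock; case: ifP => _; last by rewrite mul0r.
rewrite !RpowE RminusE RinvE INRE !RmultE; congr (_ * _).
case: ifP => [ag|]; first by rewrite (resE _ ag); apply: eq_bigr => e _; rewrite RdivE.
by move=> nag; apply/esym/eqP; apply: contraFT nag; exact: res_agree.
Qed.

Lemma fk_pi_act_res_rev A w w' :
  fk_pi lam q w * (act q w A * res p A w w') =
  fk_pi lam q w' * (act q w' A * res p A w' w).
Proof.
case: (boolP (agree A w w')) => [ag|nag]; last first.
  have -> : res p A w w' = 0 by apply/eqP; apply: contraR nag; exact: res_agree.
  have -> : res p A w' w = 0.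
    by apply/eqP; apply: contraR nag => /res_agree; rewrite agree_sym.
  exact: mulr_null_r.
have q0 : q != 0 by apply/lt0r_neq0/(lt_trans _ q1).
case: (boolP (cluster_union w A)) => cu; last first.
  have cu' : ~~ cluster_union w' A.
    by apply: contra cu; apply: agree_union; rewrite agree_sym.
  have act0 v : ~~ cluster_union v A -> act q v A = 0 by move=> /negbTE cv; rewrite /act cv -lock.
  by rewrite (act0 w) // (act0 w') //; exact: mulr_null_l.
have cu' := agree_union ag cu.
have nE := agree_n_comp ag cu.
have qE v : cluster_union v A -> q ^+ n_clusters v * act q v A =
    (q - 1) ^+ (n_clusters v - n_comp (adj v) (mem A)).
  by move=> cv; rewrite /act -lock cv; apply: expr_split_inv q0 (n_comp_le v A).
have offE : \prod_(e | ~~ inside A e) bern p (w' e) = \prod_(e | ~~ inside A e) bern p (w e).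
  by apply: eq_bigr => e ne; move/agreeP: ag => ->.
have wE v : \prod_e bern p (v e) =
    \prod_(e | ~~ inside A e) bern p (v e) * \prod_(e | inside A e) bern p (v e).
  by rewrite (bigID (inside A)) mulrC.
rewrite !fk_piE !fk_weightE (resE _ ag) resE; last by rewrite agree_sym.
rewrite (wE w) (wE w') offE; apply: swap_factors (qE _ cu) _.
by rewrite -nE; apply: qE.
Qed.

Lemma chayes_machta_rev w w' :
  fk_pi lam q w * chayes_machta lam q w w' = fk_pi lam q w' * chayes_machta lam q w' w.
Proof.
rewrite !chayes_machtaE.
move: (fk_pi _ _ w) (fk_pi _ _ w') (fun A => fk_pi_act_res_rev A w w') => a b rev.
by rewrite !mulr_sumr; apply: eq_bigr => A _; exact: rev.
Qed.

Lemma chayes_machta_row w : \sum_w' chayes_machta lam q w w' = 1.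
Proof.
under eq_bigr do rewrite chayes_machtaE.
rewrite exchange_big /= -[RHS](act_row q w).
by apply: eq_bigr => A _; rewrite -mulr_sumr res_row mulr1.
Qed.

Lemma chayes_machta_ge0 w w' : 0 <= chayes_machta lam q w w'.
Proof.
rewrite chayes_machtaE; apply: sumr_ge0 => A _; apply: mulr_ge0; first exact: act_ge0.
by apply: res_ge0; have /andP[/ltW -> /ltW ->] := p_bounds.
Qed.

Lemma updK w e b b' : upd (upd w e b) e b' = upd w e b'.
Proof. by apply/ffunP => f; rewrite !ffunE; case: (f == e). Qed.

Lemma upd_id w e : upd w e (w e) = w.
Proof. by apply/ffunP => f; rewrite !ffunE; case: eqP => [->|]. Qed.

Lemma updE w e b : upd w e b e = b.
Proof. by rewrite ffunE eqxx. Qed.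

Lemma glauberE w w' : glauber lam q w w' =
  #|{: edge n}|%:R^-1 * \sum_e (if w' == upd w e (w' e) then fk_pi lam q w' /
     (fk_pi lam q (upd w e false) + fk_pi lam q (upd w e true)) else 0).
Proof. by rewrite /glauber INRE. Qed.

Lemma glauber_rev w w' :
  fk_pi lam q w * glauber lam q w w' = fk_pi lam q w' * glauber lam q w' w.
Proof.
rewrite !glauberE; move: (@fk_pi n lam q) => pi.
rewrite mulrCA [RHS]mulrCA; congr (_ * _); rewrite !mulr_sumr; apply: eq_bigr => e _.
have half (v v' : config n) : v' == upd v e (v' e) -> v == upd v' e (v e).
  by move=> /eqP {1}->; rewrite updK upd_id eqxx.
case: ifP => [h|h].
  rewrite (half _ _ h); move/eqP: h => h.
  by rewrite [in RHS]h !updK -h; ring.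
by case: ifP => [/half|_]; [rewrite h | rewrite !mulr0].
Qed.

Lemma glauber_ge0 w w' : 0 <= glauber lam q w w'.
Proof.
rewrite glauberE; move: (@fk_pi n lam q) fk_pi_gt0 => pi pi_gt0; apply: mulr_ge0; first by rewrite invr_ge0 ler0n.
apply: sumr_ge0 => e _; case: ifP => // _.
by apply: divr_ge0; rewrite ?addr_ge0 // ltW ?pi_gt0.
Qed.

Lemma glauber_row w : (1 < n)%N -> \sum_w' glauber lam q w w' = 1.
Proof.
move=> n1; under eq_bigr do rewrite glauberE.
move: (@fk_pi n lam q) fk_pi_gt0 => pi pi_gt0.
rewrite -mulr_sumr exchange_big /=.
rewrite (eq_bigr (fun=> 1)) => [|e _]; last first.
  rewrite -big_mkcond /=.
  have neq : upd w e true != upd w e false.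
    by apply/eqP => /ffunP/(_ e); rewrite !updE.
  rewrite (bigD1 (upd w e true)) ?updE //= (bigD1 (upd w e false)) ?updE ?eqxx ?neq 1?eq_sym //=.
  rewrite big1 ?addr0 => [|v]; last first.
    by case/andP => /andP[/eqP {1 2}->]; case: (v e); rewrite eqxx ?andbF.
  by rewrite addrC -mulrDl divff // lt0r_neq0 // addr_gt0 ?pi_gt0.
rewrite sumr_const -[1 *+ _]/(_%:R) mulVf // pnatr_eq0 -lt0n.
have lt01 : (Ordinal n0 < Ordinal n1)%N by [].
by apply/card_gt0P; exists (exist _ (Ordinal n0, Ordinal n1) lt01).
Qed.

End Reversible.

(** * Exploration of an Erdos--Renyi graph *)

Section Exploration.

Variables (n : nat) (p : R) (A0 : {set 'I_n}) (w0 : config n).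
Hypothesis p01 : 0 <= p <= 1.
Implicit Types (w : config n) (A B : {set 'I_n}) (x y z v : 'I_n) (e : edge n) (F : config n -> R).

Definition radj w A : rel 'I_n := fun x y => [&& x \in A, y \in A & adj w x y].

Definition reach w A B : {set 'I_n} := [set y | [exists x in B, connect (radj w A) x y]].

Definition set_edge w x y (b : bool) : config n :=
  [ffun e => if (val e == (x, y)) || (val e == (y, x)) then b else w e].

Definition set_edges w v (s : seq 'I_n) (b : 'I_n -> bool) : config n :=
  foldr (fun y w' => set_edge w' v y (b y)) w s.

Lemma adj_set_edge w x y b u v : x != y -> adj (set_edge w x y b) u v =
  if (((u, v) == (x, y)) || ((u, v) == (y, x))) then b else adj w u v.
Proof.
have swap (i j k l : 'I_n) : ((i, j) == (k, l)) = ((j, i) == (l, k)).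
  by rewrite !xpair_eqE andbC.
move=> xy; apply/adjP/idP => [[e]|].
  rewrite ffunE => we ve.
  have -> : ((u, v) == (x, y)) || ((u, v) == (y, x)) =
            ((val e == (x, y)) || (val e == (y, x))).
    by case: ve => -> //; rewrite orbC (swap v u x y) (swap v u y x).
  by case: ifP we => // _ we; apply/adjP; exists e.
case: ifP => [uv bt|uv /adjP[e we ve]]; last first.
  exists e => //; rewrite ffunE.
  have -> : (val e == (x, y)) || (val e == (y, x)) =
            (((u, v) == (x, y)) || ((u, v) == (y, x))).
    by case: ve => -> //; rewrite orbC (swap v u x y) (swap v u y x).
  by rewrite uv.
have [e ve] : exists e : edge n, val e = (x, y) \/ val e = (y, x).
  have [lt|lt|/val_inj eq] := ltngtP x y.
  - by exists (exist _ (x, y) lt); left.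
  - by exists (exist _ (y, x) lt); right.
  - by rewrite eq eqxx in xy.
exists e; first by rewrite ffunE; case: ve => ->; rewrite eqxx ?orbT.
case/orP: uv => /eqP[-> ->] //; by case: ve; [right | left].
Qed.

Lemma adj_set_edges w v s b x y : v \notin s -> uniq s ->
  adj (set_edges w v s b) x y =
  if (x == v) && (y \in s) then b y else
  if (y == v) && (x \in s) then b x else adj w x y.
Proof.
elim: s => [|z s IH] /=; first by rewrite !in_nil !andbF.
rewrite !inE negb_or => /andP[vz vs] /andP[zs us].
rewrite adj_set_edge // !xpair_eqE IH //.
case: (eqVneq x v) => [->|xv] /=.
  case: (eqVneq y z) => [->|yz] /=; first by [].
  by rewrite (negbTE vz) /=; case: ifP => //; case: eqP.
rewrite andbC; case: (eqVneq y v) => [->|yv] /=; last by [].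
by case: (eqVneq x z) => [->|xz].
Qed.

Lemma eq_set_edges w v s b b' : {in s, b =1 b'} -> set_edges w v s b = set_edges w v s b'.
Proof.
elim: s => //= y s IH eqb; rewrite IH => [|z zs]; last by rewrite eqb // inE zs orbT.
by rewrite eqb // inE eqxx.
Qed.

Definition res_mean F := \sum_w res p A0 w0 w * F w.

Lemma sum_split_edge (G : config n -> R) e :
  \sum_w G w = \sum_(w : config n | w e) (G w + G (upd w e false)).
Proof.
rewrite big_split /= (bigID (fun w : config n => w e)) /=; congr (_ + _).
rewrite (reindex_onto (fun w : config n => upd w e false) (fun w => upd w e true)) /=.
  apply: eq_bigl => w; rewrite updE /= updK.
  apply/eqP/idP => [<-|we]; first by rewrite updE.
  by rewrite -[RHS](upd_id w e) we.
by move=> w /negbTE we; rewrite updK -[RHS](upd_id w e) we.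
Qed.

Lemma cond_upd F e : inside A0 e -> res_mean F =
  p * res_mean (fun w => F (upd w e true)) + (1 - p) * res_mean (fun w => F (upd w e false)).
Proof.
move=> eA; pose h w := \prod_(f | f != e)
  (if inside A0 f then bern p (w f) else (w f == w0 f)%:R).
have resh w : res p A0 w0 w = bern p (w e) * h w.
  by rewrite /res -lock (bigD1 e) //= eA.
have hupd w b : h (upd w e b) = h w.
  by apply: eq_bigr => f /negbTE fe; rewrite ffunE fe.
rewrite /res_mean ![\sum_w _ * F _](sum_split_edge _ e) !mulr_sumr -big_split /=.
apply: eq_bigr => w we; have wt : upd w e true = w by rewrite -[RHS](upd_id w e) we.
by rewrite !resh !updE !hupd we !updK wt /bern; ring.
Qed.

Lemma cond_edge F x y : x != y -> x \in A0 -> y \in A0 -> res_mean F =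
  p * res_mean (fun w => F (set_edge w x y true)) +
  (1 - p) * res_mean (fun w => F (set_edge w x y false)).
Proof.
move=> xy xA yA.
have [e ve] : exists e : edge n, val e = (x, y) \/ val e = (y, x).
  have [lt|lt|/val_inj eq] := ltngtP x y.
  - by exists (exist _ (x, y) lt); left.
  - by exists (exist _ (y, x) lt); right.
  - by rewrite eq eqxx in xy.
have se w b : set_edge w x y b = upd w e b.
  apply/ffunP => f; rewrite !ffunE; congr (if _ then _ else _).
  have no u v : val e = (u, v) -> (val f == (v, u)) = false.
    move=> veq; apply/negbTE/eqP => vf; have := valP f; have := valP e.
    by rewrite veq vf /= => lt1 lt2; have := ltn_trans lt1 lt2; rewrite ltnn.
  by rewrite -[f == e]val_eqE; case: ve => ve; rewrite (no _ _ ve) ve ?orbF.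
rewrite (@cond_upd F e); last by rewrite /inside; case: ve => ->; rewrite /= xA yA.
by congr (_ * _ + _ * _); apply: eq_bigr => w _; rewrite se.
Qed.

Lemma res_mean_mono F F' : (forall w, F w <= F' w) -> res_mean F <= res_mean F'.
Proof.
by move=> le; apply: ler_sum => w _; apply: ler_wpM2l; [exact: res_ge0 | exact: le].
Qed.

Lemma res_mean1 : res_mean (fun=> 1) = 1.
Proof. by rewrite /res_mean -[RHS](res_row p A0 w0); apply: eq_bigr => w _; rewrite mulr1. Qed.

Lemma res_mean_le1 F : (forall w, F w <= 1) -> res_mean F <= 1.
Proof. by move=> F1; rewrite -[leRHS]res_mean1; apply: res_mean_mono. Qed.

(** The edges from [v] to [s] are integrated out one at a time: a bound of product form in their
    states averages to a power. *)
Lemma cond_edges F (C c1 c0 : R) v (s : seq 'I_n) :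
  v \notin s -> uniq s -> v \in A0 -> {subset s <= A0} ->
  (forall b, res_mean (fun w => F (set_edges w v s b)) <=
             C * \prod_(y <- s) (if b y then c1 else c0)) ->
  res_mean F <= C * (p * c1 + (1 - p) * c0) ^+ size s.
Proof.
elim: s F C => [|y s IH] F C /=.
  by move=> _ _ _ _ /(_ (fun=> true)); rewrite big_nil expr0.
rewrite inE negb_or => /andP[vy vs] /andP[ys us] vA sA bnd.
have yA : y \in A0 by apply: sA; rewrite inE eqxx.
have sA' : {subset s <= A0} by move=> z zs; apply: sA; rewrite inE zs orbT.
have half b0 : res_mean (fun w => F (set_edge w v y b0)) <=
    C * (if b0 then c1 else c0) * (p * c1 + (1 - p) * c0) ^+ size s.
  apply: IH => // b.
  have := bnd (fun z => if z == y then b0 else b z).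
  rewrite big_cons eqxx -mulrA.
  rewrite (eq_big_seq (fun z => if b z then c1 else c0)) /= => [|z zs]; last first.
    by case: eqP zs ys => // -> ->.
  have -> // : res_mean (fun w => F (set_edge (set_edges w v s
      (fun z => if z == y then b0 else b z)) v y b0)) =
    res_mean (fun w => F (set_edge (set_edges w v s b) v y b0)).
  apply: eq_bigr => w _; congr (_ * F (set_edge _ _ _ _)).
  by apply: eq_set_edges => z zs; case: eqP zs ys => // -> ->.
case/andP: p01 => p0 p1.
rewrite (cond_edge F vy vA yA) exprS.
apply: le_trans (lerD (ler_wpM2l p0 (half true)) (ler_wpM2l _ (half false))) _.
  by rewrite subr_ge0.
by rewrite le_eqVlt; apply/orP; left; apply/eqP; ring.
Qed.

Lemma sub_reach w A B : B \subset reach w A B.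
Proof.
by apply/subsetP => x xB; rewrite inE; apply/exists_inP; exists x; rewrite ?connect0.
Qed.

Lemma reach_sub w A B : B \subset A -> reach w A B \subset A.
Proof.
move=> /subsetP BA; apply/subsetP => y; rewrite inE => /exists_inP[x /BA xA].
by apply: (@connect_ind_pred _ (radj w A) (mem A)) => // u v _ /and3P[].
Qed.

Lemma reach_closed w A B x y : x \in reach w A B -> x \in A -> y \in A -> adj w x y ->
  y \in reach w A B.
Proof.
rewrite !inE => /exists_inP[z zB zx] xA yA xy; apply/exists_inP; exists z => //.
by rewrite (connect_trans zx) // connect1 // /radj xA yA.
Qed.

Lemma reach_ind w A B (X : {set 'I_n}) : {subset B <= X} ->
  (forall u v, u \in X -> u \in A -> v \in A -> adj w u v -> v \in X) ->
  {subset reach w A B <= X}.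
Proof.
move=> BX step y; rewrite inE => /exists_inP[x /BX xX].
apply: (@connect_ind_pred _ (radj w A) (mem X)) => //= u v Xu /and3P[uA vA uv].
exact: step Xu _ _ _.
Qed.

Lemma reach_set0 w A : reach w A set0 = set0.
Proof. by apply/setP => y; rewrite !inE; apply/exists_inP => -[x]; rewrite inE. Qed.

Lemma reach_ext w w' A B : {in A &, adj w =2 adj w'} -> reach w A B = reach w' A B.
Proof.
move=> eqa; suff eqr : radj w A =2 radj w' A.
  by apply/setP => y; rewrite !inE; apply: eq_existsb => x; rewrite (eq_connect eqr).
by move=> x y; rewrite /radj; case xA: (x \in A); case yA: (y \in A) => //=; rewrite eqa.
Qed.

(** One step of the exploration: the edges from [v] to undiscovered vertices are revealed and [v] is
    discarded. What remains lives on [A :\ v] and no longer uses the revealed edges. *)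
Lemma reach_step w A B v : v \in B -> B \subset A ->
  reach w A B = v |: reach w (A :\ v) ((B :\ v) :|: [set y in A :\: B | adj w v y]).
Proof.
move=> vB BA; set B' := (B :\ v) :|: [set y in A :\: B | adj w v y].
have B'A : B' \subset A :\ v.
  have sBA := subsetP BA; apply/subsetP => y; rewrite ?/B' !inE => /orP[/andP[-> /sBA -> //]|/andP[/andP[yB yA] _]].
  by rewrite yA andbT; apply: contraNneq yB => ->.
apply/eqP; rewrite eqEsubset; apply/andP; split; apply/subsetP.
  apply: reach_ind => [y yB|x y].
    rewrite in_setU1; have [//|yv] := eqVneq y v.
    by rewrite (subsetP (sub_reach _ _ _)) // !inE yv yB.
  rewrite !in_setU1; have [->|yv] := eqVneq y v; first by [].
  case/orP => [/eqP -> _ yA vy|xr xA yA xy] /=.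
    apply: (subsetP (sub_reach _ _ _)); rewrite !inE yv yA vy /=.
    by case: (y \in B).
  have xAv := subsetP (reach_sub w B'A) _ xr.
  by apply: reach_closed xr xAv _ xy; rewrite !inE yv yA.
move=> y; rewrite in_setU1 => /orP[/eqP ->|]; first exact: (subsetP (sub_reach _ _ _)).
have vA := subsetP BA _ vB.
move: y; apply: reach_ind => [y|x y xr].
  rewrite !inE => /orP[/andP[_ yB]|/andP[/andP[_ yA] vy]].
    by have := subsetP (sub_reach w A B) _ yB; rewrite inE.
  have := @reach_closed w A B v y (subsetP (sub_reach _ _ _) _ vB) vA yA vy.
  by rewrite inE.
by rewrite !in_setD1 => /andP[_ xA] /andP[_ yA]; apply: reach_closed.
Qed.

(* The bound is [z ^+ #|B|] times the generating function of a binomial law with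
   parameters [#|A| - #|B|] and [1 - (1 - p) ^+ k]; it is exactly preserved when the
   edges from one vertex of [B] are revealed. *)
Lemma explore (k : nat) A B (z : R) : A \subset A0 -> B \subset A -> 0 < z ->
  z ^+ k * res_mean (fun w => (#|reach w A B| == k)%:R) <=
  z ^+ #|B| * ((1 - p) ^+ k + (1 - (1 - p) ^+ k) * z) ^+ (#|A| - #|B|).
Proof.
move=> AA0 BA zgt0; case/andP: (p01) => p0 p1; have z0 := ltW zgt0.
have s01 j : 0 <= (1 - p) ^+ j <= 1.
  by rewrite exprn_ge0 ?subr_ge0 //= exprn_ile1 ?subr_ge0 // gerBl.
have d0 j : 0 <= (1 - p) ^+ j + (1 - (1 - p) ^+ j) * z.
  by case/andP: (s01 j) => a b; rewrite addr_ge0 // mulr_ge0 // subr_ge0.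
elim: k A B AA0 BA => [|k IH] A B AA0 BA.
  have [->|[v vB]] := set_0Vmem B.
    rewrite cards0 !expr0 !mul1r subrr mul0r addr0 expr1n.
    by apply: res_mean_le1 => w; case: eqP.
  rewrite (_ : res_mean _ = 0) ?mulr0 ?mulr_ge0 ?exprn_ge0 //.
  apply: big1 => w _; rewrite cards_eq0 (_ : _ == _ = false) ?mulr0 //.
  by apply/negbTE/set0Pn; exists v; apply: (subsetP (sub_reach _ _ _)).
have [->|[v vB]] := set_0Vmem B.
  rewrite (_ : res_mean _ = 0) ?mulr0 ?mulr_ge0 ?exprn_ge0 //.
  by apply: big1 => w _; rewrite reach_set0 cards0 mulr0.
have vA := subsetP BA _ vB.
set d := (1 - p) ^+ k + (1 - (1 - p) ^+ k) * z.
pose s := enum (A :\: B).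
have mem_s y : (y \in s) = (y \in A :\: B) by rewrite mem_enum.
have vs : v \notin s by rewrite mem_s !inE vB.
have us : uniq s by apply: enum_uniq.
have cs : size s = (#|A| - #|B|)%N by rewrite -cardE cardsD (setIidPr BA).
(* An undiscovered vertex is a neighbour of [v] with probability [p], contributing [z], and
   otherwise contributes the base [d] for [k]; the average is the base for [k + 1]. *)
have -> : (1 - p) ^+ k.+1 + (1 - (1 - p) ^+ k.+1) * z = p * z + (1 - p) * d.
  by rewrite /d exprS; ring.
have zk : 0 < z ^+ k by rewrite exprn_gt0.
rewrite -cs (cardsD1 v B) vB exprD expr1 exprS -!mulrA.
apply: (ler_wpM2l z0); rewrite -ler_pdivlMl // mulrA; apply: (cond_edges vs us (subsetP AA0 _ vA)) => [y|b].
  by rewrite mem_s inE => /andP[_ yA]; exact: (subsetP AA0).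
pose J := [set y in A :\: B | b y].
have JB : [disjoint B :\ v & J].
  by apply/pred0P => y /=; rewrite !inE; case: (y \in B); rewrite ?andbF.
have BJA : (B :\ v) :|: J \subset A :\ v.
  have sBA := subsetP BA; apply/subsetP => y; rewrite ?/B' !inE => /orP[/andP[-> /sBA -> //]|/andP[/andP[yB yA] _]].
  by rewrite yA andbT; apply: contraNneq yB => ->.
have -> : res_mean (fun w => (#|reach (set_edges w v s b) A B| == k.+1)%:R) =
          res_mean (fun w => (#|reach w (A :\ v) ((B :\ v) :|: J)| == k)%:R).
  apply: eq_bigr => w _; rewrite (reach_step _ vB BA); congr (_ * (nat_of_bool _)%:R).
  have -> : [set y in A :\: B | adj (set_edges w v s b) v y] = J.
    apply/setP => y; rewrite !in_set adj_set_edges // eqxx mem_s /= in_setD.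
    by case: (y \in B) => //=; case: (y \in A).
  have -> : reach (set_edges w v s b) (A :\ v) (B :\ v :|: J) = reach w (A :\ v) (B :\ v :|: J).
    apply: reach_ext => x y; rewrite !in_setD1 => /andP[/negbTE xv _] /andP[/negbTE yv _].
    by rewrite adj_set_edges // xv yv.
  have vr : v \notin reach w (A :\ v) (B :\ v :|: J).
    by apply/negP => /(subsetP (reach_sub w BJA)); rewrite !inE eqxx.
  by rewrite cardsU1 vr add1n eqSS.
have := IH _ _ (subset_trans (subD1set _ _) AA0) BJA.
rewrite cardsU (disjoint_setI0 JB) cards0 subn0 -/d -ler_pdivlMl // => le; apply: le_trans le _.
rewrite exprD -!mulrA; apply: ler_wpM2l; first by rewrite invr_ge0 ltW.
apply: ler_wpM2l; first exact: exprn_ge0.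
rewrite /s big_enum /= (bigID b) /=.
rewrite (eq_bigr (fun=> z)) => [|y /andP[_ ->] //].
rewrite [X in _ <= _ * X](eq_bigr (fun=> d)) => [|y /andP[_ /negbTE ->] //].
rewrite !prodr_const.
have JAB : J \subset A :\: B by apply/subsetP => y; rewrite inE => /andP[].
rewrite le_eqVlt; apply/orP; left; apply/eqP; congr (_ ^+ _ * _ ^+ _).
  by apply: eq_card => y; rewrite -[RHS]/((y \in A :\: B) && b y) !inE.
transitivity #|(A :\: B) :\: J|; last first.
  apply: eq_card => y; rewrite -[RHS]/((y \in A :\: B) && ~~ b y) !inE.
  by case: (y \in B); case: (y \in A); case: (b y).
rewrite cardsD (setIidPr JAB) cardsD (setIidPr BA) subnDA; congr (_ - _)%N.
by rewrite (cardsD1 v A) (cardsD1 v B) vB vA !add1n subSS.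
Qed.

End Exploration.

(** Give each set [B] the weight [exp (- b |B|)]: all weights add up to [(1 + exp (- b)) ^ |T|], and
    a counted set has weight at least [exp (- b r)]. *)
Lemma card_small_sets (T : finType) (r : nat) (b : R) : 0 <= b ->
  #|[set B : {set T} | (#|B| <= r)%N]|%:R <= exp (exp (- b) * #|T|%:R + b * r%:R).
Proof.
move=> b0; set y := exp (- b).
have y0 : 0 < y by apply: exp_gt0.
have y1 : y <= 1 by rewrite -exp0; apply: ler_exp; lra.
have sum_y : \sum_(B : {set T}) y ^+ #|B| = (1 + y) ^+ #|T|.
  rewrite addrC -prodr_const bigA_distr /=; apply: eq_bigr => B _.
  by rewrite -big_mkcond /= prodr_const.
rewrite expD !expM_nat.
have yr : y ^+ r * exp b ^+ r = 1 by rewrite -exprMn -expD addNr exp0 expr1n.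
have br0 : 0 < exp b ^+ r by apply/exprn_gt0/exp_gt0.
apply: (@le_trans _ _ ((1 + y) ^+ #|T| * exp b ^+ r)); last first.
  apply: ler_wpM2r; first exact: ltW.
  by apply: lerXn2r; rewrite ?nnegrE ?exp_ge0 ?exp_ge1Dx // ltW // addr_gt0.
rewrite -sum_y mulr_suml -sum1_card natr_sum [leRHS](bigID (fun B : {set T} => (#|B| <= r)%N)) /=.
rewrite -[leLHS]addr0; apply: lerD; last first.
  by apply: sumr_ge0 => B _; apply: mulr_ge0; [apply/exprn_ge0/ltW | exact: ltW].
rewrite (eq_bigl (fun B : {set T} => (#|B| <= r)%N)) => [|B]; last by rewrite inE.
apply: ler_sum => B Br; rewrite -yr; apply: ler_wpM2r; first exact: ltW.
by apply: ler_wiXn2l => //; exact: ltW.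
Qed.

(** * Concentration of the explored size *)

Section Deviation.

Variables (n : nat) (p a : R).
Hypotheses (p01 : 0 <= p <= 1) (a01 : 0 <= a <= 1 / 2).
Implicit Types (w : config n) (A B : {set 'I_n}) (X : {set {set 'I_n}}).

(* The expected number of newly discovered vertices after [k] explorations started
   from [r] vertices, minus the number that have been used. *)
Definition drift A (r k : nat) : R :=
  (#|A|%:R - r%:R) * (1 - (1 - p) ^+ k) - (k%:R - r%:R).

Lemma explore_deviation A w0 B k : B \subset A -> 4 * a * n%:R <= `|drift A #|B| k| ->
  res_mean p A w0 (fun w => (#|reach w A B| == k)%:R) <= exp (- (2 * a ^+ 2 * n%:R)).
Proof.
move=> BA dev; case/andP: a01 => a0 a1; case/andP: (p01) => p0 p1.
pose s := 1 - (1 - p) ^+ k.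
have s01 : 0 <= s <= 1.
  rewrite /s subr_ge0 gerBl exprn_ge0 ?subr_ge0 // andbT.
  by rewrite exprn_ile1 ?subr_ge0 // gerBl.
have sE : (1 - p) ^+ k = 1 - s by rewrite /s; ring.
clearbody s.
case/andP: s01 => s0 s1.
have cBA : (#|B| <= #|A|)%N by apply: subset_leq_card.
have cAn : (#|A| <= n)%N by rewrite -[leqRHS]card_ord max_card.
(* [explore] at [z = exp t], for [t] of either sign. *)
have bound t : t <= 1 / 2 -> res_mean p A w0 (fun w => (#|reach w A B| == k)%:R) <=
    exp (t * drift A #|B| k + 2 * t ^+ 2 * n%:R).
  move=> t1; have := explore w0 p01 k (subxx A) BA (exp_gt0 t).
  rewrite sE subKr => h.
  have e0 : 0 < exp t ^+ k by apply/exprn_gt0/exp_gt0.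
  rewrite -(ler_pM2l e0) (le_trans h) // -!expM_nat -expD.
  have le1 : 1 - s + s * exp t <= exp (s * (t + 2 * t ^+ 2)).
    apply: le_trans (exp_ge1Dx _); have := ler_wpM2l s0 (exp_le_quad t1); lra.
  have ge0 : 0 <= 1 - s + s * exp t.
    by rewrite addr_ge0 ?subr_ge0 // mulr_ge0 // exp_ge0.
  apply: (@le_trans _ _ (exp (t * #|B|%:R) * exp (s * (t + 2 * t ^+ 2)) ^+ (#|A| - #|B|))).
    apply: ler_wpM2l; first exact: exp_ge0.
    by apply: lerXn2r le1; rewrite nnegrE ?exp_ge0.
  rewrite -expM_nat -expD; apply: ler_exp; rewrite natrB // /drift sE subKr.
  rewrite -subr_ge0.
  have -> : t * k%:R + (t * ((#|A|%:R - #|B|%:R) * s - (k%:R - #|B|%:R)) + 2 * t ^+ 2 * n%:R) -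
    (t * #|B|%:R + s * (t + 2 * t ^+ 2) * (#|A|%:R - #|B|%:R)) =
    2 * t ^+ 2 * (n%:R - s * (#|A|%:R - #|B|%:R)) :> R by ring.
  apply: mulr_ge0; first by rewrite mulr_ge0 // sqr_ge0.
  rewrite subr_ge0; apply: (@le_trans _ _ (1 * (#|A|%:R - #|B|%:R))).
    by apply: ler_wpM2r => //; rewrite subr_ge0 ler_nat.
  by rewrite mul1r lerBlDr -natrD ler_nat (leq_trans cAn) // leq_addr.
(* With [t = - a] or [t = a] according to the sign of the drift, the linear term is at most
   [- 4 a^2 n] and the quadratic one is [2 a^2 n]. *)
have [d0|d0] := leP 0 (drift A #|B| k).
  rewrite (ger0_norm d0) in dev.
  apply: le_trans (bound (- a) _) _; first by lra.
  by apply: ler_exp; have := ler_wpM2l a0 dev; lra.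
rewrite (ltr0_norm d0) in dev.
apply: le_trans (bound a a1) _.
by apply: ler_exp; have := ler_wpM2l a0 dev; lra.
Qed.

(** The drift is taken at the size actually reached, where discovered and used vertices should
    balance. The family [X] is left open: many starting sets at the price of a union bound, or a
    single one with its own tolerance. *)
Definition typical X A w :=
  [forall B in X, (B \subset A) ==> (`|(drift A #|B| (#|reach w A B|))| < 4 * a * n%:R)].

(** Union bound over the starting sets and the [n + 1] possible sizes of what they reach. *)
Lemma atypical_le X A w0 :
  res_mean p A w0 (fun w => (~~ typical X A w)%:R) <=
  #|X|%:R * n.+1%:R * exp (- (2 * a ^+ 2 * n%:R)).
Proof.
set eps := exp _.
pose bad B (k : 'I_n.+1) := 4 * a * n%:R <= `|drift A #|B| k|.
apply: (@le_trans _ _ (\sum_(B in X | B \subset A) \sum_(k | bad B k)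
    res_mean p A w0 (fun w => (#|reach w A B| == k)%:R))).
  have -> : \sum_(B in X | B \subset A) \sum_(k | bad B k)
      res_mean p A w0 (fun w => (#|reach w A B| == k)%:R) =
    res_mean p A w0 (fun w => \sum_(B in X | B \subset A) \sum_(k | bad B k)
      (#|reach w A B| == k)%:R).
    rewrite /res_mean; under eq_bigr do rewrite exchange_big /=.
    rewrite exchange_big /=; apply: eq_bigr => w _; rewrite mulr_sumr.
    by apply: eq_bigr => B _; rewrite mulr_sumr.
  apply: res_mean_mono => // w; case: (boolP (typical X A w)) => [_|] /=.
    by apply: sumr_ge0 => B _; apply: sumr_ge0 => k _; apply: ler0n.
  rewrite negb_forall_in => /exists_inP[B BX]; rewrite negb_imply -leNgt => /andP[BA dev].
  have rn : (#|reach w A B| < n.+1)%N by rewrite ltnS -[leqRHS]card_ord max_card.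
  rewrite (bigD1 B) /= ?BX // (bigD1 (Ordinal rn)) //= eqxx -addrA lerDl.
  by apply: addr_ge0; apply: sumr_ge0 => i _; rewrite ?ler0n //; apply: sumr_ge0 => j _; rewrite ler0n.
apply: (@le_trans _ _ (\sum_(B in X) \sum_(k < n.+1) eps)); last first.
  by rewrite !sumr_const card_ord -(mulr_natl eps) -(mulr_natl (_ * eps)) mulrA.
rewrite [leRHS](bigID (fun B : {set 'I_n} => B \subset A)) /= -[leLHS]addr0; apply: lerD; last first.
  by apply: sumr_ge0 => B _; apply: sumr_ge0 => k _; apply: exp_ge0.
apply: ler_sum => B /andP[_ BA].
rewrite [leRHS](bigID (bad B)) /= -[leLHS]addr0; apply: lerD; last first.
  by apply: sumr_ge0 => k _; apply: exp_ge0.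
by apply: ler_sum => k dev; apply: explore_deviation.
Qed.

End Deviation.

(** * Activation of clusters *)

Section Activation.

Variables (n : nat) (q : R) (w : config n).
Hypothesis q1 : 1 < q.
Implicit Types (A B W X : {set 'I_n}) (x y : 'I_n).

Definition nroots B := #|[set x in B | roots (adj w) x]|.

Let rt := fingraph.root (adj w).

Let cl_rootE x y : (y \in cl w x) = (rt y == rt x).
Proof. by rewrite inE -(root_connect (adj_connect_sym w)) eq_sym. Qed.

Lemma card_cluster_union X : cluster_union w X ->
  #|X| = (\sum_(x in X | roots (adj w) x) #|cl w x|)%N.
Proof.
move=> cu; rewrite -sum1_card (partition_big rt (fun x => (x \in X) && roots (adj w) x)) /=.
  apply: eq_bigr => x /andP[xX /eqP rx]; rewrite sum1_card; apply: eq_card => y.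
  rewrite -[LHS]/((y \in X) && (rt y == x)) cl_rootE [rt x]rx.
  case: eqP => [ryx|]; last by rewrite andbF.
  rewrite andbT; apply: (subsetP (cluster_union_cl cu xX)).
  by rewrite cl_rootE ryx [rt x]rx.
move=> y yX; rewrite (roots_root (adj_connect_sym w)) andbT.
by apply: (subsetP (cluster_union_cl cu yX)); rewrite cl_rootE [rt (rt y)](root_root (adj_connect_sym w)).
Qed.

Lemma big_union K : cluster_union w (big K w).
Proof.
apply/cluster_unionP => x y xy; rewrite !in_set.
by rewrite (cl_eq (x := x) (y := y)) // inE connect1.
Qed.

Lemma cluster_unionI A B : cluster_union w A -> cluster_union w B -> cluster_union w (A :&: B).
Proof.
move=> /cluster_unionP cA /cluster_unionP cB; apply/cluster_unionP => x y xy.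
by rewrite !inE (cA _ _ xy) (cB _ _ xy).
Qed.

Lemma nroots_big K : (K.+1 * nroots (big K w) <= n)%N.
Proof.
apply: (@leq_trans #|big K w|); last by rewrite -[leqRHS]card_ord max_card.
rewrite (card_cluster_union (big_union K)) /nroots -sum1_card big_distrr /=.
rewrite [X in (_ <= X)%N](eq_bigl (fun x => x \in [set x in big K w | roots (adj w) x])); last first.
  by move=> x; rewrite [RHS]in_set.
by apply: leq_sum => x; rewrite muln1 !inE => /andP[].
Qed.

Lemma act_forced B : cluster_union w B ->
  (q^-1) ^+ nroots B <= \sum_A act q w A * (B \subset A)%:R.
Proof.
(* [h] kills every active set that misses a cluster of [B]. *)
move=> cB; pose h x : R := if x \in B then 0 else 1.
have -> : (q^-1) ^+ nroots B = \prod_(x | roots (adj w) x) (q^-1 * 1 + (1 - q^-1) * h x).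
  rewrite (bigID (mem B)) /= [X in _ = _ * X]big1 ?mulr1; last first.
    by move=> x /andP[_ /negbTE xB]; rewrite /h xB; ring.
  rewrite (eq_bigr (fun=> q^-1)); last by move=> x /andP[_ xB]; rewrite /h xB; ring.
  rewrite prodr_const; congr (_ ^+ _); apply: eq_card => x.
  by rewrite -[RHS]/(roots (adj w) x && (x \in B)) inE andbC.
rewrite -act_sum; apply: ler_sum => A _.
case: (boolP (cluster_union w A)) => cA; last first.
  by rewrite /act (negbTE cA) -lock !mul0r.
apply: ler_wpM2l; first exact: act_ge0.
case: (boolP (B \subset A)) => [_|/subsetPn[x xB xA]].
  apply: prodr_ile1 => x _; rewrite /h; case: (x \in A); rewrite ?ler01 ?lexx //.
  by case: ifP; rewrite ?ler01 ?lexx.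
have rxB : rt x \in B by apply: (subsetP (cluster_union_cl cB xB)); rewrite cl_rootE [rt (rt x)](root_root (adj_connect_sym w)).
have rxA : rt x \notin A.
  apply: contra xA => rxA; apply: (subsetP (cluster_union_cl cA rxA)).
  by rewrite cl_rootE [rt (rt x)](root_root (adj_connect_sym w)).
rewrite (bigD1 (rt x)) /=; last exact: (roots_root (adj_connect_sym w)).
by rewrite (negbTE rxA) /h rxB mul0r.
Qed.

(** The marks are independent, and a cluster of size [m] in [W] gives a factor of at most
    [exp (t m / q + 2 t^2 m^2)]; [m^2 <= K m] makes the exponents add up to a multiple of [|W|]. *)
Lemma act_moment B W K (t : R) : cluster_union w W -> [disjoint B & W] ->
  (forall x, x \in W -> (#|cl w x| <= K)%N) -> `|t| * K%:R <= 1 / 2 ->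
  \sum_A act q w A * ((B \subset A)%:R * exp (t * #|A :&: W|%:R)) <=
  (q^-1) ^+ nroots B * exp ((t / q + 2 * t ^+ 2 * K%:R) * #|W|%:R).
Proof.
move=> cW dBW WK tK.
have q0 : 0 < q by apply: lt_trans q1.
have qi0 : 0 <= q^-1 by rewrite invr_ge0 ltW.
have qi1 : q^-1 <= 1 by rewrite (invf_le1 q0) ltW.
pose s x : R := if x \in W then #|cl w x|%:R else 0.
pose g x : R := exp (t * s x).
pose h x : R := if x \in B then 0 else 1.
have sum_s X : cluster_union w X -> \sum_(x in X | roots (adj w) x) s x = #|X :&: W|%:R.
  move=> cX; rewrite (card_cluster_union (cluster_unionI cX cW)) natr_sum.
  rewrite (bigID (mem W)) /= [X in _ + X]big1 ?addr0; last first.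
    by move=> x /andP[_ /negbTE xW]; rewrite /s xW.
  apply: eq_big => [x|x /andP[_ xW]]; last by rewrite /s xW.
  by rewrite in_setI andbAC.
apply: (@le_trans _ _ (\sum_A act q w A * \prod_(x | roots (adj w) x) (if x \in A then g x else h x))).
  apply: ler_sum => A _; case: (boolP (cluster_union w A)) => cA; last first.
    by rewrite /act (negbTE cA) -lock !mul0r.
  apply: ler_wpM2l; first exact: act_ge0.
  case: (boolP (B \subset A)) => [/subsetP BA|_]; last first.
    rewrite mul0r; apply: prodr_ge0 => x _; case: ifP => _; first exact: exp_ge0.
    by rewrite /h; case: ifP.
  rewrite mul1r (bigID (mem A)) /= [X in _ <= _ * X]big1 ?mulr1; last first.
    move=> x /andP[_ xA]; rewrite (negbTE xA) /h; case: ifP => // /BA.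
    by rewrite (negbTE xA).
  rewrite (eq_bigr g); last by move=> x /andP[_ ->].
  rewrite -(sum_s _ cA) mulr_sumr le_eqVlt; apply/orP; left; apply/eqP.
  rewrite (big_morph exp expD exp0); apply: eq_bigl => x; exact: andbC.
rewrite act_sum; set c := t / q + _.
apply: (@le_trans _ _ (\prod_(x | roots (adj w) x) ((if x \in B then q^-1 else 1) * exp (c * s x)))).
  apply: ler_prod => x _; apply/andP; split.
    apply: addr_ge0; first by apply: mulr_ge0 qi0 (exp_ge0 _).
    by apply: mulr_ge0; [rewrite subr_ge0 | rewrite /h; case: ifP].
  rewrite /g /h; case: ifP => xB.
    have -> : s x = 0 by rewrite /s (disjointFr dBW).
    by rewrite !mulr0 exp0 addr0.
  rewrite /s; case: ifP => xW; last by rewrite !mulr0 exp0; lra.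
  rewrite mul1r mulr1; set sz := #|cl w x|%:R.
  have sz0 : 0 <= sz :> R by apply: ler0n.
  have szK : sz <= K%:R by rewrite ler_nat WK.
  have ts : t * sz <= 1 / 2.
    apply: le_trans tK; apply: (@le_trans _ _ (`|t| * sz)).
      by apply: ler_wpM2r => //; exact: ler_norm.
    by apply: ler_wpM2l.
  have e1 := ler_wpM2l qi0 (exp_le_quad ts).
  apply: le_trans (exp_ge1Dx _).
  have e2 : 2 * (t * sz) ^+ 2 <= 2 * t ^+ 2 * K%:R * sz.
    have -> : 2 * (t * sz) ^+ 2 = (2 * t ^+ 2 * sz) * sz by ring.
    apply: ler_wpM2r => //; apply: ler_wpM2l => //.
    by apply: mulr_ge0 => //; exact: sqr_ge0.
  have e3 : q^-1 * (2 * (t * sz) ^+ 2) <= 2 * (t * sz) ^+ 2.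
    by apply: ler_piMl => //; apply: mulr_ge0 => //; exact: sqr_ge0.
  have -> : c * sz = q^-1 * (t * sz) + 2 * t ^+ 2 * K%:R * sz by rewrite /c; ring.
  lra.
rewrite big_split /= -(big_morph exp expD exp0) -mulr_sumr.
have -> : \sum_(x | roots (adj w) x) s x = #|W|%:R.
  have cT : cluster_union w [set: 'I_n] by apply/cluster_unionP => x y _; rewrite !inE.
  by rewrite -[W]setTI -(sum_s _ cT); apply: eq_bigl => x; rewrite inE.
rewrite -big_mkcondr /= prodr_const le_eqVlt; apply/orP; left; apply/eqP.
congr (_ ^+ _ * _); apply: eq_card => x.
by rewrite -[LHS]/(roots (adj w) x && (x \in B)) inE andbC.
Qed.

(** The factor [q^-1 ^+ nroots w B] is kept because the deviation must be rare relative to the event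
    that [B] is active, which may itself be exponentially unlikely. *)
Lemma act_deviation B W K (t d : R) : cluster_union w W -> [disjoint B & W] ->
  (forall x, x \in W -> (#|cl w x| <= K)%N) -> `|t| * K%:R <= 1 / 2 ->
  \sum_A act q w A * ((B \subset A)%:R * (d <= t * (#|A :&: W|%:R - #|W|%:R / q))%R%:R) <=
  (q^-1) ^+ nroots B * exp (2 * t ^+ 2 * K%:R * #|W|%:R - d).
Proof.
move=> cW dBW WK tK.
set c := t * (#|W|%:R / q) + d.
apply: (@le_trans _ _ ((\sum_A act q w A * ((B \subset A)%:R * exp (t * #|A :&: W|%:R))) * exp (- c))).
  rewrite mulr_suml; apply: ler_sum => A _; rewrite -!mulrA.
  apply: ler_wpM2l; first exact: act_ge0.
  apply: ler_wpM2l; first exact: ler0n.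
  rewrite -expD; case: (boolP (d <= _)%R) => [dl|_] /=; last exact: exp_ge0.
  rewrite -[leLHS]exp0; apply: ler_exp; rewrite /c subr_ge0.
  by rewrite -lerBrDl -mulrBr.
apply: (@le_trans _ _ ((q^-1) ^+ nroots B * exp ((t / q + 2 * t ^+ 2 * K%:R) * #|W|%:R) * exp (- c))).
  apply: ler_wpM2r; first exact: exp_ge0.
  exact: act_moment.
rewrite -mulrA -expD le_eqVlt; apply/orP; left; apply/eqP; congr (_ * exp _).
by rewrite /c; ring.
Qed.

End Activation.

(** * Flow out of a phase *)

Section Flows.

Variables (n : nat) (p : R) (pi : config n -> R) (ac : config n -> {set 'I_n} -> R).
Hypotheses (p01 : 0 <= p <= 1) (pi_ge0 : forall w, 0 <= pi w).
Hypotheses (ac_ge0 : forall w A, 0 <= ac w A) (ac_row : forall w, \sum_A ac w A = 1).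
Hypothesis ac_union : forall w A, ~~ cluster_union w A -> ac w A = 0.
Hypothesis rev : forall A w w',
  pi w * (ac w A * res p A w w') = pi w' * (ac w' A * res p A w' w).

Variables (typ : {set 'I_n} -> config n -> bool) (eps : R).
Hypothesis atyp : forall A w, res_mean p A w (fun v => (~~ typ A v)%:R) <= eps.
Implicit Types (S G : {set config n}) (w v : config n) (A : {set 'I_n}).

(* Resample the active set of a configuration of [S :\: G]: by hypothesis it
   leaves an atypical graph and typically lands in [S], so reversibility bounds
   the mass of [S :\: G] by the chance of producing an atypical graph from [S]. *)
Lemma boundary_mass S G (good : config n -> {set 'I_n} -> bool) (rho : R) :
  eps <= 1 / 2 ->
  (forall w, w \in S :\: G -> rho <= \sum_A ac w A * (good w A)%:R) ->
  (forall w A, w \in S :\: G -> cluster_union w A -> good w A -> ~~ typ A w) ->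
  (forall w A v, w \in S :\: G -> cluster_union w A -> good w A ->
     agree A w v -> typ A v -> v \in S) ->
  rho * \sum_(w in S :\: G) pi w <= 2 * eps * \sum_(w in S) pi w.
Proof.
move=> eps2 rho_le good_atyp good_S.
(* The factor 2 of the conclusion: a resampled graph is typical with probability at least
   [1 / 2]. *)
have typ_half A w : 1 / 2 <= \sum_v res p A w v * (typ A v)%:R.
  have := atyp A w; have := res_row p A w.
  have -> : \sum_v res p A w v =
      \sum_v res p A w v * (typ A v)%:R + res_mean p A w (fun v => (~~ typ A v)%:R).
    rewrite -big_split /=; apply: eq_bigr => v _; rewrite -mulrDr.
    by case: (typ A v); rewrite /= ?addr0 ?add0r mulr1.
  have := eps2; lra.
suff half_le : rho / 2 * \sum_(w in S :\: G) pi w <= eps * \sum_(w in S) pi w.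
  have -> : rho * \sum_(w in S :\: G) pi w = 2 * (rho / 2 * \sum_(w in S :\: G) pi w).
    by move: (\sum_(w in _) pi w) => x; lra.
  by rewrite -[leRHS]mulrA; apply: ler_wpM2l.
apply: (@le_trans _ _ (\sum_(w in S :\: G) \sum_A \sum_v
    pi w * (ac w A * res p A w v) * (good w A && typ A v)%:R)).
  rewrite mulr_sumr; apply: ler_sum => w wSG.
  apply: (@le_trans _ _ (\sum_A pi w * (ac w A * (good w A)%:R) * (1 / 2))).
    rewrite -mulr_suml -mulr_sumr; have := ler_wpM2l (pi_ge0 w) (rho_le w wSG).
    lra.
  apply: ler_sum => A _; apply: le_trans (ler_wpM2l _ (typ_half A w)) _.
    by apply: mulr_ge0 => //; apply: mulr_ge0.
  rewrite mulr_sumr; apply: ler_sum => v _; rewrite le_eqVlt; apply/orP; left; apply/eqP.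
  by case: (good w A); case: (typ A v); rewrite /=; ring.
apply: (@le_trans _ _ (\sum_(w in S :\: G) \sum_A \sum_(v in S)
    pi w * (ac w A * res p A w v) * (~~ typ A w)%:R)).
  apply: ler_sum => w wSG; apply: ler_sum => A _.
  rewrite (bigID (fun v => v \in S)) /= [X in _ + X]big1 ?addr0; last first.
    move=> v vS; case: (boolP (good w A && typ A v)) => [/andP[gd tv]|_]; last by rewrite mulr0.
    case: (boolP (cluster_union w A)) => [cu|/ac_union ->]; last by rewrite mul0r mulr0 mul0r.
    have -> : res p A w v = 0.
      by apply/eqP; apply: contraR vS => /res_agree ag; apply: good_S gd ag tv.
    by rewrite !mulr0 mul0r.
  apply: ler_sum => v vS.
  have pos : 0 <= pi w * (ac w A * res p A w v).
    by apply: mulr_ge0 => //; apply: mulr_ge0 => //; apply: res_ge0.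
  case: (boolP (good w A && typ A v)) => [/andP[gd tv]|_]; last first.
    by rewrite mulr0 mulr_ge0 // ler0n.
  case: (boolP (cluster_union w A)) => [cu|/ac_union ->]; last by rewrite mul0r !mulr0 !mul0r.
  by rewrite (good_atyp w A).
rewrite mulr_sumr; under eq_bigr do rewrite exchange_big /=.
rewrite exchange_big /=; apply: ler_sum => v vS.
rewrite exchange_big /=; apply: (@le_trans _ _ (\sum_A pi v * (ac v A * eps))); last first.
  by rewrite -mulr_sumr -mulr_suml ac_row mul1r mulrC.
apply: ler_sum => A _.
apply: (@le_trans _ _ (\sum_w pi v * ac v A * (res p A v w * (~~ typ A w)%:R))).
  rewrite [leRHS](bigID (fun w => w \in S :\: G)) /= -[leLHS]addr0; apply: lerD.
    by apply: ler_sum => w _; rewrite rev !mulrA.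
  apply: sumr_ge0 => w _; apply: mulr_ge0; first exact: mulr_ge0.
  by apply: mulr_ge0; rewrite ?ler0n // res_ge0.
rewrite -mulr_sumr -mulrA; apply: ler_wpM2l => //.
by apply: ler_wpM2l => //; exact: atyp.
Qed.

(** From [S :\: G] escape is bounded by 1. From [G] it needs a bad active set or an atypical
    resampled graph. *)
Lemma activation_flow S G (good : config n -> {set 'I_n} -> bool) (eps' : R) : 0 <= eps -> 0 <= eps' ->
  (forall w, w \in G -> \sum_A ac w A * (~~ good w A)%:R <= eps') ->
  (forall w A v, w \in G -> cluster_union w A -> good w A ->
     agree A w v -> typ A v -> v \in S) ->
  \sum_(w in S) pi w * (\sum_(v in ~: S) \sum_A ac w A * res p A w v) <=
  \sum_(w in S :\: G) pi w + (eps + eps') * \sum_(w in S) pi w.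
Proof.
move=> eps0 eps'0 bad_le good_S.
have out_le w : \sum_(v in ~: S) \sum_A ac w A * res p A w v <= 1.
  rewrite exchange_big /= -[leRHS](ac_row w); apply: ler_sum => A _.
  rewrite -mulr_sumr ler_piMr //.
  rewrite -[leRHS](res_row p A w) [leRHS](bigID (fun v => v \in ~: S)) /= lerDl.
  by apply: sumr_ge0 => v _; apply: res_ge0.
have out_G w : w \in G -> \sum_(v in ~: S) \sum_A ac w A * res p A w v <= eps + eps'.
  move=> wG; rewrite exchange_big /=.
  apply: (@le_trans _ _ (\sum_A (ac w A * eps + ac w A * (~~ good w A)%:R))); last first.
    by rewrite big_split /= -mulr_suml ac_row mul1r; apply: lerD => //; apply: bad_le.
  apply: ler_sum => A _; rewrite -mulr_sumr -mulrDr.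
  case: (boolP (cluster_union w A)) => [cu|/ac_union ->]; last by rewrite !mul0r.
  apply: ler_wpM2l => //; case: (boolP (good w A)) => [gd|_] /=.
    rewrite addr0; apply: le_trans (atyp A w); rewrite [leRHS](bigID (fun v => v \in ~: S)) /=.
    rewrite -[leLHS]addr0; apply: lerD; last first.
      by apply: sumr_ge0 => v _; apply: mulr_ge0; rewrite ?ler0n // res_ge0.
    apply: ler_sum => v; rewrite inE => vS.
    case: (boolP (typ A v)) => [tv|_]; last by rewrite mulr1.
    rewrite mulr0; have -> // : res p A w v = 0.
    by apply/eqP; apply: contraR vS => /res_agree ag; apply: good_S gd ag tv.
  apply: (@le_trans _ _ 1); last by rewrite lerDr.
  rewrite -[leRHS](res_row p A w) [leRHS](bigID (fun v => v \in ~: S)) /= lerDl.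
  by apply: sumr_ge0 => v _; apply: res_ge0.
rewrite (bigID (fun w => w \in G)) /= addrC.
apply: lerD.
  rewrite (eq_bigl (fun w => w \in S :\: G)) => [|w]; last by rewrite in_setD andbC.
  by apply: ler_sum => w _; apply: ler_piMr.
rewrite mulr_sumr [leRHS](bigID (fun w => w \in G)) /= -[leLHS]addr0; apply: lerD; last first.
  by apply: sumr_ge0 => w _; apply: mulr_ge0 => //; apply: addr_ge0.
apply: ler_sum => w /andP[_ wG]; rewrite mulrC; apply: ler_wpM2r => //; exact: out_G.
Qed.

End Flows.

(** * Structure of typical graphs *)

Section Growth.

Variable u : R.
Hypothesis u01 : 0 <= u <= 1.

(** [1 - u ^+ m] is [1 - u] times a geometric sum of [m] terms between [u ^+ m] and 1; this gives
    both [onem_ge] and [onem_le]. *)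
Let onem_ge (m : nat) : m%:R * u ^+ m * (1 - u) <= 1 - u ^+ m.
Proof.
case/andP: u01 => u0 u1; elim: m => [|m IH]; first by rewrite !mul0r expr0 subrr.
have um : 0 <= u ^+ m by apply: exprn_ge0.
have v0 : 0 <= 1 - u by rewrite subr_ge0.
have h1 : m%:R * u ^+ m * (1 - u) * u <= m%:R * u ^+ m * (1 - u).
  by apply: ler_piMr => //; apply: mulr_ge0 => //; apply: mulr_ge0 => //; apply: ler0n.
have h2 : u ^+ m * (1 - u) * u <= u ^+ m * (1 - u).
  by apply: ler_piMr => //; apply: mulr_ge0.
rewrite exprSr -natr1; lra.
Qed.

Let onem_le (m : nat) : 1 - u ^+ m <= m%:R * (1 - u).
Proof.
case/andP: u01 => u0 u1; elim: m => [|m IH]; first by rewrite mul0r expr0 subrr.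
have um : u ^+ m <= 1 by apply: exprn_ile1.
have v0 : 0 <= 1 - u by rewrite subr_ge0.
have := ler_wpM2r v0 um; rewrite exprSr -natr1; lra.
Qed.

Definition growth (M : R) (k : nat) : R := M * (1 - u ^+ k) - k%:R.

Lemma growth_le M k : 0 <= M -> growth M k <= (M * (1 - u) - 1) * k%:R.
Proof. by move=> M0; have := ler_wpM2l M0 (onem_le k); rewrite /growth; lra. Qed.

(* [growth M] is concave: it lies below its tangent line at [j]. *)
Lemma growth_tangent M j : 0 <= M -> exists D : R,
  forall l, growth M l <= growth M j + (l%:R - j%:R) * D.
Proof.
move=> M0; exists (M * (u ^+ j * (1 - u)) - 1) => l.
case/andP: u01 => u0 u1.
suff key : u ^+ j - u ^+ l <= (l%:R - j%:R) * (u ^+ j * (1 - u)).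
  by have := ler_wpM2l M0 key; rewrite /growth; lra.
have [jl|lj] := leqP j l.
  have uj : 0 <= u ^+ j by apply: exprn_ge0.
  have e : u ^+ l = u ^+ j * u ^+ (l - j) by rewrite -exprD subnKC.
  by have := ler_wpM2l uj (onem_le (l - j)); rewrite e natrB //; lra.
have ul : 0 <= u ^+ l by apply: exprn_ge0.
have e : u ^+ j = u ^+ l * u ^+ (j - l) by rewrite -exprD subnKC // ltnW.
have := ler_wpM2l ul (onem_ge (j - l)); rewrite e (natrB _ (ltnW lj)) mulrA.
by move: (u ^+ l) (u ^+ (j - l)) (j%:R : R) (l%:R : R) => x y z t; lra.
Qed.

(** A concave function that vanishes at 0 lies above its chord from 0 to [j]. *)
Lemma growth_chord M (k j : nat) : 0 <= M -> (k <= j)%N ->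
  k%:R * growth M j <= j%:R * growth M k.
Proof.
move=> M0 kj; have [D tan] := growth_tangent k M0.
have h0 := tan 0%N; have hj := tan j.
have g0 : growth M 0 = 0 by rewrite /growth expr0 subrr mulr0 subrr.
rewrite g0 in h0.
have k0 : 0 <= k%:R :> R by apply: ler0n.
have jk : 0 <= j%:R - k%:R :> R by rewrite subr_ge0 ler_nat.
have := ler_wpM2l k0 hj; have := ler_wpM2l jk h0; lra.
Qed.

(** Between [j] and [k], at distance at most [N], growth falls by at least [(c - d) N]; by concavity
    its slope beyond [k] is at most [- (c - d)]. This is what rules out a second giant. *)
Lemma growth_double M (j k l : nat) (c d N : R) : 0 <= M -> (j < k)%N -> k%:R <= N ->
  c * N <= growth M j -> growth M k <= d * N -> d <= c ->
  growth M (k + l) <= d * N - l%:R * (c - d).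
Proof.
move=> M0 jk kN gj gk dc; have [D tan] := growth_tangent k M0.
have hj := tan j; have hl := tan (k + l)%N.
have klE : (k + l)%:R - k%:R = l%:R :> R by rewrite natrD addrAC subrr add0r.
rewrite klE in hl.
have jk' : 0 < k%:R - j%:R :> R by rewrite subr_gt0 ltr_nat.
have j0 : 0 <= j%:R :> R by apply: ler0n.
have kjN : k%:R - j%:R <= N by lra.
have D1 : (k%:R - j%:R) * D <= (k%:R - j%:R) * (d - c).
  have : (N - (k%:R - j%:R)) * (d - c) <= 0.
    by rewrite -oppr_ge0 -mulrN; apply: mulr_ge0; lra.
  lra.
rewrite ler_pM2l // in D1.
by have := ler_wpM2l (ler0n R l) D1; lra.
Qed.

End Growth.

(** * Cluster sizes in a typical graph *)

Section Structure.

Variables (n : nat) (p a : R) (r K : nat) (w : config n) (A : {set 'I_n}).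
Hypotheses (p01 : 0 <= p <= 1) (cuA : cluster_union w A).
Hypotheses (rK : (n <= K.+1 * r)%N) (ra : r%:R <= a * n%:R).
Implicit Types (B U : {set 'I_n}) (x y : 'I_n).

Let f := growth (1 - p) #|A|%:R.

Lemma reach_cl B y : B \subset A -> (y \in reach w A B) = [exists x in B, y \in cl w x].
Proof.
move=> BA; rewrite inE; apply: eq_existsb => x; case xB: (x \in B) => //=; rewrite inE.
have xA := subsetP BA _ xB; apply/idP/idP => xy.
  apply: connect_ind_pred xy => [|u v xu /and3P[_ _ uv]]; first exact: connect0.
  by rewrite (connect_trans xu) // connect1.
suff: (y \in A) && connect (radj w A) x y by case/andP.
apply: (@connect_ind_pred _ (adj w) (fun z => (z \in A) && connect (radj w A) x z)) xy.
  by rewrite xA connect0.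
move=> u v /andP[uA xu] uv; move/cluster_unionP: cuA => /(_ _ _ uv) uvA.
by rewrite -uvA uA (connect_trans xu) // connect1 // /radj -uvA uA.
Qed.

(** At size [k] the drift exceeds the growth by [|B| (1 - p) ^+ k], which lies between 0 and
    [|B|]. *)
Lemma typical_growth B (X : {set {set 'I_n}}) c : typical p c X A w -> B \in X -> B \subset A ->
  f #|reach w A B| < 4 * c * n%:R /\
  - (4 * c * n%:R) - #|B|%:R < f #|reach w A B|.
Proof.
move=> /forall_inP typ BX BA; have /implyP/(_ BA) := typ B BX.
rewrite ltr_norml /drift; move: #|reach w A B| => k /andP[lo hi].
case/andP: p01 => p0 p1.
have u01 : 0 <= (1 - p) ^+ k <= 1.
  by rewrite exprn_ge0 ?subr_ge0 //= exprn_ile1 ?subr_ge0 // gerBl.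
case/andP: u01 => u0 u1; have b0 : 0 <= #|B|%:R :> R by apply: ler0n.
have h1 := mulr_ge0 b0 u0; have h2 := ler_wpM2l b0 u1.
rewrite /f /growth; move: lo hi h1 h2.
move: ((1 - p) ^+ k : R) (k%:R : R) (#|A|%:R : R) (#|B|%:R : R) (4 * c * n%:R : R) => x y z t s.
by move=> *; split; lra.
Qed.

Hypothesis typ : typical p a [set B : {set 'I_n} | (#|B| <= r)%N] A w.

(** [U] is what is reached from its roots, and as its clusters are larger than [K] there are at most
    [r] of them. The 5 is the 4 of typicality plus [r <= a n]. *)
Lemma typical_union U : cluster_union w U -> U \subset A -> U \subset big K w ->
  f #|U| < 4 * a * n%:R /\ - (5 * a * n%:R) < f #|U|.
Proof.
move=> cU UA Ubig; pose B := [set x in U | roots (adj w) x].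
have BU : B \subset U by apply/subsetP => x; rewrite inE => /andP[].
have BA := subset_trans BU UA.
have cB : (#|B| <= r)%N.
  rewrite -(@leq_pmul2l K.+1) //; apply: leq_trans rK; apply: leq_trans (nroots_big w K).
  rewrite leq_pmul2l //; apply: subset_leq_card; apply/subsetP => x.
  by rewrite !in_set => /andP[/(subsetP Ubig)]; rewrite in_set => -> ->.
have rB : reach w A B = U.
  apply/setP => y; rewrite reach_cl //; apply/exists_inP/idP => [[x xB]|yU].
    by apply/subsetP/(cluster_union_cl cU)/(subsetP BU).
  exists (fingraph.root (adj w) y); last by rewrite cl_sym inE connect_root.
  rewrite in_set (roots_root (adj_connect_sym w)) andbT.
  by apply: (subsetP (cluster_union_cl cU yU)); rewrite inE connect_root.
have := typical_growth typ _ BA; rewrite rB inE cB => /(_ isT)[hi lo]; split => //.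
have : #|B|%:R <= r%:R :> R by rewrite ler_nat.
by move: lo ra; move: (f _) (#|B|%:R : R) (r%:R : R) (n%:R : R) => *; lra.
Qed.

(** Growth has slope at most [x - 1 < 0], while typicality keeps it above [- 5 a n]. *)
Lemma subcritical_typical (x eta : R) : #|A|%:R * p <= x -> 5 * a <= eta * (1 - x) -> x < 1 ->
  #|A :&: big K w|%:R <= eta * n%:R.
Proof.
move=> Ax ae x1.
have [_] := typical_union (cluster_unionI cuA (big_union w K)) (subsetIl _ _) (subsetIr _ _).
case/andP: (p01) => p0 p1.
have u01 : 0 <= 1 - p <= 1 by rewrite subr_ge0 p1 gerBl.
have := growth_le u01 #|A :&: big K w| (ler0n _ #|A|); rewrite subKr -/f.
move: (f _) (#|A :&: big K w|%:R : R) (ler0n R #|A :&: big K w|) => y k k0 h1 h2.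
have h3 := ler_wpM2r k0 Ax; have h4 := ler_wpM2r (ler0n R n) ae.
have x1' : 0 < 1 - x by lra.
rewrite -(ler_pM2l x1'); lra.
Qed.

Variables (j : nat) (gam eta : R).
Hypotheses (gam_j : gam * n%:R <= f j) (jn : (j <= n)%N) (eta0 : 0 < eta).
Hypotheses (a_eta : 4 * a <= eta * gam) (a_gam : 4 * a <= gam)
  (eta_j : 2 * eta * n%:R <= j%:R) (a_j : 9 * a * n%:R <= j%:R * (gam - 4 * a))
  (n0 : (0 < n)%N).

Let u01 : 0 <= 1 - p <= 1.
Proof. by case/andP: p01 => p0 p1; rewrite subr_ge0 p1 gerBl. Qed.

(** At sizes from [eta n] to [j] the chord bound makes growth at least [eta gam n >= 4 a n], which
    typicality forbids. *)
Let gap U : cluster_union w U -> U \subset A -> U \subset big K w ->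
  (eta * n%:R <= #|U|%:R) -> (j < #|U|)%N.
Proof.
move=> cU UA Ub eU; rewrite ltnNge; apply/negP => Uj.
have [hi _] := typical_union cU UA Ub.
have := growth_chord u01 (ler0n _ #|A|) Uj; rewrite -/f leNgt => /negP; apply.
have n0' : 0 < n%:R :> R by rewrite ltr0n.
have j0 : 0 < j%:R :> R.
  by apply: lt_le_trans eta_j; apply: mulr_gt0 => //; apply: mulr_gt0.
have an : a * n%:R >= 0 by apply: le_trans ra; apply: ler0n.
have gam0 : 0 <= gam by have := a_gam; move: an; rewrite pmulr_lge0 //; lra.
apply: (@lt_le_trans _ _ (j%:R * (4 * a * n%:R))); first by rewrite ltr_pM2l.
apply: (@le_trans _ _ (n%:R * (4 * a * n%:R))).
  by apply: ler_wpM2r; [rewrite -mulrA; apply: mulr_ge0 | rewrite ler_nat].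
apply: (@le_trans _ _ (eta * n%:R * (gam * n%:R))).
  have := ler_wpM2r (ltW n0') (ler_wpM2r (ltW n0') a_eta); lra.
by apply: ler_pM => //; apply: mulr_ge0 => //; exact: ltW.
Qed.

Lemma giant_structure : eta * n%:R <= #|A :&: big K w|%:R ->
  exists2 x, x \in A & (j < #|cl w x|)%N /\ #|(A :&: big K w) :\: cl w x|%:R < eta * n%:R.
Proof.
move=> big_ge; set V := A :&: big K w.
have cV : cluster_union w V := cluster_unionI cuA (big_union w K).
have VA : V \subset A := subsetIl _ _; have Vb : V \subset big K w := subsetIr _ _.
have n0' : 0 < n%:R :> R by rewrite ltr0n.
have cucl x : cluster_union w (cl w x).
  apply/cluster_unionP => y z yz; rewrite !(cl_sym w x).
  by rewrite (cl_eq (x := y) (y := z)) // inE connect1.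
have clV x : x \in V -> cl w x \subset V by apply: cluster_union_cl.
have unionU B B' : cluster_union w B -> cluster_union w B' -> cluster_union w (B :|: B').
  move=> /cluster_unionP cB /cluster_unionP cB'; apply/cluster_unionP => x y xy.
  by rewrite !inE (cB _ _ xy) (cB' _ _ xy).
have [x xV xbig] : exists2 x, x \in V & eta * n%:R <= #|cl w x|%:R.
  (* If all clusters were smaller than [eta n], adding one to a maximal union below [eta n] would
     land in the forbidden range, as [2 eta n <= j]. *)
  apply/exists_inP; apply: contraT; rewrite negb_exists_in => /forall_inP small.
  pose P U := [&& cluster_union w U, U \subset V & #|U|%:R < eta * n%:R].
  have P0 : P set0.
    apply/and3P; split; rewrite ?sub0set ?cards0 ?mulr_gt0 //.
    by apply/cluster_unionP => x y _; rewrite !inE.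
  case: (@arg_maxnP _ set0 P (fun U : {set 'I_n} => #|U|) P0) => U /and3P[cU UV Ulow] Umax.
  have [y yV yU] : exists2 y, y \in V & y \notin U.
    apply/subsetPn; apply: contraTN Ulow => VU; rewrite -leNgt.
    by apply: le_trans big_ge _; rewrite ler_nat subset_leq_card.
  have cUy := unionU _ _ cU (cucl y).
  have UyV : U :|: cl w y \subset V by rewrite subUset UV clV.
  have ylow : #|cl w y|%:R < eta * n%:R by rewrite ltNge small.
  have Uy_le : #|U :|: cl w y|%:R < 2 * eta * n%:R.
    apply: (@le_lt_trans _ _ (#|U|%:R + #|cl w y|%:R)); last by lra.
    by rewrite -natrD ler_nat cardsU leq_subr.
  have Uy_ge : eta * n%:R <= #|U :|: cl w y|%:R.
    rewrite leNgt; apply/negP => lt; have := Umax (U :|: cl w y).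
    rewrite /P cUy UyV lt => /(_ isT) /=; rewrite leqNgt => /negP; apply.
    apply: proper_card; apply/properP; split; first exact: subsetUl.
    by exists y => //; rewrite inE mem_cl orbT.
  have := gap cUy (subset_trans UyV VA) (subset_trans UyV Vb) Uy_ge.
  rewrite ltnNge -(ler_nat R) => /negP[].
  exact: le_trans (ltW Uy_le) eta_j.
have xj := gap (cucl x) (subset_trans (clV _ xV) VA) (subset_trans (clV _ xV) Vb) xbig.
exists x; first exact: (subsetP VA).
split => //; rewrite ltNge; apply/negP => rest.
have DV : V :\: cl w x \subset V := subsetDl _ _.
have cD : cluster_union w (V :\: cl w x).
  by rewrite setDE; apply: cluster_unionI => //; rewrite cluster_union_compl.
have dj := gap cD (subset_trans DV VA) (subset_trans DV Vb) rest.
have [hx _] := typical_union (cucl x) (subset_trans (clV _ xV) VA) (subset_trans (clV _ xV) Vb).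
have [_ hV] := typical_union cV VA Vb.
have Vsum : (#|cl w x| + #|V :\: cl w x|)%N = #|V|.
  by rewrite -(cardsID (cl w x) V) (setIidPr (clV _ xV)).
have xn : #|cl w x|%:R <= n%:R :> R by rewrite ler_nat -[leqRHS]card_ord max_card.
(* Two disjoint unions larger than [j] would push growth at [V] down to [4 a n - 9 a n], against the
   lower bound [- 5 a n]. *)
have := growth_double u01 #|V :\: cl w x| (ler0n _ #|A|) xj xn gam_j (ltW hx) a_gam.
rewrite Vsum -/f.
have : j%:R * (gam - 4 * a) <= #|V :\: cl w x|%:R * (gam - 4 * a).
  by apply: ler_wpM2r; [rewrite subr_ge0 | rewrite ler_nat ltnW].
have := a_j; move: hV; lra.
Qed.

(** [gap] leaves open that all clusters are small. An exploration from [B0] cannot stop at a size up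
    to [j], where the chord bound gives growth at least [gam |B0| >= 4 a' n]. The clusters of size
    at most [K] that it meets, at most one per vertex of [B0], have at most [K |B0|] vertices. *)
Lemma seed_big (B0 : {set 'I_n}) (a' : R) : typical p a' [set B0] A w -> B0 \subset A ->
  4 * a' * n%:R <= gam * #|B0|%:R -> 0 <= gam -> (0 < #|B0|)%N ->
  eta * n%:R + K%:R * #|B0|%:R <= j%:R ->
  eta * n%:R <= #|A :&: big K w|%:R.
Proof.
move=> typ' BA aB gam0 B0pos etaj.
set Rc := reach w A B0.
have n0' : 0 < n%:R :> R by rewrite ltr0n.
have B0Rc : (#|B0| <= #|Rc|)%N by apply: subset_leq_card; apply: sub_reach.
have jR : (j < #|Rc|)%N.
  rewrite ltnNge; apply/negP => Rj.
  have [hi _] := typical_growth typ' (set11 _) BA.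
  have := growth_chord u01 (ler0n _ #|A|) Rj; rewrite -/f leNgt => /negP; apply.
  have j0 : 0 < j%:R :> R by rewrite ltr0n; apply: leq_trans Rj; apply: leq_trans B0Rc.
  apply: (@lt_le_trans _ _ (j%:R * (4 * a' * n%:R))); first by rewrite ltr_pM2l.
  apply: (@le_trans _ _ (j%:R * (gam * #|B0|%:R))); first by apply: ler_wpM2l aB; exact: ltW.
  apply: (@le_trans _ _ (n%:R * (gam * #|B0|%:R))).
    by apply: ler_wpM2r; [apply: mulr_ge0 | rewrite ler_nat].
  rewrite mulrCA [n%:R * _]mulrC mulrCA.
  by apply: ler_pM => //; [apply: mulr_ge0 => //; exact: ltW | rewrite ler_nat].
have RcA : Rc \subset A by apply: reach_sub.
have small : (#|Rc :\: big K w| <= K * #|B0|)%N.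
  apply: (@leq_trans #|\bigcup_(x in B0 | (#|cl w x| <= K)%N) cl w x|).
    apply: subset_leq_card; apply/subsetP => y; rewrite inE => /andP[yb].
    rewrite reach_cl // => /exists_inP[x xB xy]; apply/bigcupP; exists x => //.
    by rewrite xB; move: yb; rewrite inE (cl_eq xy) -leqNgt.
  apply: leq_trans (_ : \sum_(x in B0 | (#|cl w x| <= K)%N) K <= _)%N; last first.
    rewrite sum_nat_const mulnC leq_mul2l; apply/orP; right; apply: subset_leq_card.
    by apply/subsetP => x /andP[].
  elim/big_rec2: _ => [|x m U /andP[_ xK] IH]; first by rewrite cards0.
  by rewrite cardsU (leq_trans (leq_subr _ _)) // leq_add.
have : (#|Rc| <= #|A :&: big K w| + K * #|B0|)%N.
  rewrite -(cardsID (big K w) Rc) leq_add // subset_leq_card //.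
  exact: setSI.
rewrite -(ler_nat R) natrD natrM => le1.
have : j%:R <= #|Rc|%:R :> R by rewrite ler_nat ltnW.
move: etaj; lra.
Qed.

End Structure.

Lemma half_of_split (e l x f g1 g2 k : R) : 4 * e <= 1 / 2 -> l <= x -> 0 <= x ->
  x <= f -> g1 <= 2 * e * x -> g2 <= 2 * e * x -> f <= k + (g1 + g2) -> l / 2 <= k.
Proof. by move=> small lx x0 xf h1 h2 fk; have := ler_wpM2r x0 small; lra. Qed.

(** * Probabilities of the activation events *)

Section Activations.

Variables (n : nat) (q : R) (K0 K : nat) (d : R) (w : config n).
Hypotheses (q1 : 1 < q) (d01 : 0 <= d <= 1) (K00 : (0 < K0)%N) (K0K : (K0 <= K)%N).
Implicit Types (A B W : {set 'I_n}).

Definition near A W : bool := `|#|A :&: W|%:R - #|W|%:R / q| < d * n%:R.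

Definition mid := big K0 w :\: big K w.

(* [kick] has probability of order [q ^- (n / K)] only, but leaves no cluster larger
   than [K] inactive; [calm] fails with exponentially small probability. *)
Definition kick A := [&& big K w \subset A, near A mid & near A (~: big K w)].

Definition calm A := near A (~: big K0 w).

Lemma union_compl_big L : cluster_union w (~: big L w).
Proof. by rewrite cluster_union_compl big_union. Qed.

Lemma act_far B W L : (0 < L)%N -> cluster_union w W -> [disjoint B & W] ->
  (forall x, x \in W -> (#|cl w x| <= L)%N) ->
  \sum_A act q w A * ((B \subset A)%:R * (~~ near A W)%:R) <=
  2 * exp (- (d ^+ 2 * n%:R / (8 * L%:R))) * (q^-1) ^+ nroots w B.
Proof.
move=> L0 cW dBW WL; case/andP: d01 => d0 d1.
have L0' : 0 < L%:R :> R by rewrite ltr0n.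
have n0' : 0 <= n%:R :> R by apply: ler0n.
(* This [t] minimises [2 t^2 L n - t d n]; the minimum is [- d^2 n / (8 L)]. *)
pose t := d / (4 * L%:R); pose D := d ^+ 2 * n%:R / (4 * L%:R).
have t0 : 0 <= t by rewrite /t divr_ge0 // mulr_ge0 // ltW.
have tL : t * L%:R = d / 4.
  by rewrite /t invfM mulrA mulfVK // lt0r_neq0.
have dev s : `|s| = t ->
    \sum_A act q w A * ((B \subset A)%:R * (D <= s * (#|A :&: W|%:R - #|W|%:R / q))%R%:R) <=
    exp (- (d ^+ 2 * n%:R / (8 * L%:R))) * (q^-1) ^+ nroots w B.
  move=> st; apply: le_trans (act_deviation q1 D cW dBW WL _) _.
    by rewrite st tL; lra.
  rewrite mulrC; apply: ler_wpM2r; first by rewrite exprn_ge0 // invr_ge0; have := q1; lra.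
  have Wn : #|W|%:R <= n%:R :> R by rewrite ler_nat -[leqRHS]card_ord max_card.
  have s2 : s ^+ 2 = t ^+ 2 by rewrite -st real_normK // num_real.
  apply: ler_exp; rewrite s2 /D.
  have -> : 2 * t ^+ 2 * L%:R = 2 * t * (t * L%:R) by ring.
  have -> : d ^+ 2 * n%:R / (8 * L%:R) = t * d * n%:R / 2.
    by rewrite /t; field; rewrite lt0r_neq0.
  have -> : d ^+ 2 * n%:R / (4 * L%:R) = t * d * n%:R.
    by rewrite /t; field; rewrite lt0r_neq0.
  rewrite tL.
  have td : 0 <= t * d by apply: mulr_ge0.
  have := ler_wpM2l td Wn; move: (#|W|%:R : R) => x; lra.
have up := dev t (ger0_norm t0); have lo := dev (- t) (etrans (normrN t) (ger0_norm t0)).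
rewrite -mulrA mulr_natl mulr2n.
apply: (le_trans _ (lerD up lo)); rewrite -big_split /=; apply: ler_sum => A _.
rewrite -mulrDr -mulrDr; apply: ler_wpM2l; first exact: act_ge0.
apply: ler_wpM2l; first exact: ler0n.
rewrite -natrD ler_nat /near -leNgt.
case: (boolP (d * n%:R <= _)) => //; rewrite ler_normr => /orP[] far.
  suff -> : D <= t * (#|A :&: W|%:R - #|W|%:R / q) by [].
  have -> : D = t * (d * n%:R) by rewrite /D /t; field; rewrite lt0r_neq0.
  exact: ler_wpM2l.
suff -> : D <= - t * (#|A :&: W|%:R - #|W|%:R / q) by rewrite addn1.
have -> : D = t * (d * n%:R) by rewrite /D /t; field; rewrite lt0r_neq0.
by rewrite mulNr -mulrN; exact: ler_wpM2l.
Qed.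

Lemma act_calm : \sum_A act q w A * (~~ calm A)%:R <=
  2 * exp (- (d ^+ 2 * n%:R / (8 * K0%:R))).
Proof.
have nr0 : nroots w set0 = 0%N by apply: eq_card0 => x; rewrite !inE.
have := @act_far set0 (~: big K0 w) K0 K00 (union_compl_big K0); rewrite nr0 expr0 mulr1.
rewrite (_ : [disjoint _ & _]); last by apply/pred0P => x /=; rewrite in_set0.
move=> /(_ isT) far; apply: (le_trans _ (far _)) => [|x]; last by rewrite !in_set -leqNgt.
by under [leRHS]eq_bigr do rewrite sub0set mul1r.
Qed.

Lemma act_kick : 4 * exp (- (d ^+ 2 * n%:R / (8 * K%:R))) <= 1 / 2 ->
  exp (- (q * n%:R / K.+1%:R)) / 2 <= \sum_A act q w A * (kick A)%:R.
Proof.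
move=> small.
have q0 : 0 < q by apply: lt_trans q1.
set N := nroots w (big K w).
have Nn : N%:R <= n%:R / K.+1%:R :> R.
  by rewrite ler_pdivlMr ?ltr0n // -natrM ler_nat mulnC nroots_big.
(* [q <= exp q] takes the place of a logarithm of [q]. *)
have lowN : exp (- (q * n%:R / K.+1%:R)) <= (q^-1) ^+ N.
  apply: (@le_trans _ _ (exp (- q * N%:R))).
    apply: ler_exp; rewrite mulNr lerN2 -mulrA; apply: ler_wpM2l => //; exact: ltW.
  rewrite expM_nat; apply: lerXn2r; rewrite ?nnegrE ?exp_ge0 ?invr_ge0 ?(ltW q0) //.
  rewrite expN lef_pV2 ?posrE ?exp_gt0 //.
  by apply: le_trans (exp_ge1Dx q); rewrite lerDr.
have K0' : (0 < K)%N by apply: leq_trans K0K.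
have forced := act_forced q1 (big_union w K).
have far1 := @act_far (big K w) mid K K0'.
have far2 := @act_far (big K w) (~: big K w) K K0' (union_compl_big K).
have cmid : cluster_union w mid.
  by rewrite /mid setDE cluster_unionI ?union_compl_big ?big_union.
have {far1} far1 : \sum_A act q w A * ((big K w \subset A)%:R * (~~ near A mid)%:R) <=
    2 * exp (- (d ^+ 2 * n%:R / (8 * K%:R))) * (q^-1) ^+ N.
  apply: far1 => // [|x]; last by rewrite !in_set => /andP[]; rewrite -leqNgt.
  by apply/pred0P => x /=; rewrite in_setD; case: (x \in big K w).
have {far2} far2 : \sum_A act q w A * ((big K w \subset A)%:R * (~~ near A (~: big K w))%:R) <=
    2 * exp (- (d ^+ 2 * n%:R / (8 * K%:R))) * (q^-1) ^+ N.
  apply: far2 => // [|x]; last by rewrite !in_set -leqNgt.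
  by apply/pred0P => x /=; rewrite in_setC; case: (x \in big K w).
(* Activating the large clusters has probability at least [q^-1 ^+ N], of which each of the two
   deviations takes away at most a quarter. *)
have : \sum_A act q w A * (big K w \subset A)%:R <=
    \sum_A act q w A * (kick A)%:R +
    (\sum_A act q w A * ((big K w \subset A)%:R * (~~ near A mid)%:R) +
     \sum_A act q w A * ((big K w \subset A)%:R * (~~ near A (~: big K w))%:R)).
  rewrite -!big_split /=; apply: ler_sum => A _; rewrite -!mulrDr.
  apply: ler_wpM2l; first exact: act_ge0.
  rewrite /kick; case: (_ \subset _); rewrite ?mul0r ?addr0 ?ler0n //= !mul1r.
  by case: (near A mid); case: (near A (~: big K w)); rewrite /= -!natrD ler_nat.
have qN0 : 0 <= q^-1 ^+ N by rewrite exprn_ge0 // invr_ge0 ltW.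
exact: (half_of_split small lowN qN0 forced far1 far2).
Qed.

End Activations.

(** * Leakage of the two chains out of a phase *)

Section Traps.

Variables (n : nat) (lam q : R).
Hypotheses (n1 : (1 < n)%N) (lam0 : 0 < lam) (lamn : lam < n%:R) (q1 : 1 < q).
Let p := lam / n%:R.
Variables (K0 K : nat) (d : R).
Hypotheses (d01 : 0 <= d <= 1) (K00 : (0 < K0)%N) (K0K : (K0 <= K)%N).
Hypothesis kick_small : 4 * exp (- (d ^+ 2 * n%:R / (8 * K%:R))) <= 1 / 2.
Variables (typ : {set 'I_n} -> config n -> bool) (eps : R).
Hypothesis atyp : forall A w, res_mean p A w (fun v => (~~ typ A v)%:R) <= eps.
Hypotheses (eps0 : 0 <= eps) (eps2 : eps <= 1 / 2).
Variables S G : {set config n}.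
Implicit Types (w v : config n) (A : {set 'I_n}).
Hypothesis kick_atyp : forall w A, w \in S :\: G -> cluster_union w A ->
  kick q K0 K d w A -> ~~ typ A w.
Hypothesis kick_S : forall w A v, w \in S :\: G -> cluster_union w A ->
  kick q K0 K d w A -> agree A w v -> typ A v -> v \in S.
Hypothesis calm_S : forall w A v, w \in G -> cluster_union w A ->
  calm q K0 d w A -> agree A w v -> typ A v -> v \in S.
Hypothesis upd_S : forall w e b, w \in G -> upd w e b \in S.

Let n0 : (0 < n)%N := ltnW n1.
Let x := q * n%:R / K.+1%:R.

Let p01 : 0 <= p <= 1.
Proof. by have /andP[/ltW -> /ltW ->] := p_bounds n0 lam0 lamn. Qed.

Let act_union w A : ~~ cluster_union w A -> act q w A = 0.
Proof. by move=> cu; rewrite /act -lock (negbTE cu). Qed.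

(** [kick] has probability at least [exp (- x) / 2]; with the 2 of [boundary_mass] this gives the
    4. *)
Lemma shell_mass : \sum_(w in S :\: G) fk_pi lam q w <=
  4 * eps * exp x * \sum_(w in S) fk_pi lam q w.
Proof.
have pi0 w : 0 <= fk_pi lam q w by apply/ltW/fk_pi_gt0.
have := boundary_mass p01 pi0 (fun w A => act_ge0 w A q1) (act_row q)
  act_union (fk_pi_act_res_rev lam q1) atyp eps2
  (fun w _ => act_kick w q1 d01 K00 K0K kick_small) kick_atyp kick_S.
rewrite -/x; move: (\sum_(w in S :\: G) _) (\sum_(w in S) _) => s t bm.
have := ler_wpM2l (exp_ge0 x) bm; rewrite expN.
have -> : exp x * ((exp x)^-1 / 2 * s) = s / 2.
  by field; rewrite lt0r_neq0 // exp_gt0.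
have -> : exp x * (2 * eps * t) = (4 * eps * exp x * t) / 2 by lra.
by rewrite ler_pM2r // invr_gt0.
Qed.

Lemma glauber_trap :
  \sum_(w in S) fk_pi lam q w * (\sum_(v in ~: S) glauber lam q w v) <=
  4 * eps * exp x * \sum_(w in S) fk_pi lam q w.
Proof.
apply: le_trans shell_mass.
have row w := glauber_row n0 lam0 lamn q1 w n1.
have gl0 := glauber_ge0 n0 lam0 lamn q1.
have out0 w v : w \in G -> v \notin S -> glauber lam q w v = 0.
  move=> wG vS; rewrite glauberE [X in _ * X]big1 ?mulr0 // => e _.
  by case: eqP => // vE; move: vS; rewrite vE upd_S.
have pi0 w : 0 <= fk_pi lam q w by apply/ltW/fk_pi_gt0.
move: (@fk_pi n lam q) (@glauber n lam q) pi0 row gl0 out0 => pi gl pi0 row gl0 out0.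
rewrite (bigID (fun w => w \in G)) /= big1 ?add0r => [|w /andP[_ wG]]; last first.
  by rewrite big1 ?mulr0 // => v; rewrite inE => vS; rewrite out0.
rewrite (eq_bigl (fun w => w \in S :\: G)) => [|w]; last by rewrite in_setD andbC.
apply: ler_sum => w _; apply: ler_piMr => //.
rewrite -[leRHS](row w) [leRHS](bigID (fun v => v \in ~: S)) /= lerDl.
exact: sumr_ge0.
Qed.

Lemma chayes_machta_trap :
  \sum_(w in S) fk_pi lam q w * (\sum_(v in ~: S) chayes_machta lam q w v) <=
  (4 * eps * exp x + (eps + 2 * exp (- (d ^+ 2 * n%:R / (8 * K0%:R))))) *
  \sum_(w in S) fk_pi lam q w.
Proof.
have pi0 w : 0 <= fk_pi lam q w by apply/ltW/fk_pi_gt0.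
rewrite mulrDl; apply: le_trans (lerD shell_mass (lexx _)).
have cmE w : \sum_(v in ~: S) chayes_machta lam q w v =
    \sum_(v in ~: S) \sum_A act q w A * res p A w v.
  by apply: eq_bigr => v _; rewrite chayes_machtaE.
have bad0 : 0 <= 2 * exp (- (d ^+ 2 * n%:R / (8 * K0%:R))) by rewrite mulr_ge0 // exp_ge0.
have := activation_flow p01 pi0 (fun w A => act_ge0 w A q1) (act_row q) act_union atyp
  eps0 bad0 (fun w _ => act_calm w q1 d01 K00) calm_S.
apply: le_trans.
rewrite le_eqVlt; apply/orP; left; apply/eqP; apply: eq_bigr => w _.
by rewrite cmE.
Qed.

End Traps.

(** * The two phases *)

Section SingleFlip.

Variables (n : nat) (w : config n) (e : edge n) (b : bool).
Let x := (val e).1.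
Let y := (val e).2.
Let w' := upd w e b.

Lemma adj_upd u v : adj w u v ->
  [\/ adj w' u v, (u = x /\ v = y) | (u = y /\ v = x)].
Proof.
case/adjP => f wf vf; case: (eqVneq f e) => [fe|fe].
  by rewrite fe in vf; rewrite /x /y; case: vf => ->; [constructor 2 | constructor 3].
constructor 1; apply/adjP; exists f => //.
by rewrite /w' ffunE (negbTE fe).
Qed.

Lemma adj_upd' u v : adj w' u v ->
  [\/ adj w u v, (u = x /\ v = y) | (u = y /\ v = x)].
Proof.
case/adjP => f; rewrite /w' ffunE; case: (eqVneq f e) => [fe _ vf|fe wf vf].
  by rewrite fe in vf; rewrite /x /y; case: vf => ->; [constructor 2 | constructor 3].
by constructor 1; apply/adjP; exists f.
Qed.

Let small (v : config n) K c : {set 'I_n} := if (#|cl v c| <= K)%N then cl v c else set0.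

Let card_small v K c : (#|small v K c| <= K)%N.
Proof. by rewrite /small; case: ifP => //; rewrite cards0. Qed.

(** The old cluster is covered by the new clusters of [z], [x] and [y], each of which lies in
    [big K w'] or has at most [K] vertices. *)
Lemma card_cl_upd K z : (#|cl w z| <= #|big K w'| + 3 * K)%N.
Proof.
have sub t : t \in cl w z -> [|| t \in cl w' z, t \in cl w' x | t \in cl w' y].
  rewrite inE; apply: (@connect_ind_pred _ _ (fun t => [|| t \in cl w' z, t \in cl w' x | t \in cl w' y])).
    by rewrite mem_cl.
  move=> u v inu /adj_upd[uv|[_ ->]|[_ ->]]; last 2 first.
  - by rewrite mem_cl !orbT.
  - by rewrite mem_cl !orbT.
  have step c : u \in cl w' c -> v \in cl w' c.
    by rewrite !inE => cu; rewrite (connect_trans cu) // connect1.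
  by case/or3P: inu => /step ->; rewrite ?orbT.
have -> : (3 * K = K + K + K)%N by rewrite !mulSn mul0n addn0 addnA.
apply: (@leq_trans #|big K w' :|: (small w' K z :|: small w' K x :|: small w' K y)|).
  apply: subset_leq_card; apply/subsetP => t tz; rewrite in_setU.
  case: (boolP (t \in big K w')) => //=; rewrite inE -leqNgt => tK.
  have sm c : t \in cl w' c -> t \in small w' K c.
    by move=> tc; rewrite /small -(cl_eq tc) tK mem_cl.
  by rewrite !in_setU; case/or3P: (sub t tz) => /sm ->; rewrite ?orbT.
by rewrite cardsU (leq_trans (leq_subr _ _)) // leq_add2l cardsU (leq_trans (leq_subr _ _)) //
  leq_add // cardsU (leq_trans (leq_subr _ _)) // leq_add.
Qed.

(** A cluster grows only if it contains an endpoint of the flipped edge, so the vertices gained lie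
    in two old clusters of size at most [K0]. *)
Lemma card_big_upd K0 K : (K0 <= K)%N -> (#|big K w'| <= #|big K0 w| + 2 * K0)%N.
Proof.
move=> K0K.
have -> : (2 * K0 = K0 + K0)%N by rewrite !mulSn mul0n addn0.
apply: (@leq_trans #|big K0 w :|: (small w K0 x :|: small w K0 y)|).
  apply: subset_leq_card; apply/subsetP => t; rewrite in_setU => tK.
  case: (boolP (t \in big K0 w)) => //=; rewrite inE -leqNgt => tK0.
  have sm c : t \in cl w c -> t \in small w K0 c.
    by move=> tc; rewrite /small -(cl_eq tc) tK0 mem_cl.
  rewrite in_setU; apply: contraLR tK; rewrite negb_or => /andP[tx ty].
  rewrite inE -leqNgt; apply: leq_trans K0K; apply: leq_trans tK0.
  apply: subset_leq_card; apply/subsetP => u; rewrite inE.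
  apply: (@connect_ind_pred _ _ (fun u => u \in cl w t)); first exact: mem_cl.
  move=> u1 v tu /adj_upd'[uv|[ux _]|[uy _]].
  - by move: tu; rewrite !inE => tu; rewrite (connect_trans tu) // connect1.
  - by case/negP: tx; apply: sm; rewrite -ux cl_sym.
  - by case/negP: ty; apply: sm; rewrite -uy cl_sym.
by rewrite cardsU (leq_trans (leq_subr _ _)) // leq_add2l cardsU (leq_trans (leq_subr _ _)) // leq_add.
Qed.

End SingleFlip.

Lemma card_big_compl n K (w : config n) : #|~: big K w|%:R = n%:R - #|big K w|%:R :> R.
Proof.
have e : (#|big K w| + #|~: big K w| = n)%N by rewrite cardsC card_ord.
have {}e : #|big K w|%:R + #|~: big K w|%:R = n%:R :> R by rewrite -natrD e.
by rewrite -e addrC addKr.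
Qed.

Lemma big_mono n K0 K (w : config n) : (K0 <= K)%N -> big K w \subset big K0 w.
Proof.
by move=> K0K; apply/subsetP => x; rewrite !inE; apply: leq_ltn_trans.
Qed.

(** * The low phase *)

Section Subcritical.

Variables (n : nat) (lam q : R) (K0 K r : nat) (d d1 d2 eta a x2 : R).
Let p := lam / n%:R.
Hypotheses (n0 : (0 < n)%N) (p01 : 0 <= p <= 1) (q1 : 1 < q) (K0K : (K0 <= K)%N).
Hypotheses (rK : (n <= K0.+1 * r)%N) (ra : r%:R <= a * n%:R).
Hypotheses (lam0 : 0 < lam) (a_eta : 5 * a <= eta * (1 - lam * x2)) (x2_lt : lam * x2 < 1).
Hypotheses (d1_x2 : d1 + q^-1 + d <= x2) (d2_d1 : d2 + eta <= d1) (eta0 : 0 <= eta) (d20 : 0 <= d2).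
Hypotheses (d2_ge : eta + q * (eta + d) <= d2) (flip : d2 * n%:R + 2 * K0%:R <= d1 * n%:R).
Implicit Types (w v : config n) (A : {set 'I_n}).

Definition low_S : {set config n} := [set w | #|big K w|%:R <= d1 * n%:R].
Definition low_G : {set config n} := [set w | #|big K0 w|%:R <= d2 * n%:R].

Variable typ : {set 'I_n} -> config n -> bool.
Hypothesis typE : forall A w, typ A w -> typical p a [set B : {set 'I_n} | (#|B| <= r)%N] A w.

Let n0' : 0 < n%:R :> R. Proof. by rewrite ltr0n. Qed.

Let low_big A v : #|A|%:R <= x2 * n%:R -> cluster_union v A -> typ A v ->
  #|A :&: big K0 v|%:R <= eta * n%:R.
Proof.
move=> Ax cu /typE tv; apply: (subcritical_typical p01 cu rK ra tv _ a_eta x2_lt).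
rewrite /p mulrA ler_pdivrMr // mulrC -mulrA; apply: ler_wpM2l; [exact: ltW | exact: Ax].
Qed.

Let near_le A W (s : R) : near q d A W -> #|W|%:R <= s -> #|A :&: W|%:R <= s / q + d * n%:R.
Proof.
rewrite /near ltr_norml => /andP[_ hi] Ws.
have qi : 0 <= q^-1 by rewrite invr_ge0; apply/ltW/(lt_trans _ q1).
have := ler_wpM2r qi Ws; move: hi; move: (#|_|%:R : R) (#|_|%:R : R) => u v; lra.
Qed.

Let card_split A w L (s t : R) : #|big L w|%:R <= s -> #|A :&: ~: big L w|%:R <= t -> #|A|%:R <= s + t.
Proof.
move=> hs ht; apply: le_trans (lerD hs ht); rewrite -natrD ler_nat.
rewrite -(cardsID (big L w) A) setDE leq_add2r; apply/subset_leq_card/subsetIr.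
Qed.

Let compl_le L w : #|~: big L w|%:R <= n%:R :> R.
Proof. by rewrite ler_nat -[leqRHS]card_ord max_card. Qed.

Let kick_size w A : w \in low_S -> kick q K0 K d w A -> #|A|%:R <= x2 * n%:R.
Proof.
rewrite inE => wS /and3P[_ _ nr].
apply: le_trans (card_split wS (near_le nr (compl_le K w))) _.
have := ler_wpM2r (ltW n0') d1_x2; lra.
Qed.

Let calm_size w A : w \in low_G -> calm q K0 d w A -> #|A|%:R <= x2 * n%:R.
Proof.
rewrite inE => wG nr.
apply: le_trans (card_split wG (near_le nr (compl_le K0 w))) _.
have := ler_wpM2r (ltW n0') d1_x2; have := ler_wpM2r (ltW n0') d2_d1.
have := mulr_ge0 eta0 (ltW n0'); lra.
Qed.

(** If the graph on [A] were typical, at most [eta n] active vertices would lie in clusters larger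
    than [K0]. The inactive ones lie in [mid], whose active share is about [1 / q], so [mid] has at
    most [q (eta + d) n] vertices. The sum is at most [d2 n], as the core requires. *)
Lemma low_kick_atyp w A : w \in low_S :\: low_G -> cluster_union w A ->
  kick q K0 K d w A -> ~~ typ A w.
Proof.
rewrite in_setD => /andP[wG wS] cu kk; apply: contra wG => tw.
have small := low_big (kick_size wS kk) cu tw.
case/and3P: kk => bA nm _; rewrite inE.
have midA : #|A :&: mid K0 K w|%:R <= eta * n%:R.
  by apply: le_trans small; rewrite ler_nat subset_leq_card // setIS // subsetDl.
have bound : #|big K0 w|%:R <= #|A :&: big K0 w|%:R + #|mid K0 K w|%:R :> R.
  rewrite -natrD ler_nat -(cardsID A (big K0 w)) setIC leq_add2l subset_leq_card //.
  exact: setDS.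
move: nm; rewrite /near ltr_norml => /andP[lo _].
apply: le_trans bound _.
have q0 : 0 < q := lt_trans ltr01 q1.
have midq : #|mid K0 K w|%:R <= q * (eta + d) * n%:R.
  rewrite -mulrA -ler_pdivrMl // mulrC.
  move: lo midA; move: (#|A :&: _|%:R : R) (#|_|%:R / q : R) => u v; lra.
have := ler_wpM2r (ltW n0') d2_ge; move: midq small.
move: (#|mid _ _ _|%:R : R) (#|_ :&: _|%:R : R) => u v; lra.
Qed.

Lemma low_kick_S w A v : w \in low_S :\: low_G -> cluster_union w A ->
  kick q K0 K d w A -> agree A w v -> typ A v -> v \in low_S.
Proof.
rewrite in_setD => /andP[_ wS] cu kk ag tv.
have small := low_big (kick_size wS kk) (agree_union ag cu) tv.
case/and3P: kk => /subsetP bA _ _; rewrite inE.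
apply: (@le_trans _ _ (eta * n%:R)).
  apply: le_trans small; rewrite ler_nat subset_leq_card //; apply/subsetP => x xb.
  rewrite in_setI (subsetP (big_mono v K0K) _ xb) andbT.
  apply: contraT => xA; move: xb; rewrite inE (agree_cl ag cu xA) => xb.
  by rewrite bA // inE in xA.
have := ler_wpM2r (ltW n0') d2_d1; have := mulr_ge0 d20 (ltW n0'); lra.
Qed.

(** Inactive clusters are unchanged and contribute at most [d2 n]; the resampled graph contributes
    at most [eta n]. *)
Lemma low_calm_S w A v : w \in low_G -> cluster_union w A ->
  calm q K0 d w A -> agree A w v -> typ A v -> v \in low_S.
Proof.
move=> wG cu cm ag tv.
have small := low_big (calm_size wG cm) (agree_union ag cu) tv.
move: wG; rewrite !inE => wG.
apply: (@le_trans _ _ (#|A :&: big K0 v|%:R + #|big K0 w|%:R)).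
  rewrite -natrD ler_nat -(cardsID A (big K v)) setIC leq_add //.
    by rewrite subset_leq_card // setIS // big_mono.
  apply/subset_leq_card/subsetP => x; rewrite inE => /andP[xA xb].
  by move: (subsetP (big_mono v K0K) _ xb); rewrite !inE (agree_cl ag cu xA).
have := ler_wpM2r (ltW n0') d2_d1; move: small wG.
move: (#|_|%:R : R) (#|_|%:R : R) => u t; lra.
Qed.

Lemma low_upd_S w e b : w \in low_G -> upd w e b \in low_S.
Proof.
rewrite !inE => wG; apply: le_trans flip; apply: (@le_trans _ _ (#|big K0 w|%:R + 2 * K0%:R)).
  by rewrite -natrM -natrD ler_nat card_big_upd.
by rewrite lerD2r.
Qed.

Lemma low_S_neq0 : (0 < K)%N -> low_S != set0.
Proof.
move=> K1; apply/set0Pn; exists [ffun=> false]; rewrite inE.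
rewrite (_ : big K _ = set0).
  rewrite cards0; apply: mulr_ge0; last exact: ltW.
  by move: d2_d1 d20 eta0; lra.
apply/setP => x; have c1 : cl ([ffun=> false] : config n) x = [set x].
  apply/setP => y; rewrite !inE; apply/idP/eqP => [xy|->]; last exact: connect0.
  apply/eqP; apply: (@connect_ind_pred _ _ (fun y => y == x)) xy => // u v _ /adjP[e].
  by rewrite ffunE.
by rewrite !in_set c1 cards1; apply/negbTE; rewrite -leqNgt.
Qed.

End Subcritical.

(** * The high phase *)

Section Supercritical.

Variables (n : nat) (p q : R) (K0 K r r0 j : nat) (d d2 th eta gam a a' x1 : R).
Hypotheses (n0 : (0 < n)%N) (p01 : 0 <= p <= 1) (q1 : 1 < q) (K0K : (K0 <= K)%N) (Kj : (K <= j)%N).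
Hypotheses (rK : (n <= K0.+1 * r)%N) (ra : r%:R <= a * n%:R) (jn : (j <= n)%N).
Hypothesis gam_j : gam * n%:R <= x1 * n%:R * (1 - (1 - p) ^+ j) - j%:R.
Hypotheses (eta0 : 0 < eta) (gam0 : 0 <= gam) (a_eta : 4 * a <= eta * gam) (a_gam : 4 * a <= gam)
  (eta_j : 2 * eta * n%:R <= j%:R) (a_j : 9 * a * n%:R <= j%:R * (gam - 4 * a)).
Hypotheses (a'_r0 : 4 * a' * n%:R <= gam * r0%:R) (r00 : (0 < r0)%N)
  (r0_j : eta * n%:R + K0%:R * r0%:R <= j%:R) (r0_x1 : r0%:R <= x1 * n%:R).
Hypotheses (th_j : th * n%:R + 3 * K%:R <= j%:R) (eta_th : eta <= th).
Hypotheses (d0 : 0 <= d) (d20 : 0 <= d2) (d2_ge : eta + q * (eta + d) <= d2).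
Hypothesis x1_th : x1 <= th + (1 - th - d2) / q - d.
Implicit Types (w v : config n) (A : {set 'I_n}).

(* A fixed set of starting vertices: as no union bound is needed, its exploration is
   controlled up to errors much smaller than its size. *)
Definition seed r0 A : {set 'I_n} := [set x in take r0 (enum A)].

Lemma seed_sub m A : seed m A \subset A.
Proof. by apply/subsetP => x; rewrite inE => /mem_take; rewrite mem_enum. Qed.

Lemma card_seed m A : (m <= #|A|)%N -> #|seed m A| = m.
Proof.
move=> mA; rewrite cardsE; have /card_uniqP -> : uniq (take m (enum A)).
  exact/take_uniq/enum_uniq.
by rewrite size_takel // -cardE.
Qed.

Definition high_S : {set config n} := [set w | th * n%:R <= #|big K w|%:R].
(** The core asks for a single giant because a cluster is activated as a whole: the giant is either
    left untouched or entirely active. By [th_j] its size exceeds [th n] by [3 K], so that it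
    survives one flip. *)
Definition high_G : {set config n} :=
  [set w | [exists x, (j < #|cl w x|)%N && (#|big K0 w :\: cl w x|%:R <= d2 * n%:R)%R]].

Variable typ : {set 'I_n} -> config n -> bool.
Hypothesis typE : forall A w, typ A w -> typical p a [set B : {set 'I_n} | (#|B| <= r)%N] A w.
Hypothesis typE' : forall A w, typ A w -> typical p a' [set seed r0 A] A w.

Let n0' : 0 < n%:R :> R. Proof. by rewrite ltr0n. Qed.

Let q0 : 0 < q. Proof. exact: lt_trans q1. Qed.

Let qi : 0 <= q^-1 <= 1.
Proof. by rewrite invr_ge0 ltW //= invf_le1 // ltW. Qed.

Let growth_j A : x1 * n%:R <= #|A|%:R -> gam * n%:R <= growth (1 - p) #|A|%:R j.
Proof.
move=> xA; apply: le_trans gam_j _; rewrite /growth lerD2r; apply: ler_wpM2r => //.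
case/andP: p01 => p0 p1.
by rewrite subr_ge0 exprn_ile1 ?subr_ge0 // gerBl.
Qed.

Let cl_big L w x : (L < #|cl w x|)%N -> cl w x \subset big L w.
Proof. by move=> Lx; apply/subsetP => y yx; rewrite inE (cl_eq yx). Qed.

Let giant_S v x : (j < #|cl v x|)%N -> v \in high_S.
Proof.
move=> jx; rewrite inE; apply: (@le_trans _ _ (#|cl v x|%:R)); last first.
  by rewrite ler_nat; apply/subset_leq_card/cl_big/(leq_ltn_trans Kj).
apply: (@le_trans _ _ j%:R); last by rewrite ler_nat ltnW.
by apply: le_trans th_j; rewrite lerDl mulr_ge0.
Qed.

Let large_S A v : x1 * n%:R <= #|A|%:R -> cluster_union v A -> typ A v -> v \in high_S.
Proof.
move=> xA cu tv; have gj := growth_j xA.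
have r0A : (r0 <= #|A|)%N by rewrite -(ler_nat R); apply: le_trans r0_x1 xA.
have bigA : eta * n%:R <= #|A :&: big K0 v|%:R.
  apply: (seed_big p01 cu gj jn n0 (typE' tv) (seed_sub _ _)); rewrite ?card_seed //.
have [x _ [jx _]] := giant_structure p01 cu rK ra (typE tv) gj jn eta0 a_eta a_gam eta_j a_j n0 bigA.
exact: giant_S jx.
Qed.

Let near_ge A W : near q d A W -> #|W|%:R / q - d * n%:R <= #|A :&: W|%:R.
Proof. rewrite /near ltr_norml => /andP[lo _]; move: lo; move: (#|_|%:R : R) (#|_|%:R / q : R) => u v; lra. Qed.

(* An active set that contains [m] vertices and about a [1/q]-fraction of at
   least [n - m - d2 n] further vertices is supercritical. *)
Let size_ge (m s t : R) : th * n%:R <= m -> n%:R - m - d2 * n%:R <= s -> m + (s / q - d * n%:R) <= t ->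
  x1 * n%:R <= t.
Proof.
move=> mth ms; apply: le_trans; case/andP: qi => qi0 qi1.
have h1 := ler_wpM2r qi0 ms.
have qi1' : 0 <= 1 - q^-1 by rewrite subr_ge0.
have h2 := ler_wpM2r qi1' mth; have h3 := ler_wpM2r (ltW n0') x1_th.
move: h1 h2 h3; move: q^-1 => z; lra.
Qed.

Let kick_size w A : w \in high_S -> kick q K0 K d w A -> x1 * n%:R <= #|A|%:R.
Proof.
rewrite inE => wS /and3P[bA _ nr]; have lo := near_ge nr.
apply: (size_ge wS _ (le_trans (lerD (lexx _) lo) _)).
  by rewrite card_big_compl gerBl mulr_ge0 // ltW.
rewrite -natrD ler_nat -(cardsID (big K w) A) (setIidPr bA) setDE.
exact: leqnn.
Qed.

(** The counterpart of [low_kick_atyp] with the giant taken out; it lies in [big K w], hence off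
    [mid]. *)
Lemma high_kick_atyp w A : w \in high_S :\: high_G -> cluster_union w A ->
  kick q K0 K d w A -> ~~ typ A w.
Proof.
rewrite in_setD => /andP[wG wS] cu kk; apply: contra wG => tw.
have gj := growth_j (kick_size wS kk).
case/and3P: kk => bA nm _.
have bigA : eta * n%:R <= #|A :&: big K0 w|%:R.
  move: wS; rewrite inE => wS; apply: le_trans (_ : #|big K w|%:R <= _).
    by apply: le_trans wS; apply: ler_wpM2r eta_th; exact: ltW.
  by rewrite ler_nat subset_leq_card // subsetI bA big_mono.
have [x xA [jx rest]] := giant_structure p01 cu rK ra (typE tw) gj jn eta0 a_eta a_gam eta_j a_j n0 bigA.
rewrite inE; apply/existsP; exists x; rewrite jx /=.
have clK : cl w x \subset big K w by apply/cl_big/(leq_ltn_trans Kj).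
have midA : #|A :&: mid K0 K w|%:R < eta * n%:R.
  apply: le_lt_trans rest; rewrite ler_nat subset_leq_card //; apply/subsetP => y.
  rewrite !inE => /and3P[-> yK ->]; rewrite !andbT.
  by apply: contra yK => xy; have := subsetP clK y; rewrite !inE; apply.
have bound : #|big K0 w :\: cl w x|%:R <=
    #|(A :&: big K0 w) :\: cl w x|%:R + #|mid K0 K w|%:R :> R.
  rewrite -natrD ler_nat -(cardsID A (big K0 w :\: cl w x)); apply: leq_add.
    by rewrite subset_leq_card // setIDAC setIC.
  apply/subset_leq_card/subsetP => y; rewrite !in_setD => /and3P[yA _ ->]; rewrite andbT.
  by apply: contra yA; exact: (subsetP bA).
apply: le_trans bound _; have lo := near_ge nm.
have midq : #|mid K0 K w|%:R <= q * (eta + d) * n%:R.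
  rewrite -mulrA -ler_pdivrMl // mulrC.
  move: lo midA; move: (#|A :&: _|%:R : R) (#|_|%:R / q : R) => u v; lra.
have := ler_wpM2r (ltW n0') d2_ge; move: midq rest.
move: (#|mid _ _ _|%:R : R) (#|_ :\: _|%:R : R) => u v; lra.
Qed.

Lemma high_kick_S w A v : w \in high_S :\: high_G -> cluster_union w A ->
  kick q K0 K d w A -> agree A w v -> typ A v -> v \in high_S.
Proof.
rewrite in_setD => /andP[_ wS] cu kk ag tv.
exact: large_S (kick_size wS kk) (agree_union ag cu) tv.
Qed.

(** An inactive giant keeps the configuration in [high_S]. An active one puts at least [th n]
    vertices into [A], which [size_ge] turns into a supercritical density. *)
Lemma high_calm_S w A v : w \in high_G -> cluster_union w A ->
  calm q K0 d w A -> agree A w v -> typ A v -> v \in high_S.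
Proof.
rewrite inE => /existsP[x /andP[jx rest]] cu nr ag tv.
have [xA|xA] := boolP (x \in A); last first.
  by apply: (@giant_S v x); rewrite (agree_cl ag cu xA).
apply: large_S (agree_union ag cu) tv.
have clA := cluster_union_cl cu xA.
have clK0 : cl w x \subset big K0 w by apply/cl_big/(leq_ltn_trans _ jx)/(leq_trans K0K).
have lo := near_ge nr.
apply: (@size_ge (#|cl w x|%:R) _ _ _ _ (le_trans (lerD (lexx _) lo) _)).
- apply: le_trans (_ : j%:R <= _); last by rewrite ler_nat ltnW.
  by apply: le_trans th_j; rewrite lerDl mulr_ge0.
- rewrite card_big_compl.
  have bE : (#|cl w x| + #|big K0 w :\: cl w x| = #|big K0 w|)%N.
    by rewrite -(cardsID (cl w x) (big K0 w)) (setIidPr clK0).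
  have {}bE : #|big K0 w|%:R = #|cl w x|%:R + #|big K0 w :\: cl w x|%:R :> R by rewrite -natrD bE.
  rewrite bE; move: rest; move: (#|_|%:R : R) (#|_|%:R : R) => u t; lra.
- rewrite -natrD ler_nat -(cardsID (big K0 w) A) setDE leq_add2r subset_leq_card //.
  by rewrite subsetI clA.
Qed.

Lemma high_upd_S w e b : w \in high_G -> upd w e b \in high_S.
Proof.
rewrite !inE => /existsP[x /andP[jx _]].
have := card_cl_upd w e b K x; rewrite -(ler_nat R) natrD natrM => le1.
have : j%:R <= #|cl w x|%:R :> R by rewrite ler_nat ltnW.
move: le1 th_j; move: (#|_|%:R : R) (#|_|%:R : R) => u t; lra.
Qed.

Lemma high_S_neq0 : (K < n)%N -> th <= 1 -> high_S != set0.
Proof.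
move=> Kn th1; apply/set0Pn; exists [ffun=> true]; rewrite inE.
have -> : big K ([ffun=> true] : config n) = setT.
  apply/setP => x; rewrite !in_set.
  suff -> : cl ([ffun=> true] : config n) x = setT by rewrite cardsT card_ord.
  apply/setP => y; rewrite !inE; have [->|xy] := eqVneq x y; first exact: connect0.
  apply/connect1/adjP; have [lt|lt|/val_inj eq] := ltngtP x y.
  - by exists (exist _ (x, y) lt); [rewrite ffunE | left].
  - by exists (exist _ (y, x) lt); [rewrite ffunE | right].
  - by rewrite eq eqxx in xy.
by rewrite cardsT card_ord ger_pMl.
Qed.

End Supercritical.

(** * Asymptotics *)

Lemma nat_ge (x : R) : exists N : nat, x <= N%:R.
Proof. by exists (Num.bound `|x|); apply/ltW/(le_lt_trans (ler_norm x))/archi_boundP. Qed.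

Lemma nat_ceil (x : R) : 0 <= x -> exists2 j : nat, x <= j%:R & j%:R <= x + 1.
Proof.
move=> x0; have [N xN] := nat_ge x.
have exN : exists m : nat, (x <= m%:R)%R by exists N.
case: (ex_minnP exN) => j xj jmin; exists j => //.
case: j xj jmin => [|j] xj jmin; first by lra.
rewrite -natr1 lerD2r leNgt; apply/negP => /ltW /jmin.
by rewrite ltnn.
Qed.

Lemma eventually_ge (x : R) : exists N : nat, forall n, (N <= n)%N -> x <= n%:R.
Proof.
by have [N xN] := nat_ge x; exists N => n Nn; apply: le_trans xN _; rewrite ler_nat.
Qed.

Lemma exp_decay (C c s : R) : 0 <= C -> 0 < c -> 0 < s ->
  exists N : nat, forall n, (N <= n)%N -> C * exp (- (c * n%:R)) <= s.
Proof.
move=> C0 c0 s0; have [N Nge] := eventually_ge (C / (c * s)); exists N => n /Nge.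
rewrite ler_pdivrMr ?mulr_gt0 // expN => h.
rewrite ler_pdivrMr ?exp_gt0 //.
have e := exp_ge1Dx (c * n%:R); have := ler_wpM2l (ltW s0) e.
have := ltW s0; lra.
Qed.

Lemma succ_le_exp (c : R) n : 0 < c -> n.+1%:R <= (1 + c^-1) * exp (c * n%:R).
Proof.
move=> c0; have ci : 0 < c^-1 by rewrite invr_gt0.
apply: (@le_trans _ _ ((1 + c^-1) * (1 + c * n%:R))); last first.
  by apply: ler_wpM2l (exp_ge1Dx _); lra.
have cc : c^-1 * c = 1 by rewrite mulVf // lt0r_neq0.
have -> : (1 + c^-1) * (1 + c * n%:R) = 1 + c * n%:R + c^-1 + (c^-1 * c) * n%:R by ring.
have := mulr_ge0 (ltW c0) (ler0n R n); rewrite cc -natr1; lra.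
Qed.

(** * Probability of atypical graphs *)

Section Typicality.

Variables (n : nat) (p a a' : R) (r r0 : nat).
Hypotheses (p01 : 0 <= p <= 1).

Definition typ2 (A : {set 'I_n}) (w : config n) :=
  typical p a [set B : {set 'I_n} | (#|B| <= r)%N] A w && typical p a' [set seed r0 A] A w.

(* [2 / a^2] is an exponent [b] for which [exp (- b) <= a^2 / 2]. *)
Lemma typ2_atypical (c : R) : 0 < a <= 1 / 2 -> 0 < a' <= 1 / 2 ->
  2 / a ^+ 2 * r%:R <= a ^+ 2 / 2 * n%:R -> 0 < c -> 2 * c <= a ^+ 2 -> 2 * c <= a' ^+ 2 ->
  forall A w, res_mean p A w (fun v => (~~ typ2 A v)%:R) <=
    2 * (1 + c^-1) * exp (- (c * n%:R)).
Proof.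
move=> /andP[a0 a1] /andP[a'0 a'1] rle c0 ca ca' A w.
have h1 : 0 <= a <= 1 / 2 by rewrite ltW.
have h2 : 0 <= a' <= 1 / 2 by rewrite ltW.
have n0 : 0 <= n%:R :> R by apply: ler0n.
have le1 := atypical_le p01 h1 [set B : {set 'I_n} | (#|B| <= r)%N] A w.
have le2 := atypical_le p01 h2 [set seed r0 A] A w; rewrite cards1 mul1r in le2.
have a2 : 0 < a ^+ 2 by apply: exprn_gt0.
have b0 : 0 <= 2 / a ^+ 2 by rewrite divr_ge0 // ltW.
have card := card_small_sets 'I_n r b0; rewrite card_ord in card.
have eb : exp (- (2 / a ^+ 2)) <= a ^+ 2 / 2.
  rewrite expN -[leRHS]invrK lef_pV2 ?posrE ?exp_gt0 ?invr_gt0 ?divr_gt0 //.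
  by rewrite invf_div; apply: le_trans (exp_ge1Dx _); rewrite lerDr.
have card' : #|[set B : {set 'I_n} | (#|B| <= r)%N]|%:R <= exp (a ^+ 2 * n%:R).
  apply: le_trans card _; apply: ler_exp.
  have := ler_wpM2r n0 eb; move: rle; lra.
have bound : exp (- (2 * c * n%:R)) * n.+1%:R <= (1 + c^-1) * exp (- (c * n%:R)).
  have := ler_wpM2l (exp_ge0 (- (2 * c * n%:R))) (succ_le_exp n c0).
  rewrite mulrCA -expD.
  by have -> : - (2 * c * n%:R) + c * n%:R = - (c * n%:R) by ring.
apply: (@le_trans _ _ (exp (- (2 * c * n%:R)) * n.+1%:R + exp (- (2 * c * n%:R)) * n.+1%:R)); last first.
  by apply: le_trans (lerD bound bound) _; rewrite -[leRHS]mulrA [leRHS]mulr_natl [leRHS]mulr2n.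
apply: (@le_trans _ _ (res_mean p A w (fun v =>
    (~~ typical p a [set B : {set 'I_n} | (#|B| <= r)%N] A v)%:R) +
  res_mean p A w (fun v => (~~ typical p a' [set seed r0 A] A v)%:R))).
  rewrite /res_mean -big_split /=; apply: ler_sum => v _; rewrite -mulrDr.
  apply: ler_wpM2l; first exact: res_ge0.
  by rewrite /typ2 negb_and -natrD ler_nat; case: (typical _ _ _ _ _); case: (typical _ _ _ _ _).
apply: lerD.
  apply: le_trans le1 _; rewrite mulrAC; apply: ler_wpM2r => //.
  apply: le_trans (ler_wpM2r (exp_ge0 _) card') _.
  rewrite -expD; apply: ler_exp; have := ler_wpM2r n0 ca; lra.
apply: le_trans le2 _; rewrite mulrC; apply: ler_wpM2r => //.
apply: ler_exp; have := ler_wpM2r n0 ca'; have := mulr_ge0 (sqr_ge0 a') n0; lra.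
Qed.

End Typicality.

Definition trapped n (lam q : R) (S : {set config n}) (eps : R) :=
  \sum_(w in S) fk_pi lam q w * (\sum_(v in ~: S) glauber lam q w v) <=
    eps * \sum_(w in S) fk_pi lam q w /\
  \sum_(w in S) fk_pi lam q w * (\sum_(v in ~: S) chayes_machta lam q w v) <=
    eps * \sum_(w in S) fk_pi lam q w.

(* Quantified over all large [K], so that two phases can be compared at the same [K]. *)
Definition metastable (lam q : R) (Bd : forall n, nat -> config n -> Prop) :=
  exists K1 : nat, forall K, (K1 <= K)%N -> exists C c : R, [/\ 0 <= C, 0 < c &
  exists N : nat, forall n, (N <= n)%N -> exists S : {set config n},
    [/\ S != set0, forall w, w \in S -> Bd n K w & trapped lam q S (C * exp (- (c * n%:R)))]].

Lemma half_rate (q c N k : R) : 2 * q <= c * k -> 0 <= N -> q * N <= c / 2 * N * k.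
Proof. by move=> h N0; have := ler_wpM2r N0 h; lra. Qed.

Lemma rate_le (c1 c2 N x : R) : 0 <= N -> c2 <= c1 / 2 -> x <= c1 / 2 * N ->
  - (c1 * N) + x <= - (c2 * N).
Proof. by move=> N0 c12 xN; have := ler_wpM2r N0 c12; lra. Qed.

Lemma glauber_coef (C u y : R) : C * u <= C * y -> 0 <= C * y -> 0 <= y ->
  4 * (C * u) <= (5 * C + 2) * y.
Proof. by move=> *; lra. Qed.

Lemma chayes_machta_coef (C u v y z : R) : C * u <= C * y -> C * v <= C * y -> z <= y ->
  0 <= y -> 4 * (C * u) + (C * v + 2 * z) <= (5 * C + 2) * y.
Proof. by move=> *; lra. Qed.

Section Assembly.

Variables (lam q : R) (K0 K : nat) (d C1 c1 c2 : R).
Hypotheses (lam0 : 0 < lam) (q1 : 1 < q) (d01 : 0 < d <= 1) (K00 : (0 < K0)%N) (K0K : (K0 <= K)%N).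
Hypotheses (C10 : 0 <= C1) (c10 : 0 < c1) (Kq : 2 * q <= c1 * K.+1%:R).
Hypotheses (c2a : c2 <= c1 / 2) (c2b : c2 <= d ^+ 2 / (8 * K0%:R)).

(** By [Kq], half of the rate [c1] pays for [exp (q n / (K + 1))]. The constant [5 C1 + 2] collects
    [4 eps exp x], [eps] and the failure of [calm]. *)
Lemma assemble : exists N : nat, forall n, (N <= n)%N ->
  forall (typ : {set 'I_n} -> config n -> bool) (S G : {set config n}),
  (forall A w, res_mean (lam / n%:R) A w (fun v => (~~ typ A v)%:R) <= C1 * exp (- (c1 * n%:R))) ->
  (forall w A, w \in S :\: G -> cluster_union w A -> kick q K0 K d w A -> ~~ typ A w) ->
  (forall w A v, w \in S :\: G -> cluster_union w A ->
     kick q K0 K d w A -> agree A w v -> typ A v -> v \in S) ->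
  (forall w A v, w \in G -> cluster_union w A ->
     calm q K0 d w A -> agree A w v -> typ A v -> v \in S) ->
  (forall w e b, w \in G -> upd w e b \in S) ->
  trapped lam q S ((5 * C1 + 2) * exp (- (c2 * n%:R))).
Proof.
case/andP: (d01) => d0 d1.
have K0' : 0 < K%:R :> R by rewrite ltr0n; apply: leq_trans K0K.
have K00' : 0 < K0%:R :> R by rewrite ltr0n.
have cK : 0 < d ^+ 2 / (8 * K%:R) by apply: divr_gt0; rewrite ?exprn_gt0 ?mulr_gt0.
have half0 : 0 < 1 / 2 :> R by lra.
have four0 : 0 <= 4 :> R by lra.
have [N1 H1] := exp_decay four0 cK half0.
have [N2 H2] := exp_decay C10 c10 half0.
have [N3 H3] := eventually_ge (lam + 1).
exists (N1 + N2 + N3 + 2)%N => n Nn typ S G atyp Ha Hb Hc Hd.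
have n1 : (1 < n)%N by apply: leq_trans Nn; rewrite leq_addl.
have nN1 : (N1 <= n)%N by apply: leq_trans Nn; rewrite -!addnA leq_addr.
have nN2 : (N2 <= n)%N by apply: leq_trans Nn; rewrite addnC addnCA -!addnA addnCA leq_addr.
have nN3 : (N3 <= n)%N by apply: leq_trans Nn; rewrite [(_ + N3)%N]addnC -!addnA leq_addr.
have lamn : lam < n%:R by apply: lt_le_trans (H3 n nN3); rewrite ltrDl.
have n0 : 0 <= n%:R :> R by apply: ler0n.
have {H1} H1 := H1 n nN1; have {H2} H2 := H2 n nN2.
have kick_small : 4 * exp (- (d ^+ 2 * n%:R / (8 * K%:R))) <= 1 / 2 by rewrite mulrAC.
have eps0 : 0 <= C1 * exp (- (c1 * n%:R)) by rewrite mulr_ge0 // exp_ge0.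
have d01' : 0 <= d <= 1 by rewrite ltW.
have gt := glauber_trap n1 lam0 lamn q1 d01' K00 K0K kick_small atyp H2 Ha Hb Hd.
have ct := chayes_machta_trap n1 lam0 lamn q1 d01' K00 K0K kick_small atyp eps0 H2 Ha Hb Hc.
have pi0 : 0 <= \sum_(w in S) fk_pi lam q w.
  by apply: sumr_ge0 => w _; apply/ltW/fk_pi_gt0 => //; exact: ltnW.
have xle : q * n%:R / K.+1%:R <= c1 / 2 * n%:R.
  by rewrite ler_pdivrMr ?ltr0n //; apply: half_rate.
have e1 : exp (- (c1 * n%:R)) * exp (q * n%:R / K.+1%:R) <= exp (- (c2 * n%:R)).
  by rewrite -expD; apply: ler_exp; apply: rate_le n0 c2a xle.
have e2 : exp (- (c1 * n%:R)) <= exp (- (c2 * n%:R)).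
  rewrite -[X in exp X]addr0; apply: ler_exp; apply: rate_le n0 c2a _.
  by rewrite mulr_ge0 // divr_ge0 // ltW.
have e3 : exp (- (d ^+ 2 * n%:R / (8 * K0%:R))) <= exp (- (c2 * n%:R)).
  by apply: ler_exp; rewrite mulrAC lerN2; apply: ler_wpM2r.
have f1 := ler_wpM2l C10 e1; have f2 := ler_wpM2l C10 e2.
have e0 := exp_ge0 (- (c2 * n%:R)); have f0 := mulr_ge0 C10 e0.
split; [apply: le_trans gt _ | apply: le_trans ct _]; apply: ler_wpM2r => //.
  by apply: le_trans (glauber_coef f1 f0 e0); rewrite !mulrA.
by apply: le_trans (chayes_machta_coef f1 f2 e3 e0); rewrite !mulrA.
Qed.

End Assembly.

Lemma scale_exists (a : R) : 0 < a -> exists2 K0 : nat, (0 < K0)%N &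
  forall n, (K0 < n)%N -> exists r : nat, [/\ (n <= K0.+1 * r)%N, r%:R <= a * n%:R &
    2 / a ^+ 2 * r%:R <= a ^+ 2 / 2 * n%:R].
Proof.
move=> a0; have a2 : 0 < a ^+ 2 by apply: exprn_gt0.
(* The first summand gives [r <= a n], the second [r <= a^4 n / 4]; both allow for the factor 2 lost
   when [n / (K0 + 1)] is rounded up. *)
have [K1 K1ge] := nat_ge (2 / a + 8 / (a ^+ 2 * a ^+ 2)).
exists K1.+1 => // n Kn; exists (n %/ K1.+2).+1.
have n0 : 0 <= n%:R :> R by apply: ler0n.
have rL : (n %/ K1.+2).+1%:R * K1.+2%:R <= 2 * n%:R :> R.
  rewrite -natrM -natrM ler_nat mulSn mul2n -addnn.
  by apply: leq_add => //; exact: leq_trunc_div.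
have Lge : 2 / a + 8 / (a ^+ 2 * a ^+ 2) <= K1.+2%:R.
  by apply: le_trans K1ge _; rewrite ler_nat ltnW.
have key (b : R) : 0 < b -> 2 / b <= K1.+2%:R -> (n %/ K1.+2).+1%:R <= b * n%:R.
  move=> b0 bL; rewrite -(ler_pM2r (divr_gt0 (ltr0n R 2) b0)).
  apply: (@le_trans _ _ (2 * n%:R)); last first.
    by rewrite le_eqVlt; apply/orP; left; apply/eqP; field; rewrite lt0r_neq0.
  by apply: le_trans rL; apply: ler_wpM2l.
have u0 : 0 < 2 / a by apply: divr_gt0.
have v0 : 0 < 8 / (a ^+ 2 * a ^+ 2) by rewrite divr_gt0 // mulr_gt0.
split.
- by rewrite mulnC ltnW // ltn_ceil.
- by apply: key a0 _; apply: le_trans Lge; rewrite lerDl ltW.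
have b0 : 0 < a ^+ 2 * a ^+ 2 / 4 by rewrite divr_gt0 // mulr_gt0.
have bL : 2 / (a ^+ 2 * a ^+ 2 / 4) <= K1.+2%:R.
  apply: le_trans Lge; have -> : 2 / (a ^+ 2 * a ^+ 2 / 4) = 8 / (a ^+ 2 * a ^+ 2).
    by field; rewrite lt0r_neq0.
  by rewrite lerDr ltW.
rewrite mulrAC ler_pdivrMr // mulrC.
have := key _ b0 bL; move: (_.+1%:R : R) (n%:R : R) (a ^+ 2) => r N b; lra.
Qed.

(** * Choice of the constants and metastability of each phase *)

Lemma low_constants (lam q th : R) : 0 < lam -> lam < q -> 1 < q -> 0 < th ->
  exists x2 d1 s a : R,
    [/\ lam * x2 < 1, 0 < s <= 1, 0 < a <= 1 / 2, 5 * a <= s * (1 - lam * x2) &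
     [/\ d1 + q^-1 + s <= x2, s + q * (s + s) + s <= d1 & d1 < th]].
Proof.
move=> lam0 lamq q1 th0; have q0 : 0 < q by apply: lt_trans q1.
(* Half of [1 / lam - 1 / q]: an active set of density up to [q^-1 + e] is still subcritical. *)
pose e := (q - lam) / (2 * lam * q).
have e0 : 0 < e.
  by apply: divr_gt0; [rewrite subr_gt0 | apply: mulr_gt0 => //; apply: mulr_gt0].
have x2E : lam * (q^-1 + e) = 1 - (q - lam) / (2 * q).
  by rewrite /e; field; rewrite !lt0r_neq0.
have g0 : 0 < (q - lam) / (2 * q) by rewrite divr_gt0 ?subr_gt0 // mulr_gt0.
pose d1 := Num.min (e / 2) (th / 2).
have d10 : 0 < d1 by rewrite /d1 lt_min; apply/andP; split; apply: divr_gt0.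
have d1e : d1 <= e / 2 by rewrite /d1 ge_min lexx.
have d1t : d1 <= th / 2 by rewrite /d1 ge_min lexx orbT.
have q2 : 0 < 2 + 2 * q by lra.
(* [s] serves both as [eta] and as [d]; the core bound [s + q (s + s)] plus [eta] is then
   [(2 + 2 q) s]. *)
pose s := Num.min (d1 / (2 + 2 * q)) 1.
have s0 : 0 < s by rewrite /s lt_min divr_gt0 //= ltr01.
have s1 : s <= 1 by rewrite /s ge_min lexx orbT.
have sd : (2 + 2 * q) * s <= d1 by rewrite mulrC -ler_pdivlMr // /s ge_min lexx.
pose a := Num.min (s * ((q - lam) / (2 * q)) / 5) (1 / 2).
have sg : 0 < s * ((q - lam) / (2 * q)) by apply: mulr_gt0.
have a0 : 0 < a by rewrite /a lt_min; apply/andP; split; apply: divr_gt0.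
have a1 : a <= 1 / 2 by rewrite /a ge_min lexx orbT.
have ag : a <= s * ((q - lam) / (2 * q)) / 5 by rewrite /a ge_min lexx.
have qs : 0 <= q * s by apply: mulr_ge0; exact: ltW.
exists (q^-1 + e), d1, s, a; rewrite x2E; clearbody a s d1.
move: ((q - lam) / (2 * q)) g0 ag => g g0 ag.
split; rewrite ?s0 ?s1 ?a0 ?a1 //; first by lra.
  by rewrite subKr; move: ag; move: (s * _) => y; lra.
split; last by lra.
  by move: (q^-1) => y; lra.
by lra.
Qed.

Lemma low_phase (lam q th : R) : 0 < lam -> lam < q -> 1 < q -> 0 < th ->
  exists2 d1 : R, d1 < th & metastable lam q (fun n K w => #|big K w|%:R <= d1 * n%:R).
Proof.
move=> lam0 lamq q1 th0.
have [x2 [d1 [s [a [x2_lt s01 a01 a_eta [d1_x2 sd1 d1th]]]]]] := low_constants lam0 lamq q1 th0.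
exists d1 => //; case/andP: (s01) => s0 s1; case/andP: (a01) => a0 a1.
have [K0 K00 scale] := scale_exists a0.
have q0 : 0 < q by apply: lt_trans q1.
set d2 := s + q * (s + s) in sd1.
have d20 : 0 <= d2 by rewrite /d2; apply: addr_ge0; [|apply: mulr_ge0; [|apply: addr_ge0]]; exact: ltW.
pose c1 := a ^+ 2 / 2.
have c10 : 0 < c1 by rewrite divr_gt0 // exprn_gt0.
have c1a : 2 * c1 <= a ^+ 2 by rewrite /c1; lra.
have [K1 K1ge] := nat_ge (2 * q / c1).
exists (maxn K0 K1) => K; rewrite geq_max => /andP[K0K K1K].
have Kq : 2 * q <= c1 * K.+1%:R.
  rewrite [leRHS]mulrC -ler_pdivrMr // (le_trans K1ge) // ler_nat.
  exact: leq_trans K1K (leqnSn _).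
pose C1 := 2 * (1 + c1^-1).
have C10 : 0 <= C1 by rewrite /C1 mulr_ge0 // addr_ge0 // invr_ge0 ltW.
pose c2 := Num.min (c1 / 2) (s ^+ 2 / (8 * K0%:R)).
have K00' : 0 < K0%:R :> R by rewrite ltr0n.
have c20 : 0 < c2 by rewrite /c2 lt_min divr_gt0 //= divr_gt0 ?exprn_gt0 // mulr_gt0.
have c2a : c2 <= c1 / 2 by rewrite /c2 ge_min lexx.
have c2b : c2 <= s ^+ 2 / (8 * K0%:R) by rewrite /c2 ge_min lexx orbT.
have [N1 asm] := assemble lam0 q1 s01 K00 K0K C10 c10 Kq c2a c2b.
have [N2 N2ge] := eventually_ge lam.
have [N3 N3ge] := eventually_ge (2 * K0%:R / s).
exists (5 * C1 + 2), c2; split => //; first by rewrite addr_ge0 // mulr_ge0.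
exists (maxn N1 (maxn N2 (maxn N3 K0.+1))) => n; rewrite !geq_max.
case/and4P => nN1 /N2ge lamn /N3ge flip0 K0n.
have n0 : (0 < n)%N by apply: leq_ltn_trans K0n.
have n0' : 0 < n%:R :> R by rewrite ltr0n.
have p01 : 0 <= lam / n%:R <= 1.
  by rewrite (divr_ge0 (ltW lam0) (ltW n0')) /= ler_pdivrMr // mul1r.
have flip : d2 * n%:R + 2 * K0%:R <= d1 * n%:R.
  move: flip0; rewrite ler_pdivrMr // [n%:R * s]mulrC => flip0.
  by apply: le_trans (lerD (lexx _) flip0) _; rewrite -mulrDl ler_wpM2r // ltW.
have [r [rK ra rc]] := scale n K0n.
exists (low_S n K d1); split.
- exact: low_S_neq0 n0 sd1 (ltW s0) d20 (leq_trans K00 K0K).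
- by move=> w; rewrite inE.
(* A seed of size 0 is empty and has drift 0. *)
have typE (A : {set 'I_n}) w : typ2 (lam / n%:R) a a r 0 A w ->
  typical (lam / n%:R) a [set B : {set 'I_n} | (#|B| <= r)%N] A w by case/andP.
apply: (asm n nN1 (@typ2 n (lam / n%:R) a a r 0) _ (low_G n K0 d2)).
- by have := typ2_atypical 0 p01 a01 a01 rc c10 c1a c1a.
- by have h := low_kick_atyp n0 p01 q1 rK ra lam0 a_eta x2_lt d1_x2 (lexx _) typE; apply: h.
- by have h := low_kick_S n0 p01 q1 K0K rK ra lam0 a_eta x2_lt d1_x2 sd1 d20 typE; apply: h.
- by have h := low_calm_S n0 p01 q1 K0K rK ra lam0 a_eta x2_lt d1_x2 sd1 (ltW s0) typE; apply: h.
- by have h := low_upd_S K0K flip; apply: h.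
Qed.

(* [z + q z / (e^z - 1) < lam] says exactly that exploring a fraction
   [th = z / lam] of the vertices of a supercritical active set of density
   [th + (1 - th) / q] discovers more than it uses. *)
Lemma surplus_gt0 (lam q z : R) : 0 < lam -> 1 < q -> 0 < z -> z + q * z / (exp z - 1) < lam ->
  0 < (z / lam + (1 - z / lam) / q) * (1 - exp (- z)) - z / lam.
Proof.
move=> lam0 q1 z0 hz; have q0 : 0 < q by apply: lt_trans q1.
have e1 : 0 < exp z - 1 by have := exp_ge1Dx z; lra.
have e0 := exp_gt0 z.
rewrite expN.
have -> : (z / lam + (1 - z / lam) / q) * (1 - (exp z)^-1) - z / lam =
    ((lam + (q - 1) * z) * (exp z - 1) - q * z * exp z) / (q * lam * exp z).
  by field; rewrite !lt0r_neq0.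
apply: divr_gt0; last by apply: mulr_gt0 => //; apply: mulr_gt0.
have : (z + q * z / (exp z - 1)) * (exp z - 1) < lam * (exp z - 1) by rewrite ltr_pM2r.
rewrite mulrDl divfK ?lt0r_neq0 //; move: (exp z) => x; lra.
Qed.

Lemma high_constants (lam q z : R) : 0 < lam -> 1 < q -> 0 < z -> z + q * z / (exp z - 1) < lam ->
  exists th th1 x1 g s a : R,
  [/\ lam * th = z, 0 < th, th < th1, th1 <= 1 & 0 < x1] /\
  [/\ g <= x1 * (1 - exp (- z)) - th1, 0 < g <= 1, 0 < s <= 1, 2 * s <= th &
      x1 <= th + (1 - th - (s + q * (s + s))) / q - s] /\
  [/\ 0 < a <= 1 / 2, 4 * a <= s * g, 4 * a <= g & 9 * a <= th * (g - 4 * a)].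
Proof.
move=> lam0 q1 z0 hz; have c0 := surplus_gt0 lam0 q1 z0 hz.
have q0 : 0 < q by apply: lt_trans q1.
have th0 : 0 < z / lam by apply: divr_gt0.
have th1 : z / lam <= 1.
  rewrite ler_pdivrMr // mul1r ltW // (lt_trans _ hz) // ltrDl.
  apply: divr_gt0; first exact: mulr_gt0.
  by have := exp_ge1Dx z; lra.
have lth : lam * (z / lam) = z by rewrite mulrC divfK // lt0r_neq0.
move: (z / lam) c0 th0 th1 lth => th c0 th0 th1 lth.
have E0 := exp_ge0 (- z).
have E1 : exp (- z) <= 1 by rewrite -exp0; apply: ler_exp; lra.
pose x0 := th + (1 - th) / q; rewrite -/x0 in c0.
have qi1 : q^-1 <= 1 by rewrite invf_le1 // ltW.
have qi0 : 0 < q^-1 by rewrite invr_gt0.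
have x01 : x0 <= 1.
  by have : (1 - th) / q <= 1 - th by [rewrite ler_piMr // subr_ge0]; rewrite /x0; lra.
have x0th : th <= x0 by rewrite /x0 lerDl divr_ge0 ?subr_ge0 // ltW.
have x00 : 0 < x0 by lra.
pose c := x0 * (1 - exp (- z)) - th; rewrite -/c in c0.
have cx : c <= x0 - th by rewrite /c; have := mulr_ge0 (ltW x00) E0; lra.
(* The surplus [c] is shared out: [c / 4] raises [th] to [th1], [c / 4] lowers the density [x0], and
   [c / 2] remains as [g]. The 16 keeps the loss of density [s / q + 3 s] below [c / 4]. *)
pose s := Num.min (c / 16) (th / 2).
have s0 : 0 < s by rewrite /s lt_min; apply/andP; split; apply: divr_gt0.
have sc : s <= c / 16 by rewrite /s ge_min lexx.
have st : s <= th / 2 by rewrite /s ge_min lexx orbT.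
clearbody s.
pose g := c / 2.
pose a := Num.min (Num.min (s * g / 4) (g / 8)) (Num.min (th * g / 18) (1 / 2)).
have g0 : 0 < g by apply: divr_gt0.
have sg0 : 0 < s * g by apply: mulr_gt0.
have tg0 : 0 < th * g by apply: mulr_gt0.
have a0 : 0 < a by rewrite /a !lt_min; apply/andP; split; apply/andP; split; apply: divr_gt0.
have [as1 as2 as3 as4] : [/\ a <= s * g / 4, a <= g / 8, a <= th * g / 18 & a <= 1 / 2].
  by rewrite /a !ge_min !lexx /= !orbT.
clearbody a.
exists th, (th + c / 4), (x0 - c / 4), g, s, a; split; [|split].
- by split => //; lra.
- split.
  + have -> : (x0 - c / 4) * (1 - exp (- z)) - (th + c / 4) = c / 2 + exp (- z) * (c / 4).
      have cE : x0 * (1 - exp (- z)) = c + th by rewrite /c subrK.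
      by rewrite mulrBl cE; clearbody c; lra.
    by rewrite /g lerDl mulr_ge0 // divr_ge0 // ltW.
  + by rewrite g0 /= /g; lra.
  + by rewrite s0 /=; lra.
  + lra.
  + have -> : th + (1 - th - (s + q * (s + s))) / q - s = x0 - s / q - 3 * s.
      by rewrite /x0; field; rewrite lt0r_neq0.
    have : s / q <= s by rewrite ler_piMr // ltW.
    move: (s / q) => y; lra.
- split; [by rewrite a0 | lra | lra |].
  have := ler_wpM2l (ltW th0) as2; lra.
Qed.

Lemma high_phase (lam q z : R) : 0 < lam -> 1 < q -> 0 < z -> z + q * z / (exp z - 1) < lam ->
  exists2 th : R, 0 < th & metastable lam q (fun n K w => th * n%:R <= #|big K w|%:R).
Proof.
move=> lam0 q1 z0 hz.
have [th [th1 [x1 [g [s [a [[lth th0 thth1 th11 x10]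
  [[gx g01 s01 s2 x1s] [a01 asg ag atg]]]]]]]]] := high_constants lam0 q1 z0 hz.
exists th => //; case/andP: (s01) => s0 s1; case/andP: (a01) => a0 a1; case/andP: (g01) => g0 g1.
have eta_th : s <= th by lra.
have th_1 : th <= 1 by lra.
have [K0 K00 scale] := scale_exists a0.
have q0 : 0 < q by apply: lt_trans q1.
set d2 := s + q * (s + s) in x1s.
have d20 : 0 <= d2 by rewrite /d2; apply: addr_ge0; [|apply: mulr_ge0; [|apply: addr_ge0]]; exact: ltW.
(* [1 / L] is the density of the seed: the first summand gives [K0 r0 <= s n], the second
   [r0 <= x1 n]. *)
have [L' L'ge] := nat_ge (K0%:R / s + x1^-1).
pose L := L'.+1.
have L0 : 0 < L%:R :> R by rewrite ltr0n.
have Lge : K0%:R / s + x1^-1 <= L%:R by apply: le_trans L'ge _; rewrite ler_nat.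
have K0s0 : 0 <= K0%:R / s by rewrite divr_ge0 // ltW.
have LK : K0%:R <= s * L%:R.
  rewrite [leRHS]mulrC -ler_pdivrMr //; apply: le_trans Lge.
  by rewrite lerDl invr_ge0 ltW.
have Lx : 1 <= x1 * L%:R.
  rewrite [leRHS]mulrC -ler_pdivrMr // div1r; apply: le_trans Lge.
  by rewrite lerDr.
(* Rounding leaves [r0 >= n / (2 L)], so that [4 a' n <= g r0]. *)
pose a' := g / (8 * L%:R).
have a'0 : 0 < a' by apply: divr_gt0 => //; apply: mulr_gt0.
have L1 : 1 <= L%:R :> R by rewrite (ler_nat R 1).
have a'1 : a' <= 1 / 2.
  by rewrite /a' ler_pdivrMr ?mulr_gt0 //; move: L1; move: (L%:R : R) => l; lra.
have a'01 : 0 < a' <= 1 / 2 by rewrite a'0.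
pose c1 := Num.min (a ^+ 2) (a' ^+ 2) / 2.
have c10 : 0 < c1 by rewrite /c1 divr_gt0 // lt_min !exprn_gt0.
have c1E : 2 * c1 = Num.min (a ^+ 2) (a' ^+ 2) by rewrite /c1 mulrC divfK // lt0r_neq0.
have c1a : 2 * c1 <= a ^+ 2 by rewrite c1E ge_min lexx.
have c1a' : 2 * c1 <= a' ^+ 2 by rewrite c1E ge_min lexx orbT.
have [K1 K1ge] := nat_ge (2 * q / c1).
exists (maxn K0 K1) => K; rewrite geq_max => /andP[K0K K1K].
have Kq : 2 * q <= c1 * K.+1%:R.
  rewrite [leRHS]mulrC -ler_pdivrMr // (le_trans K1ge) // ler_nat.
  exact: leq_trans K1K (leqnSn _).
pose C1 := 2 * (1 + c1^-1).
have C10 : 0 <= C1 by rewrite /C1 mulr_ge0 // addr_ge0 // invr_ge0 ltW.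
pose c2 := Num.min (c1 / 2) (s ^+ 2 / (8 * K0%:R)).
have K00' : 0 < K0%:R :> R by rewrite ltr0n.
have c20 : 0 < c2 by rewrite /c2 lt_min divr_gt0 //= divr_gt0 ?exprn_gt0 // mulr_gt0.
have c2a : c2 <= c1 / 2 by rewrite /c2 ge_min lexx.
have c2b : c2 <= s ^+ 2 / (8 * K0%:R) by rewrite /c2 ge_min lexx orbT.
have [N1 asm] := assemble lam0 q1 s01 K00 K0K C10 c10 Kq c2a c2b.
have [N2 N2ge] := eventually_ge lam.
have [N3 N3ge] := eventually_ge ((3 * K%:R + 1) / (th1 - th)).
exists (5 * C1 + 2), c2; split => //; first by rewrite addr_ge0 // mulr_ge0.
exists (maxn N1 (maxn N2 (maxn N3 (maxn K0.+1 (maxn K.+1 L))))) => n; rewrite !geq_max.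
case/and5P => nN1 /N2ge lamn /N3ge room K0n /andP[Kn Ln].
have n0 : (0 < n)%N by apply: leq_ltn_trans K0n.
have n0' : 0 < n%:R :> R by rewrite ltr0n.
have p01 : 0 <= lam / n%:R <= 1.
  by rewrite (divr_ge0 (ltW lam0) (ltW n0')) /= ler_pdivrMr // mul1r.
have [r [rK ra rc]] := scale n K0n.
have thn : 0 <= th * n%:R by rewrite mulr_ge0 // ltW.
have th3K : 0 <= th * n%:R + 3 * K%:R by rewrite addr_ge0 // mulr_ge0.
(* The summand [3 K] is what a single flip may cost; being bounded in [n], it keeps [j] below
   [th1 n]. *)
have [j th_j j_th] := nat_ceil th3K.
have thn_j : th * n%:R <= j%:R by apply: le_trans th_j; rewrite lerDl mulr_ge0.
have j_th1 : j%:R <= th1 * n%:R.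
  apply: le_trans j_th _; move: room; rewrite ler_pdivrMr ?subr_gt0 // mulrBr ![n%:R * _]mulrC.
  by rewrite lerBrDl addrA.
have jn : (j <= n)%N by rewrite -(ler_nat R) (le_trans j_th1) // ger_pMl.
have Kj : (K <= j)%N.
  rewrite -(ler_nat R); apply: le_trans th_j; apply: (@le_trans _ _ (3 * K%:R)).
    by rewrite ler_peMl // (ler_nat R 1).
  by rewrite lerDr.
have gam_j : g * n%:R <= x1 * n%:R * (1 - (1 - lam / n%:R) ^+ j) - j%:R.
  (* [1 - lam / n <= exp (- lam / n)], and [j >= th n = z n / lam]. *)
  have pj : (1 - lam / n%:R) ^+ j <= exp (- z).
    apply: (@le_trans _ _ (exp (- (lam / n%:R)) ^+ j)).
      apply: lerXn2r; rewrite ?nnegrE ?exp_ge0 //; last exact: exp_ge1Dx.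
      by rewrite subr_ge0; case/andP: p01.
    rewrite -expM_nat; apply: ler_exp; rewrite mulNr lerN2 -lth -mulrA.
    by apply: ler_wpM2l; [exact: ltW | rewrite mulrC ler_pdivlMr].
  apply: (@le_trans _ _ (x1 * n%:R * (1 - exp (- z)) - th1 * n%:R)).
    by have := ler_wpM2r (ltW n0') gx; rewrite mulrBl [_ * _ * n%:R]mulrAC.
  apply: lerB => //; apply: ler_wpM2l; first by rewrite mulr_ge0 // ltW.
  by rewrite lerD2l lerN2.
have eta_j : 2 * s * n%:R <= j%:R by apply: le_trans thn_j; apply: ler_wpM2r => //; exact: ltW.
have a_j : 9 * a * n%:R <= j%:R * (g - 4 * a).
  apply: (@le_trans _ _ (th * n%:R * (g - 4 * a))).
    by rewrite [leRHS]mulrAC; apply: ler_wpM2r => //; exact: ltW.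
  by apply: ler_wpM2r => //; rewrite subr_ge0.
pose r0 := (n %/ L)%N.
have r0L : r0%:R * L%:R <= n%:R :> R by rewrite -natrM ler_nat leq_trunc_div.
have r00 : (0 < r0)%N by rewrite divn_gt0.
have r0L2 : n%:R <= 2 * (r0%:R * L%:R) :> R.
  rewrite -natrM -natrM ler_nat; apply: leq_trans (ltnW (ltn_ceil n (ltn0Sn L'))) _.
  rewrite mulnA leq_mul2r; apply/orP; right; rewrite mul2n -addnn.
  exact: (leq_add r00 (leqnn r0)).
have a'_r0 : 4 * a' * n%:R <= g * r0%:R.
  have -> : 4 * a' * n%:R = g / (2 * L%:R) * n%:R by rewrite /a'; field; rewrite lt0r_neq0.
  rewrite mulrAC ler_pdivrMr ?mulr_gt0 // -mulrA; apply: ler_wpM2l; first exact: ltW.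
  by rewrite mulrCA.
have K0r0 : K0%:R * r0%:R <= s * n%:R.
  apply: (@le_trans _ _ (s * (r0%:R * L%:R))); last by apply: ler_wpM2l => //; exact: ltW.
  by rewrite [r0%:R * _]mulrC mulrA; apply: ler_wpM2r.
have r0_j : s * n%:R + K0%:R * r0%:R <= j%:R.
  apply: le_trans (lerD (lexx _) K0r0) _; apply: le_trans eta_j.
  by rewrite -[leRHS]mulrA [leRHS]mulr_natl [leRHS]mulr2n.
have r0_x1 : r0%:R <= x1 * n%:R.
  apply: (@le_trans _ _ (x1 * (r0%:R * L%:R))); last by apply: ler_wpM2l => //; exact: ltW.
  by rewrite [r0%:R * _]mulrC mulrA ler_peMl.
exists (high_S n K th); split.
- exact: high_S_neq0 n0 Kn th_1.
- by move=> w; rewrite inE.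
have typE (A : {set 'I_n}) w : typ2 (lam / n%:R) a a' r r0 A w ->
  typical (lam / n%:R) a [set B : {set 'I_n} | (#|B| <= r)%N] A w by case/andP.
have typE' (A : {set 'I_n}) w : typ2 (lam / n%:R) a a' r r0 A w ->
  typical (lam / n%:R) a' [set seed r0 A] A w by case/andP.
apply: (asm n nN1 (@typ2 n (lam / n%:R) a a' r r0) _ (high_G n K0 j d2)).
- by have := typ2_atypical r0 p01 a01 a'01 rc c10 c1a c1a'.
- by have h := high_kick_atyp n0 p01 q1 K0K Kj rK ra jn gam_j s0 asg ag eta_j a_j eta_th d20
    (lexx _) x1s typE; apply: h.
- by have h := high_kick_S n0 p01 q1 Kj rK ra jn gam_j s0 (ltW g0) asg ag eta_j a_j a'_r0 r00
    r0_j r0_x1 th_j d20 x1s typE typE'; apply: h.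
- by have h := high_calm_S n0 p01 q1 K0K Kj rK ra jn gam_j s0 (ltW g0) asg ag eta_j a_j a'_r0 r00
    r0_j r0_x1 th_j x1s typE typE'; apply: h.
- by have h := high_upd_S th_j; apply: h.
Qed.

(** * From two traps to the mixing time *)

Lemma exp_le_time (D c : R) (n t : nat) : 0 <= D -> 12 * D * exp (- (c / 2 * n%:R)) <= 1 ->
  1 <= 12 * (D * exp (- (c * n%:R))) * t%:R -> exp (c / 2 * n%:R) <= t%:R.
Proof.
move=> D0 small; have e0 := exp_gt0 (- (c / 2 * n%:R)).
(* Half of the exponent absorbs the constant [12 D]. *)
have -> : exp (- (c * n%:R)) = exp (- (c / 2 * n%:R)) * exp (- (c / 2 * n%:R)).
  by rewrite -expD; congr exp; lra.
have -> : exp (c / 2 * n%:R) = (exp (- (c / 2 * n%:R)))^-1 by rewrite expN invrK.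
move: (exp _) e0 small (ler0n R t) => x x0 small t0 h.
rewrite -div1r ler_pdivrMr //.
have := ler_wpM2r (mulr_ge0 (ltW x0) t0) small; lra.
Qed.

Lemma trapped_pair (lam q d th : R) : 0 < lam -> 1 < q -> d < th ->
  metastable lam q (fun n K w => #|big K w|%:R <= d * n%:R) ->
  metastable lam q (fun n K w => th * n%:R <= #|big K w|%:R) ->
  exists D c : R, [/\ 0 <= D, 0 < c & exists N, forall n, (N <= n)%N ->
    exists S S' : {set config n}, [/\ S != set0, S' != set0, [disjoint S & S'],
      trapped lam q S (D * exp (- (c * n%:R))) & trapped lam q S' (D * exp (- (c * n%:R)))]].
Proof.
move=> lam0 q1 dth [K1 low] [K2 high].
(* At a common [K] the two sets constrain the same quantity, so [d < th] makes them disjoint. *)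
have [C [c [C0 c0 [N H]]]] := low (maxn K1 K2) (leq_maxl _ _).
have [C' [c' [C'0 c'0 [N' H']]]] := high (maxn K1 K2) (leq_maxr _ _).
have [N3 N3ge] := eventually_ge (lam + 1).
exists (C + C'), (Num.min c c'); split; first exact: addr_ge0.
  by rewrite lt_min c0.
exists (maxn (maxn N N') (maxn N3 1)) => n; rewrite !geq_max => /andP[/andP[nN nN'] /andP[/N3ge lamn n0]].
have [S [S0 SB trS]] := H n nN; have [S' [S'0 S'B trS']] := H' n nN'.
have n0' : 0 < n%:R :> R by rewrite ltr0n.
have lam_n : lam < n%:R by apply: lt_le_trans lamn; rewrite ltrDl.
have weaken (U : {set config n}) (A a : R) : 0 <= A -> A <= C + C' -> Num.min c c' <= a ->
    trapped lam q U (A * exp (- (a * n%:R))) ->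
    trapped lam q U ((C + C') * exp (- (Num.min c c' * n%:R))).
  move=> A0 AC ac [t1 t2].
  have pi0 : 0 <= \sum_(w in U) fk_pi lam q w.
    by apply: sumr_ge0 => w _; apply/ltW/fk_pi_gt0.
  have le_rate : A * exp (- (a * n%:R)) <= (C + C') * exp (- (Num.min c c' * n%:R)).
    apply: ler_pM => //; first exact: exp_ge0.
    by apply: ler_exp; rewrite lerN2; apply: ler_wpM2r.
  by split; [apply: le_trans t1 _ | apply: le_trans t2 _]; apply: ler_wpM2r.
exists S, S'; split => //.
- apply/pred0P => w /=; apply/negbTE/negP => /andP[/SB lo /S'B hi].
  by have := le_trans hi lo; rewrite ler_pM2r // leNgt dth.
- by apply: weaken trS; rewrite ?lerDl // ge_min lexx.
- by apply: weaken trS'; rewrite ?lerDr // ge_min lexx orbT.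
Qed.

(** The minimiser is the witness. It cannot be 0, where the value is [q > lam > ls]. *)
Lemma ordered_solution (q lam ls : R) : is_lambda_s q ls -> ls < lam -> lam < q ->
  exists2 z : R, 0 < z & z + q * z / (exp z - 1) < lam.
Proof.
move=> [[z [/RleP z0 hz]] _] lsl lamq; move: hz; rewrite /lam_s_fun.
case: Req_dec_T => /= [z_eq hq|zn hz].
  by have := lt_trans lsl lamq; rewrite -hq ltxx.
exists z; first by rewrite lt0r z0 andbT; apply/eqP.
have e : z + q * z / (exp z - 1) = ls by rewrite -hz RdivE.
by rewrite e.
Qed.

Lemma lambda_s_gt0 (q ls : R) : 0 < q -> is_lambda_s q ls -> 0 < ls.
Proof.
move=> q0 [[z [/RleP z0 <-]] _]; rewrite /lam_s_fun; case: Req_dec_T => /= [//|/eqP zn].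
have z_gt0 : 0 < z by rewrite lt0r zn.
rewrite RdivE; apply: addr_gt0 => //; apply: divr_gt0; first exact: mulr_gt0.
by rewrite subr_gt0 (lt_le_trans _ (exp_ge1Dx z)) // ltrDl.
Qed.

Lemma tmix_lower_bounds (q lam ls : R) : 2 < q -> is_lambda_s q ls -> ls < lam -> lam < q ->
  exists (c : R) (N : nat), 0 < c /\ forall n, (N <= n)%N ->
    tmix_ge (@glauber n lam q) (@fk_pi n lam q) (exp (c * n%:R)) /\
    tmix_ge (@chayes_machta n lam q) (@fk_pi n lam q) (exp (c * n%:R)).
Proof.
move=> q2 ils lsl lamq; have q1 : 1 < q by apply: lt_trans q2; rewrite (ltr_nat R 1 2).
have q0 : 0 < q by apply: lt_trans q1.
have lam0 : 0 < lam := lt_trans (lambda_s_gt0 q0 ils) lsl.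
have [z z0 hz] := ordered_solution ils lsl lamq.
have [th th0 high] := high_phase lam0 q1 z0 hz.
have [d dth low] := low_phase lam0 lamq q1 th0.
have [D [c [D0 c0 [N HN]]]] := trapped_pair lam0 q1 dth low high.
have D12 : 0 <= 12 * D by apply: mulr_ge0.
have c20 : 0 < c / 2 by apply: divr_gt0.
have [N1 N1le] := exp_decay D12 c20 ltr01.
have [N2 N2ge] := eventually_ge (lam + 1).
exists (c / 2), (maxn N (maxn N1 (maxn N2 2))); split => // n; rewrite !geq_max.
case/and4P => nN /N1le small /N2ge lamn n1.
have n0 : (0 < n)%N := ltnW n1.
have lam_n : lam < n%:R by apply: lt_le_trans lamn; rewrite ltrDl.
have [S [S' [S0 S'0 dis [gS cS] [gS' cS']]]] := HN n nN.
have pi_gt0 := fk_pi_gt0 n0 lam0 lam_n q1.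
have pi_sum := fk_pi_sum n0 lam0 lam_n q1.
split=> t mix; apply/RleP; rewrite INRE; apply: exp_le_time D0 small _.
  exact: (@two_traps _ (@glauber n lam q) (@fk_pi n lam q) (glauber_ge0 n0 lam0 lam_n q1)
    (fun w => glauber_row n0 lam0 lam_n q1 w n1) pi_gt0 pi_sum (glauber_rev lam q)
    S S' t _ S0 S'0 dis gS gS' mix).
exact: (@two_traps _ (@chayes_machta n lam q) (@fk_pi n lam q) (chayes_machta_ge0 n0 lam0 lam_n q1)
  (chayes_machta_row lam q) pi_gt0 pi_sum (chayes_machta_rev lam q1)
  S S' t _ S0 S'0 dis cS cS' mix).
Qed.

#[local] Arguments exp x%_R_scope.
Local Open Scope R_scope.

Theorem theorem2 (q lam ls : R) :
  2 < q -> is_lambda_s q ls -> ls < lam -> lam < q ->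
  (exists c : R, 0 < c /\ exists N0 : nat, forall n : nat, (N0 <= n)%N ->
     tmix_ge (@glauber n lam q) (@fk_pi n lam q) (exp (c * INR n))) /\
  (exists c : R, 0 < c /\ exists N0 : nat, forall n : nat, (N0 <= n)%N ->
     tmix_ge (@chayes_machta n lam q) (@fk_pi n lam q) (exp (c * INR n))).
Proof.
move=> /RltP q2 ils /RltP lsl /RltP lamq.
have [c [N [c0 slow]]] := tmix_lower_bounds q2 ils lsl lamq.
by split; exists c; (split; first exact/RltP); exists N => n /slow[gl cm]; rewrite INRE.
Qed.
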